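(* Let $G=G(V,\omega,\gamma)$ be an oscillator group embedded in a standard oscillator group $G_A$, with Lie algebra $\mathfrak g$, assume that $D(V)\subset V$ is dense, and let $\pi:G\to U(\mathcal H)$ be a smooth unitary representation. Then the support function satisfies $$s_\pi(t,x,s)=s_\pi\Big(t-\frac{\|x\|^2}{2s},0,s\Big)$$ for all $(t,x,s)\in\mathfrak g$ with $s\neq0$. Moreover $s_\pi|_{B(I_\pi)^0}$ is continuous when $V$ is equipped with the $\|\cdot\|$-topology.
   Context: Oscillator group: $(V,\omega)$ is a locally convex symplectic (real) vector space, $V\ne0$, $\gamma:\mathbb R\to\mathrm{Sp}(V,\omega)$ a one-parameter group defining a smooth action of $\mathbb R$ on $V$, $D=\gamma'(0)$. $G(V,\omega,\gamma)=\mathbb R\times V\times\mathbb R$ with $(t,x,s)(t',x',s')=(t+t'+\frac12\omega(x,\gamma(s)x'),x+\gamma(s)x',s+s')$; its Lie algebra is $\mathfrak g=\mathbb R\times V\times\mathbb R$ with $[(t,v,s),(t',v',s')]=(\omega(v,v'),sDv'-s'Dv,0)$. It is always assumed that for each $x\in V$ the curve $t\mapsto\gamma(t)x$ has a $V$-valued smooth antiderivative, so $G$ has an exponential map. Standard oscillator group: let $H_A\neq 0$ be a complex Hilbert space, $A\ge 0$ self-adjoint on $H_A$ with $\ker A=0$, $\gamma_A(t)=e^{itA}$, $V_A=C^\infty(A)=\bigcap_k\mathcal D(A^k)$ with the $C^\infty$-topology (seminorms $\|A^kx\|$), $\omega_A(x,y)=\mathrm{Im}\langle Ax,y\rangle$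 (inner product linear in the first argument). $G_A=G(V_A,\omega_A,\gamma_A)$, with Lie algebra $\mathfrak g_A=\mathbb R\times V_A\times\mathbb R$. Embedding (standing assumption): there is a continuous linear injection $V\hookrightarrow V_A$ with dense range, regarded as an inclusion, such that the corresponding inclusions $G\hookrightarrow G_A$ and $\mathfrak g\hookrightarrow\mathfrak g_A$ (identity on the $\mathbb R$-factors) are morphisms of Lie groups and Lie algebras; thus $\omega=\omega_A|_{V\times V}$, $\gamma(t)=\gamma_A(t)|_V$. The topology of $V$ may be finer than that induced from $V_A$. $\|\cdot\|$ is the norm of $H_A$. Representations: a unitary representation $\pi:G\to U(\mathcal H)$ on a complex Hilbert space is smooth if $\mathcal H^\infty=\{v: g\mapsto\pi(g)v \text{ smooth}\}$ is dense. For $x\in\mathfrak g$, $\mathtt{d}\pi(x)v=\frac{d}{dt}|_{t=0}\pi(\exp(tx))v$ on $\mathcal H^\infty$ is essentially skew-adjoint; spectra refer to closures. The support function is $s_\pi:\mathfrak g\to\mathbb R\cup\{\infty\}$, $s_\pi(x)=\sup\mathrm{Spec}(i\,\mathtt{d}\pi(x))$ (so $\mathcal H\ne\{0\}$). $B(I_\pi)=\{x\in\mathfrak g: s_\pi(x)<\infty\}$ and $B(I_\pi)^0$ is its interior in $\mathfrak g$. *)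

(* Defs.v *)
From HB Require Import structures.
From mathcomp Require Import all_boot all_order all_algebra sesquilinear.
From mathcomp Require Import complex.
From mathcomp Require Import interval_inference all_classical all_reals.
From mathcomp Require Import ereal topology tvs normedtype convex.

Set Implicit Arguments.
Unset Strict Implicit.
Unset Printing Implicit Defensive.

Import Order.TTheory GRing.Theory Num.Theory.
Import numFieldNormedType.Exports.

Local Open Scope classical_set_scope.
Local Open Scope ring_scope.
Local Open Scope complex_scope.

(* [{dot H for conj}] is linear in its first argument *)
HB.mixin Record isHilbert (R : realType) H & CompleteNormedModule R[i] H := {
  ip : {dot H for (@Num.conj R[i])} ;
  ip_norm : forall x : H, ip x x = `|x| ^+ 2 }.

#[short(type="hilbertType")]
HB.structure Definition Hilbert (R : realType) :=
  {H of CompleteNormedModule R[i] H & isHilbert R H}.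

Definition hnorm (R : realType) (H : hilbertType R) (x : H) : R :=
  complex.Re `|x|.

Section hnorm.
Context (R : realType) (H : hilbertType R).
Implicit Types x y : H.

Lemma hnormE x : `|x| = (hnorm x)%:C.
Proof.
rewrite /hnorm; have := normr_ge0 x; rewrite lecE /= => /andP[/eqP x0 _].
by case: `|x| x0 => a b /= ->.
Qed.

Lemma hnorm_ge0 x : 0 <= hnorm x.
Proof. by rewrite -lecR -hnormE; exact: normr_ge0. Qed.

Lemma hnormD x y : hnorm (x + y) <= hnorm x + hnorm y.
Proof. by rewrite -lecR rmorphD /= -!hnormE ler_normD. Qed.

Lemma hnormZ (a : R) x : hnorm (a%:C *: x) = `|a| * hnorm x.
Proof.
suff: (hnorm (a%:C *: x))%:C = (`|a| * hnorm x)%:C by case.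
rewrite rmorphM /= -!hnormE normrZ; congr (_ * _).
by rewrite normc_def /= expr0n /= addr0 sqrtr_sqr.
Qed.

Lemma hnorm0 : hnorm (0 : H) = 0.
Proof. by rewrite /hnorm normr0. Qed.

Lemma hnormN x : hnorm (- x) = hnorm x.
Proof. by rewrite /hnorm normrN. Qed.

Lemma cvg_hnorm (T : Type) (F : set_system T) (FF : Filter F) (f : T -> H)
    (l : H) :
  f @ F --> l <-> forall e : R, 0 < e -> \forall t \near F, hnorm (l - f t) < e.
Proof.
split=> [/cvgrPdist_lt fl e e0|fl].
  have e0' : 0 < e%:C :> R[i] by rewrite ltcR.
  by apply: filterS (fl _ e0') => t; rewrite hnormE ltcR.
apply/cvgrPdist_lt => e; rewrite ltcE /= => /andP[/eqP e2 e1].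
apply: filterS (fl _ e1) => t; rewrite hnormE ltcE /= e2 => ->.
by rewrite eqxx.
Qed.

End hnorm.

(* a complex locally convex space with the scalars restricted to [R] *)
Definition realify (R : realType) (E : tvsType R[i]) : Type := E.

Section realify.
Context (R : realType) (E : tvsType R[i]).

HB.instance Definition _ := Uniform.copy (realify E) E.
HB.instance Definition _ := TopologicalZmodule.copy (realify E) E.

Let scale (a : R) (x : realify E) : realify E := a%:C *: (x : E).

Let scaleA a b v : scale a (scale b v) = scale (a * b) v.
Proof. by rewrite /scale scalerA rmorphM. Qed.

Let scale1 : left_id 1 scale.
Proof. by move=> v; rewrite /scale rmorph1 scale1r. Qed.

Let scaleDr : right_distributive scale +%R.
Proof. by move=> a u v; rewrite /scale scalerDr. Qed.

Let scaleDl v : {morph scale^~ v : a b / a + b}.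
Proof. by move=> a b; rewrite /scale rmorphD scalerDl. Qed.

HB.instance Definition _ := GRing.Zmodule_isLmodule.Build R (realify E)
  scaleA scale1 scaleDr scaleDl.

Lemma real_complex_continuous :
  continuous ((fun a : R => a%:C) : R^o -> R[i]^o).
Proof.
move=> a; apply/cvgrPdist_lt => /= e; rewrite ltcE /= => /andP[/eqP e2 e1].
near=> b; rewrite -rmorphB normc_def /= expr0n /= addr0 sqrtr_sqr ltcE /= e2.
rewrite eqxx /=; near: b; exact: (@cvgr_dist_lt R R^o).
Unshelve. all: by end_near. Qed.

Let realify_scale_continuous :
  continuous (fun z : R^o * realify E => z.1 *: z.2).
Proof.
move=> z; apply: (@continuous2_cvg _ R[i]^o E E _ _
  (fun z : R^o * realify E => (z.1)%:C) (fun z => z.2) *:%R).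
- exact: (@scale_continuous R[i] E ((z.1)%:C, z.2)).
- apply: (@cvg_comp _ _ _ fst _ _ (nbhs (z.1 : R^o))).
    exact: (@cvg_fst _ _ (nbhs (z.1 : R^o)) (nbhs (z.2 : E)) _).
  exact: real_complex_continuous.
- exact: (@cvg_snd _ _ (nbhs (z.1 : R^o)) (nbhs (z.2 : E)) _).
Qed.

HB.instance Definition _ := TopologicalZmodule_isTopologicalLmodule.Build R
  (realify E) realify_scale_continuous.

Let realify_locally_convex : exists2 B : set_system (realify E),
  (forall b, b \in B -> convex_set b) & basis B.
Proof.
have [B Bconv Bbasis] := @locally_convex R[i] E.
exists B => // b bB x y k xb yb.
have k0 : 0 <= (k%:num)%:C :> R[i] by rewrite lecR.
have k1 : (k%:num)%:C <= 1 :> R[i] by rewrite lecR.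
suff -> : conv k x y = @conv R[i] (convex_lmodType E) (Itv01 k0 k1) x y.
  exact: Bconv.
transitivity ((k%:num)%:C *: (x : E) + (1 - (k%:num)%:C) *: (y : E)); last by [].
by rewrite -[in RHS](rmorph1 (real_complex R)) -rmorphB.
Qed.

HB.instance Definition _ :=
  Uniform_isTvs.Build R (realify E) realify_locally_convex.

End realify.

Section operators.
Context (R : realType) (H : hilbertType R).

Record operator := Operator { dom : set H ; opfun :> H -> H }.

Definition graph (T : operator) : set (H * H) :=
  [set p | dom T p.1 /\ p.2 = T p.1].

Definition linear_operator (T : operator) := dom T 0 /\
  forall (a : R[i]) x y, dom T x -> dom T y ->
    dom T (a *: x + y) /\ T (a *: x + y) = a *: T x + T y.

Definition selfadjoint (T : operator) :=
  [/\ linear_operator T, dense (dom T) &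
    forall y z, (dom T y /\ z = T y) <->
      (forall x, dom T x -> ip (T x) y = ip x z)].

Definition unitary (U : H -> H) :=
  [/\ linear U, bijective U & forall x y, ip (U x) (U y) = ip x y].

(* [U t = exp (i t A)] in the sense of Stone's theorem: [U] is the strongly
   continuous one-parameter group of unitaries with generator [i A] *)
Definition unitary_group_generated_by (A : operator) (U : R -> H -> H) :=
  [/\ forall t, unitary (U t),
      forall s t x, U (s + t) x = U s (U t x),
      forall x, continuous ((fun t => U t x) : R^o -> H) &
      forall x y, (dom A x /\ y = 'i%C *: A x) <->
        (fun t : R => (t^-1)%:C *: (U t x - x)) @ 0^' --> y].

Record standard := Standard {
  std_op :> operator ;
  std_exp : R -> H -> H ;
  std_nontrivial : exists x : H, x != 0 ;
  std_selfadjoint : selfadjoint std_op ;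
  std_ge0 : forall x, dom std_op x -> 0 <= ip (std_op x) x ;
  std_ker0 : forall x, dom std_op x -> std_op x = 0 -> x = 0 ;
  std_expP : unitary_group_generated_by std_op std_exp }.

End operators.

Section Cinfty.
Context (R : realType) (H : hilbertType R) (A : standard H).

(* [x] is in [dom (A ^ k)] for all [k] *)
Definition in_Cinfty : {pred realify H} :=
  fun x => `[< forall k, dom A (iter k A x) >].

Lemma in_CinftyP (x : H) :
  reflect (forall k, dom A (iter k A x)) (x \in in_Cinfty).
Proof. exact: asboolP. Qed.

Lemma iter_linear (a : R[i]) (x y : H) k : x \in in_Cinfty ->
  y \in in_Cinfty -> iter k A (a *: x + y) = a *: iter k A x + iter k A y.
Proof.
move=> /in_CinftyP Ax /in_CinftyP Ay; elim: k => //= k ->.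
have [[_ Alin] _ _] := std_selfadjoint A.
by have [] := Alin a _ _ (Ax k) (Ay k).
Qed.

Lemma in_Cinfty_linear (a : R[i]) (x y : H) : x \in in_Cinfty ->
  y \in in_Cinfty -> (a *: x + y) \in in_Cinfty.
Proof.
move=> xA yA; apply/in_CinftyP => k; rewrite iter_linear//.
have [[_ Alin] _ _] := std_selfadjoint A.
move: xA yA => /in_CinftyP Ax /in_CinftyP Ay.
by have [] := Alin a _ _ (Ax k) (Ay k).
Qed.

Lemma in_Cinfty0 : 0 \in in_Cinfty.
Proof.
have [[A0 Alin] _ _] := std_selfadjoint A.
have AA0 : A 0 = 0.
  have [_] := Alin (-1) _ _ A0 A0.
  by rewrite !scaleN1r !addNr.
by apply/in_CinftyP => k; rewrite iter_fix.
Qed.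

Let in_Cinfty_submod : submod_closed in_Cinfty.
Proof.
split=> [|a x y xA yA]; first exact: in_Cinfty0.
exact: in_Cinfty_linear.
Qed.

HB.instance Definition _ :=
  GRing.isSubmodClosed.Build R (realify H) in_Cinfty in_Cinfty_submod.

Definition Cinfty : Type := {x : realify H | x \in in_Cinfty}.

HB.instance Definition _ := [isSub of Cinfty for @sval _ _].
HB.instance Definition _ := [Choice of Cinfty by <:].
HB.instance Definition _ := [SubChoice_isSubLmodule of Cinfty by <:].

Definition Cinfty_incl (x : Cinfty) : H := \val x.

Implicit Types x y : Cinfty.

Let iter_Cinfty_linear (a : R) x y k :
  iter k A (Cinfty_incl (a *: x + y)) =
  a%:C *: iter k A (Cinfty_incl x) + iter k A (Cinfty_incl y).
Proof. exact: (iter_linear _ _ (svalP x) (svalP y)). Qed.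

Let iterD x y k : iter k A (Cinfty_incl (x + y)) =
  iter k A (Cinfty_incl x) + iter k A (Cinfty_incl y).
Proof. by rewrite -[x]scale1r iter_Cinfty_linear rmorph1 !scale1r. Qed.

Let iter0 k : iter k A (Cinfty_incl 0) = 0.
Proof. by apply: (@addrI _ (iter k A (Cinfty_incl 0))); rewrite -iterD !addr0. Qed.

Let iterZ (a : R) x k :
  iter k A (Cinfty_incl (a *: x)) = a%:C *: iter k A (Cinfty_incl x).
Proof. by rewrite -[a *: x]addr0 iter_Cinfty_linear iter0 addr0. Qed.

Let iterB x y k : iter k A (Cinfty_incl (x - y)) =
  iter k A (Cinfty_incl x) - iter k A (Cinfty_incl y).
Proof. by rewrite -scaleN1r iterD iterZ rmorphN1 scaleN1r. Qed.

(* the uniform structure of the seminorms [x |-> `|A ^ k x|] *)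
Definition Cinfty_entourage : set_system (Cinfty * Cinfty) :=
  filter_from [set ke : nat * R | 0 < ke.2]
    (fun ke => [set xy | forall j, (j <= ke.1)%N ->
      hnorm (iter j A (Cinfty_incl (xy.1 - xy.2))) < ke.2]).

Let ent_filter : Filter Cinfty_entourage.
Proof.
apply: filter_from_filter; first by exists (0%N, 1) => /=.
move=> [k e] [l f] /= e0 f0; exists (maxn k l, Num.min e f) => /=.
  by rewrite lt_min e0.
move=> xy /= xyP; split=> j jk.
- have := xyP j; rewrite leq_max jk => /(_ isT).
  by rewrite lt_min => /andP[].
- have := xyP j; rewrite leq_max jk orbT => /(_ isT).
  by rewrite lt_min => /andP[].
Qed.

Let ent_diagonal B : Cinfty_entourage B -> diagonal `<=` B.
Proof.
move=> [[k e] /= e0 eB] [x y] /diagonalP ->; apply: eB => /= j _.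
by rewrite subrr iter0 hnorm0.
Qed.

Local Open Scope relation_scope.

Let ent_inv B : Cinfty_entourage B -> Cinfty_entourage B^-1.
Proof.
move=> [[k e] /= e0 eB]; exists (k, e) => //= -[x y] /= xy.
by apply: eB => /= j jk; rewrite iterB -hnormN opprB -iterB; exact: xy.
Qed.

Let ent_split B :
  Cinfty_entourage B -> exists2 C, Cinfty_entourage C & C \; C `<=` B.
Proof.
move=> [[k e] /= e0 eB].
exists [set xy | forall j, (j <= k)%N ->
      hnorm (iter j A (Cinfty_incl (xy.1 - xy.2))) < e / 2].
  by exists (k, e / 2) => //=; rewrite divr_gt0.
move=> [x z] [y /= xy yz]; apply: eB => /= j jk.
rewrite -(subrKA y) iterD (le_lt_trans (hnormD _ _))// [ltRHS](splitr e).
by rewrite ltrD// (xy, yz).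
Qed.

Local Close Scope relation_scope.

HB.instance Definition _ := @isUniform.Build Cinfty Cinfty_entourage
  ent_filter ent_diagonal ent_inv ent_split.

Lemma nbhs_Cinfty x (B : set Cinfty) : nbhs x B <->
  exists k (e : R), 0 < e /\
    [set y | forall j, (j <= k)%N ->
      hnorm (iter j A (Cinfty_incl (x - y))) < e] `<=` B.
Proof.
split=> [[E [[k e] /= e0 eE] EB]|[k [e [e0 eB]]]].
  exists k, e; split=> // y xy; apply: EB; apply/xsectionP; exact: eE.
exists [set xy | forall j, (j <= k)%N ->
      hnorm (iter j A (Cinfty_incl (xy.1 - xy.2))) < e]; first by exists (k, e).
by move=> y /xsectionP; exact: eB.
Qed.

Lemma cvg_Cinfty (T : Type) (F : set_system T) (FF : Filter F)
    (f : T -> Cinfty) x :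
  f @ F --> x <->
  forall k, (fun t => iter k A (Cinfty_incl (f t))) @ F
            --> iter k A (Cinfty_incl x).
Proof.
split=> [fx k|fx B].
- apply/cvg_hnorm => e e0.
  have /fx : nbhs x [set y | hnorm (iter k A (Cinfty_incl (x - y))) < e].
    by apply/nbhs_Cinfty; exists k, e; split=> // y; apply.
  by move=> fP; apply: (@filterS _ F _ _ _ _ fP) => t /=; rewrite iterB.
- move=> /nbhs_Cinfty[k [e [e0 eB]]]; rewrite nbhs_simpl.
  suff : \forall t \near F, forall j, (j <= k)%N ->
      hnorm (iter j A (Cinfty_incl (x - f t))) < e.
    by apply: filterS => t ?; exact: eB.
  elim: k {eB} => [|k IH].
    have /cvg_hnorm/(_ _ e0) := fx 0%N.
    apply: filterS => t ft j; rewrite leqn0 => /eqP ->.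
    by rewrite iterB.
  have /cvg_hnorm/(_ _ e0) := fx k.+1.
  apply: filterS2 IH => t tk ft j; rewrite leq_eqVlt => /predU1P[->|].
    by rewrite iterB.
  exact: tk.
Qed.

Let add_cont : continuous (fun z : Cinfty * Cinfty => z.1 + z.2).
Proof.
move=> z; apply/cvg_Cinfty => k; rewrite iterD.
under [X in X @ _ --> _]eq_fun do rewrite iterD.
apply: cvgD.
- exact: (proj1 (@cvg_Cinfty _ (nbhs z) _ fst z.1) (@cvg_fst _ _ (nbhs z.1) (nbhs z.2) _)).
- exact: (proj1 (@cvg_Cinfty _ (nbhs z) _ snd z.2) (@cvg_snd _ _ (nbhs z.1) (nbhs z.2) _)).
Qed.

Let scale_cont : continuous (fun z : R^o * Cinfty => z.1 *: z.2).
Proof.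
move=> z; apply/cvg_Cinfty => k; rewrite iterZ.
under [X in X @ _ --> _]eq_fun do rewrite iterZ.
apply: cvgZ.
- apply: (@cvg_comp _ _ _ fst _ _ (nbhs (z.1 : R^o))).
    exact: (@cvg_fst _ _ (nbhs (z.1 : R^o)) (nbhs z.2) _).
  exact: real_complex_continuous.
- exact: (proj1 (@cvg_Cinfty _ (nbhs z) _ snd z.2) (@cvg_snd _ _ (nbhs (z.1 : R^o)) (nbhs z.2) _)).
Qed.

HB.instance Definition _ :=
  PreTopologicalNmodule_isTopologicalNmodule.Build Cinfty add_cont.
HB.instance Definition _ :=
  TopologicalNmodule_isTopologicalLmodule.Build R Cinfty scale_cont.

Let loc_convex : exists2 B : set_system Cinfty,
  (forall b, b \in B -> convex_set b) & basis B.
Proof.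
pose V x k (e : R) := [set y | forall j, (j <= k)%N ->
      hnorm (iter j A (Cinfty_incl (x - y))) < e].
exists [set B | exists x k e, B = V x k e].
  move=> B; rewrite inE => -[x [k [e ->]]] y z t.
  rewrite !inE => yx zx j jk.
  have -> : x - conv t (y : convex_lmodType Cinfty) z =
      t%:num *: (x - y) + (1 - t%:num) *: (x - z).
    rewrite !scalerBr addrACA -scalerDl [_ + (1 - _)]addrC subrK scale1r.
    by rewrite -opprD.
  rewrite iterD !iterZ (le_lt_trans (hnormD _ _))// !hnormZ.
  rewrite !ger0_norm ?subr_ge0//.
  have [->|t0] := eqVneq t%:num 0.
    by rewrite mul0r add0r subr0 mul1r; exact: zx.
  rewrite [ltRHS](_ : e = t%:num * e + (1 - t%:num) * e); last first.
    by rewrite -mulrDl addrC subrK mul1r.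
  rewrite ltr_leD//.
    have t_gt0 : 0 < t%:num by rewrite lt_neqAle eq_sym t0 /=.
    by rewrite ltr_pM2l//; exact: yx.
  by rewrite ler_wpM2l ?subr_ge0//; apply/ltW; exact: zx.
split.
  move=> B [x [k [e ->]]]; rewrite openE => y yV.
  apply/nbhs_Cinfty; exists k.
  pose m := \big[Num.max/0]_(j < k.+1) hnorm (iter j A (Cinfty_incl (x - y))).
  have mP j : (j <= k)%N -> hnorm (iter j A (Cinfty_incl (x - y))) <= m.
    by rewrite -ltnS => jk; exact: (le_bigmax _ _ (Ordinal jk)).
  have me : m < e.
    rewrite /m; apply: bigmax_lt => [|j _]; last by apply: yV; rewrite -ltnS.
    by rewrite (le_lt_trans (hnorm_ge0 _) (yV 0%N _)).
  exists (e - m); rewrite subr_gt0; split=> // z yz j jk.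
  rewrite -(subrKA y) iterD (le_lt_trans (hnormD _ _))//.
  by rewrite -[ltRHS](subrK m) addrC ltr_leD// ?yz ?mP.
move=> x B /nbhs_Cinfty[k [e [e0 eB]]].
exists (V x k e) => //; split; first by exists x, k, e.
by move=> j _; rewrite subrr iter0 hnorm0.
Qed.

HB.instance Definition _ := Uniform_isTvs.Build R Cinfty loc_convex.

Lemma std_exp_generator t (x : H) : dom A x ->
  dom A (std_exp A t x) /\ A (std_exp A t x) = std_exp A t (A x).
Proof.
have [Uu UD _ Ugen] := std_expP A.
have [Ulin _ Uip] := Uu t; pose U := std_exp A t.
have UB (y z : H) : U (y - z) = U y - U z.
  by rewrite -[- z]scaleN1r addrC /U Ulin scaleN1r addrC.
have UZ a (y : H) : U (a *: y) = a *: U y.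
  have U0 : U 0 = 0 by rewrite -[in LHS](subrr 0) UB subrr.
  by rewrite -[a *: y]addr0 /U Ulin -/U U0 addr0.
have Uiso (y : H) : hnorm (U y) = hnorm y.
  rewrite /hnorm; congr complex.Re.
  by apply/eqP; rewrite -(@eqrXn2 _ 2)// -!ip_norm Uip.
move=> Ax; have [/(_ (conj Ax erefl)) xcvg _] := Ugen x ('i%C *: A x).
suff /Ugen[AUx] : (fun s : R => (s^-1)%:C *: (std_exp A s (U x) - U x)) @ 0^'
    --> U ('i%C *: A x).
  have i0 : 'i%C != 0 :> R[i] by rewrite eq_complex /= oner_eq0 andbF.
  by rewrite UZ => /(scalerI i0) AUxE; split; [exact: AUx|exact/esym].
apply/cvg_hnorm => e e0; move/cvg_hnorm: xcvg => /(_ _ e0).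
apply: filterS => s /= xs.
have -> : U ('i%C *: A x) - (s^-1)%:C *: (std_exp A s (U x) - U x) =
    U ('i%C *: A x - (s^-1)%:C *: (std_exp A s x - x)).
  by rewrite UB (UZ (s^-1)%:C) UB /U -!UD [s + t]addrC.
by rewrite Uiso.
Qed.

Lemma std_exp_Cinfty t (x : H) :
  x \in in_Cinfty -> std_exp A t x \in in_Cinfty.
Proof.
move=> /in_CinftyP Ax; apply/in_CinftyP => k.
have -> : iter k A (std_exp A t x) = std_exp A t (iter k A x).
  by elim: k => //= k ->; have [] := std_exp_generator t (Ax k).
by have [] := std_exp_generator t (Ax k).
Qed.

Definition std_gamma (t : R) (x : Cinfty) : Cinfty :=
  exist _ (std_exp A t (\val x)) (std_exp_Cinfty t (valP x)).

Definition std_omega (x y : Cinfty) : R :=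
  complex.Im (ip (A (Cinfty_incl x)) (Cinfty_incl y)).

End Cinfty.

Section calculus.
Context (R : realType).

Definition diff_quotient (E F : tvsType R) (f : E -> F) (x h : E) (t : R) : F :=
  t^-1 *: (f (x + t *: h) - f x).

Definition dderivable (E F : tvsType R) (f : E -> F) (x h : E) : Prop :=
  exists l : F, diff_quotient f x h @ 0^' --> l.

Definition dderiv (E F : tvsType R) (f : E -> F) (x h : E) : F :=
  xget 0 [set l | diff_quotient f x h @ 0^' --> l].

(* [f] is of class C^n in the sense of Michal and Bastiani *)
Fixpoint Cn (n : nat) (E F : tvsType R) (f : E -> F) : Prop :=
  match n with
  | 0%N => continuous f
  | m.+1 => [/\ continuous f, forall x h, dderivable f x h &
                Cn m (fun p : E * E => dderiv f p.1 p.2)]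
  end.

Definition smooth (E F : tvsType R) (f : E -> F) : Prop := forall n, Cn n f.

End calculus.

Section oscillator.
Context (R : realType).
Local Notation osc V := (R^o * V * R^o)%type.

Section operations.
Context (V : tvsType R) (omega : V -> V -> R) (gamma : R -> V -> V).

Definition generator (x : V) : V := dderiv ((fun t => gamma t x) : R^o -> V) 0 1.

Definition group_mul (g h : osc V) : osc V :=
  let: (t, x, s) := g in let: (t', x', s') := h in
  (t + t' + 2^-1 * omega x (gamma s x'), x + gamma s x', s + s').

Definition lie_bracket (g h : osc V) : osc V :=
  let: (t, v, s) := g in let: (t', v', s') := h in
  (omega v v', s *: generator v' - s' *: generator v, 0).

Definition one_parameter_group (xi : osc V) (c : R^o -> osc V) : Prop :=
  [/\ smooth c, forall s t, c (s + t) = group_mul (c s) (c t) &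
      dderiv c 0 1 = xi].

(* a smooth one-parameter group is determined by its velocity at [0], and it
   exists for every [xi] when the curves [gamma t x] have smooth antiderivatives *)
Definition group_exp (xi : osc V) : osc V :=
  xget (fun=> 0) [set c | one_parameter_group xi c] 1.

End operations.

Record oscillator (V : tvsType R) := Oscillator {
  omega : V -> V -> R ;
  gamma : R -> V -> V ;
  osc_hausdorff : hausdorff_space V ;
  osc_nontrivial : exists x : V, x != 0 ;
  omega_continuous : continuous ((fun p => omega p.1 p.2) : V * V -> R^o) ;
  omega_linear : forall y (a : R) x x',
    omega (a *: x + x') y = a * omega x y + omega x' y ;
  omega_skew : forall x y, omega x y = - omega y x ;
  omega_nondegenerate : forall x, (forall y, omega x y = 0) -> x = 0 ;
  gamma_linear : forall t, linear (gamma t) ;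
  gamma_symplectic : forall t x y, omega (gamma t x) (gamma t y) = omega x y ;
  gamma0 : forall x, gamma 0 x = x ;
  gammaD : forall s t x, gamma (s + t) x = gamma s (gamma t x) ;
  gamma_smooth : smooth ((fun p => gamma p.1 p.2) : R^o * V -> V) ;
  gamma_antiderivative : forall x, exists2 b : R^o -> V, smooth b &
    forall t, dderiv b t 1 = gamma t x }.

Section embedding.
Context (V : tvsType R) (G : oscillator V).
Context (HA : hilbertType R) (A : standard HA).
Variable iota : {linear V -> Cinfty A}.

Definition osc_map (g : osc V) : osc (Cinfty A) := (g.1.1, iota g.1.2, g.2).

Record standard_embedding : Prop := StandardEmbedding {
  iota_injective : injective iota ;
  iota_continuous : continuous iota ;
  iota_dense : dense (range iota) ;
  osc_map_smooth : smooth osc_map ;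
  osc_map_mul : forall g h, osc_map (group_mul (omega G) (gamma G) g h) =
    group_mul (@std_omega _ _ A) (@std_gamma _ _ A) (osc_map g) (osc_map h) ;
  osc_map_bracket : forall xi eta,
    osc_map (lie_bracket (omega G) (gamma G) xi eta) =
    lie_bracket (@std_omega _ _ A) (@std_gamma _ _ A) (osc_map xi) (osc_map eta) }.

Definition norm_chart (xi : osc V) : R^o * HA * R^o :=
  (xi.1.1, Cinfty_incl (iota xi.1.2), xi.2).

(* neighborhoods in [R * V * R] when [V] carries the norm of [HA] instead of
   its own topology *)
Definition norm_nbhs (xi : osc V) : set_system (osc V) :=
  nbhs (xi : initial_topology norm_chart).

End embedding.

Section representation.
Context (V : tvsType R) (G : oscillator V) (H : hilbertType R).

Record unitary_rep := UnitaryRep {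
  rep :> osc V -> H -> H ;
  rep_unitary : forall g, unitary (rep g) ;
  rep_mul : forall g h v,
    rep (group_mul (omega G) (gamma G) g h) v = rep g (rep h v) }.

Variable pi : unitary_rep.

Definition smooth_vectors : set H :=
  [set v | smooth ((fun g => pi g v) : osc V -> realify H)].

Definition smooth_rep := dense smooth_vectors.

Definition derived_rep (xi : osc V) (v : H) : H :=
  dderiv ((fun t => pi (group_exp (omega G) (gamma G) (t *: xi)) v)
          : R^o -> realify H) 0 1.

Definition i_derived_rep (xi : osc V) : operator H :=
  Operator smooth_vectors (fun v => 'i%C *: derived_rep xi v).

(* for an operator given by its graph [T], [S] is the inverse of [T - l] *)
Definition spectrum (T : set (H * H)) : set R[i] :=
  ~` [set l | exists2 S : {linear H -> H}, continuous S &
                forall u v, S u = v <-> T (v, u + l *: v)].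

(* the closure of [i_derived_rep xi] is selfadjoint when [pi] is smooth, so its
   spectrum is real *)
Definition support_function (xi : osc V) : \bar R :=
  ereal_sup [set l%:E | l in
    [set l : R | spectrum (closure (graph (i_derived_rep xi))) l%:C]].

Definition support_domain : set (osc V) :=
  [set xi | (support_function xi < +oo)%E].

End representation.

End oscillator.

(* Main.v *)
(* The support function is the supremum, over smooth unit vectors [v], of the
   linear functionals [xi |-> <i dpi(xi) v, v>]: the operators [i dpi(xi)] are
   essentially selfadjoint on the smooth vectors, these being dense and
   invariant under the one-parameter group, so the supremum of the spectrum is
   that of the numerical range. Hence it is sublinear, lower semicontinuous and
   invariant under the adjoint action, which for [d = D y] gives
     Ad(y^-1) (t, x, s) = (t + <d, x> + s |d|^2 / 2, x + s d, s).
   By density of [D V] and lower semicontinuity the value does not increase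
   under this shear for any [d] in [V], and [d = - x / s], [d = x / s] yield
   the formula.
   At an interior point with [s <> 0] the formula reduces continuity to that of
   a convex function of two real variables. An interior point with [s = 0] forces
   the support function to be finite everywhere and bounded above by [K |s|],
   so that it tends to [0] there. *)
Require Import Defs.
From HB Require Import structures.
From mathcomp Require Import all_boot all_order all_algebra sesquilinear.
From mathcomp Require Import complex.
From mathcomp Require Import interval_inference all_classical all_reals.
From mathcomp Require Import ereal topology tvs normedtype convex.
From mathcomp Require Import derive realfun sequences exp ring lra.

Set Implicit Arguments.
Unset Strict Implicit.
Unset Printing Implicit Defensive.

Import Order.TTheory GRing.Theory Num.Theory.
Import numFieldNormedType.Exports.

Local Open Scope classical_set_scope.
Local Open Scope ring_scope.
Local Open Scope complex_scope.

(** * The real inner product of a complex Hilbert space *)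

Section real_inner_product.
Context (R : realType) (H : hilbertType R).
Implicit Types x y z : H.

(** The operators are reached only through [group_exp], a choice among one-parameter groups, so
    existence and uniqueness of these curves have to be settled first. [V] carries neither a norm
    nor a completeness that would support a theory of differential equations. Uniqueness is
    therefore moved along the embedding into [HA] and tested against single vectors, where the mean
    value theorem for real functions applies; the same device gives the chain rule, which is why it
    is stated for Hilbert-valued maps. Only real spectral parameters occur, so the real part [rip]
    of the inner product carries symmetry and orthogonality. The interior of the domain refers to
    the topology of [V], continuity to the coarser norm. The two meet because the interior is used
    only through small boxes in finitely many directions, where convexity works, while the formula
    moves all other vectors back at a cost that depends on the norm alone. At [s = 0] this transport
    breaks down. The denominator that causes this then becomes the tool: it produces arbitrarily
    large central shifts from bounded values. *)

Definition rip x y : R := complex.Re (ip x y).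

Lemma ReD (a b : R[i]) : complex.Re (a + b) = complex.Re a + complex.Re b.
Proof. by case: a b => [? ?] []. Qed.

Lemma ReM (a : R) (b : R[i]) : complex.Re (a%:C * b) = a * complex.Re b.
Proof. by case: b => b1 b2 /=; rewrite mul0r subr0. Qed.

Lemma ripC x y : rip x y = rip y x.
Proof.
rewrite /rip hermC expr0 mul1r /=.
have -> (z : R[i]) : complex.Re z^* = complex.Re z by case: z.
by [].
Qed.

Lemma ripDl x y z : rip (x + y) z = rip x z + rip y z.
Proof. by rewrite /rip linearDl ReD. Qed.

Lemma ripDr x y z : rip z (x + y) = rip z x + rip z y.
Proof. by rewrite !(ripC z) ripDl. Qed.

Lemma ripZl (a : R) x y : rip (a%:C *: x) y = a * rip x y.
Proof. by rewrite /rip linearZl_LR ReM. Qed.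

Lemma ripZr (a : R) x y : rip x (a%:C *: y) = a * rip x y.
Proof. by rewrite ripC ripZl ripC. Qed.

Lemma ripNl x y : rip (- x) y = - rip x y.
Proof. by rewrite -scaleN1r -(rmorphN1 (real_complex R)) ripZl mulN1r. Qed.

Lemma ripNr x y : rip x (- y) = - rip x y.
Proof. by rewrite ripC ripNl ripC. Qed.

Lemma ripBl x y z : rip (x - y) z = rip x z - rip y z.
Proof. by rewrite ripDl ripNl. Qed.

Lemma ripBr x y z : rip z (x - y) = rip z x - rip z y.
Proof. by rewrite ripDr ripNr. Qed.

Lemma rip0l x : rip 0 x = 0.
Proof. by rewrite -[0](subrr 0) ripBl subrr. Qed.

Lemma rip0r x : rip x 0 = 0.
Proof. by rewrite ripC rip0l. Qed.

Lemma rip_norm x : rip x x = hnorm x ^+ 2.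
Proof. by rewrite /rip ip_norm hnormE -rmorphXn. Qed.

Lemma ripJJ x y : rip ('i%C *: x) ('i%C *: y) = rip x y.
Proof.
rewrite /rip linearZl_LR linearZr_LR /= mulrA.
suff -> : 'i%C * ('i%C : R[i])^* = 1 :> R[i] by rewrite mul1r.
by rewrite /Num.conj /=; apply/eqP; rewrite eq_complex /=; apply/andP; split; apply/eqP; ring.
Qed.

Lemma scaleii x : 'i%C *: ('i%C *: x) = - x :> H.
Proof. by rewrite scalerA -expr2 sqr_i scaleN1r. Qed.

Lemma ripJl x y : rip ('i%C *: x) y = - rip x ('i%C *: y).
Proof. by rewrite -ripJJ scaleii ripNl. Qed.

Lemma Im_ip x y : complex.Im (ip x y) = rip x ('i%C *: y).
Proof.
have ReJ (z : R[i]) : complex.Re ('i%C * z) = - complex.Im z.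
  by case: z => a b /=; rewrite mul0r mul1r sub0r.
by rewrite -[RHS]opprK -ripJl /rip linearZl_LR ReJ opprK.
Qed.

Lemma hnorm_sqr0 x : hnorm x ^+ 2 <= 0 -> x = 0.
Proof.
move=> h; apply/normr0_eq0; rewrite hnormE.
have : hnorm x ^+ 2 == 0 by rewrite eq_le h sqr_ge0.
by rewrite sqrf_eq0 => /eqP ->.
Qed.

Lemma hnorm_eq0 x : hnorm x = 0 -> x = 0.
Proof. by move=> h; apply: hnorm_sqr0; rewrite h expr0n. Qed.

Lemma hnorm_gt0 x : x != 0 -> 0 < hnorm x.
Proof.
move=> x0; rewrite lt_neqAle hnorm_ge0 andbT eq_sym.
by apply: contraNneq x0 => /hnorm_eq0 ->.
Qed.

(** The case [r = 0] is included because the lemma also serves quadratic forms that are only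
    semidefinite. *)
Lemma discriminant_le (p q r : R) : 0 <= r ->
  (forall t, 0 <= p + 2 * t * q + t ^+ 2 * r) -> q ^+ 2 <= p * r.
Proof.
rewrite le_eqVlt => /predU1P[<- h|r0 h].
  have [->|q0] := eqVneq q 0; first by rewrite expr0n mulr0.
  (* At this [t] the affine function takes the value [-1]. *)
  have := h (- (p + 1) / (2 * q)).
  have -> : p + 2 * (- (p + 1) / (2 * q)) * q + (- (p + 1) / (2 * q)) ^+ 2 * 0 =
    - 1 by field.
  by move=> ?; lra.
have := h (- q / r).
have -> : p + 2 * (- q / r) * q + (- q / r) ^+ 2 * r = (p * r - q ^+ 2) / r.
  by field; rewrite gt_eqF.
by rewrite pmulr_lge0 ?invr_gt0// subr_ge0.
Qed.

Lemma rip_CauchySchwarz x y : `|rip x y| <= hnorm x * hnorm y.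
Proof.
rewrite -(@ler_pXn2r _ 2)// ?nnegrE// ?mulr_ge0 ?hnorm_ge0//.
rewrite real_normK ?num_real// exprMn -!rip_norm.
apply: discriminant_le => [|t]; first by rewrite rip_norm sqr_ge0.
suff -> : rip x x + 2 * t * rip x y + t ^+ 2 * rip y y =
    hnorm (x + t%:C *: y) ^+ 2 by rewrite sqr_ge0.
by rewrite -rip_norm !(ripDl, ripDr, ripZl, ripZr) (ripC y); ring.
Qed.

Lemma hnormB_sqr x y :
  hnorm (x - y) ^+ 2 = hnorm x ^+ 2 - 2 * rip x y + hnorm y ^+ 2.
Proof. by rewrite -!rip_norm !(ripBl, ripBr) (ripC y); ring. Qed.

Lemma hnormBC x y : hnorm (x - y) = hnorm (y - x).
Proof. by rewrite -(Defs.hnormN (x - y)) opprB. Qed.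

Lemma hnorm_dist (x y z : H) : hnorm (x - z) <= hnorm (x - y) + hnorm (y - z).
Proof. by rewrite (le_trans _ (Defs.hnormD _ _))// subrKA. Qed.

Lemma cvg_rip (T : Type) (F : set_system T) {FF : Filter F} (f g : T -> H)
    (l m : H) :
  f @ F --> l -> g @ F --> m -> (fun t => rip (f t) (g t)) @ F --> rip l m.
Proof.
move=> /cvg_hnorm fl /cvg_hnorm gm; apply/cvgrPdist_lt => e e0.
set K := hnorm l + hnorm m + 1.
have K1 : 1 <= K by rewrite lerDr addr_ge0 ?hnorm_ge0.
have d0 : 0 < Num.min 1 (e / (2 * K)).
  by rewrite lt_min ltr01 divr_gt0// mulr_gt0// (lt_le_trans _ K1).
apply: filterS2 (fl _ d0) (gm _ d0) => t /=; rewrite !lt_min => /andP[f1 f2] /andP[g1 g2].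
have -> : rip l m - rip (f t) (g t) = rip (l - f t) (g t) + rip l (m - g t).
  by rewrite ripBl ripBr; ring.
have gK : hnorm (g t) <= K.
  have := hnormB_sqr m (m - g t); rewrite opprB addrCA subrr addr0 => _.
  have : hnorm (g t) <= hnorm m + hnorm (m - g t).
    by rewrite -{1}[g t](subrK m) addrC (le_trans (Defs.hnormD _ _))// hnormBC.
  by rewrite /K; have := hnorm_ge0 l; lra.
have lK : hnorm l <= K by rewrite /K; have := hnorm_ge0 m; lra.
apply: le_lt_trans (ler_normD _ _) _.
have K0 : 0 < K by exact: lt_le_trans K1.
have h1 : `|rip (l - f t) (g t)| <= hnorm (l - f t) * K.
  by apply: le_trans (rip_CauchySchwarz _ _) _; rewrite ler_wpM2l ?hnorm_ge0.
have h2 : `|rip l (m - g t)| <= K * hnorm (m - g t).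
  by apply: le_trans (rip_CauchySchwarz _ _) _; rewrite ler_wpM2r ?hnorm_ge0.
have := ltrD (f2 : hnorm (l - f t) < _) (g2 : hnorm (m - g t) < _).
rewrite -(ltr_pM2r K0).
have -> : (e / (2 * K) + e / (2 * K)) * K = e by field; rewrite gt_eqF.
by move=> ?; nra.
Qed.

Lemma hilbert_complete (u : nat -> H) :
  (forall e : R, 0 < e -> exists N, forall m n, (N <= m)%N -> (N <= n)%N ->
    hnorm (u m - u n) < e) ->
  exists l : H, u @ \oo --> l.
Proof.
move=> uC; suff /cauchy_cvg/cvg_ex[l ul] : cauchy (u @ \oo) by exists l.
apply: cauchy_exP => e; rewrite ltcE /= => /andP[/eqP e2 e0].
have [N uN] := uC _ e0; exists (u N); exists N => // n /= Nn.
by rewrite -ball_normE /= hnormE ltcE /= e2 eqxx /= uN.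
Qed.

End real_inner_product.

(** * Curves in topological vector spaces *)

Section curves.
Context (R : realType).

Lemma near0P (P : set R) : (\forall h \near 0^', P h) <->
  exists2 e : R, 0 < e & forall h, `|h| < e -> h != 0 -> P h.
Proof.
split=> [/nbhs_ballP[e /= e0 eP]|[e e0 eP]].
  exists e => // h he h0; apply: eP => //.
  by rewrite /ball /= sub0r normrN.
apply/nbhs_ballP; exists e => //= h; rewrite /ball /= sub0r normrN => he h0.
exact: eP.
Qed.

Lemma cvg_dnbhs0M (c : R) : c != 0 -> (fun h : R => c * h) @ 0^' --> 0^'.
Proof.
move=> c0 P /near0P[e e0 eP]; apply/near0P; exists (e / `|c|).
  by rewrite divr_gt0// normr_gt0.
move=> h he h0; apply: eP; last by rewrite mulf_neq0.
by rewrite normrM mulrC -ltr_pdivlMr// normr_gt0.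
Qed.

Lemma eq_cvg_dnbhs0 (T : topologicalType) (f g : R -> T) (l : T) :
  (forall h, h != 0 -> f h = g h) -> g @ 0^' --> l -> f @ 0^' --> l.
Proof.
move=> fg gl A Al; have /near0P[e e0 eP] := gl _ Al.
by apply/near0P; exists e => // h he h0; rewrite /preimage /= fg//; exact: eP.
Qed.

Lemma cvg_dnbhs0 : (fun h : R => h) @ 0^' --> (0 : R).
Proof.
move=> P /nbhs_ballP[e /= e0 eP]; apply/near0P; exists e => // h he _.
by apply: eP; rewrite /ball /= sub0r normrN.
Qed.

(** A relation rather than a value: it asserts existence, and [l] is unique as soon as [V] is
    Hausdorff. *)
Definition has_deriv (V : tvsType R) (f : R -> V) (t : R) (l : V) : Prop :=
  (fun h : R => h^-1 *: (f (t + h) - f t)) @ 0^' --> l.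

Lemma tvs_cvgZ (V : tvsType R) (T : Type) (F : set_system T) {FF : Filter F}
    (a : T -> R) (f : T -> V) (b : R) (l : V) :
  a @ F --> b -> f @ F --> l -> (fun t => a t *: f t) @ F --> b *: l.
Proof.
move=> ab fl; apply: (@continuous2_cvg _ R^o V V F _ a f *:%R b l _ ab fl).
exact: (@scale_continuous R V (b, l)).
Qed.

Lemma tvs_cvgD (V : tvsType R) (T : Type) (F : set_system T) {FF : Filter F}
    (f g : T -> V) (l m : V) :
  f @ F --> l -> g @ F --> m -> (fun t => f t + g t) @ F --> l + m.
Proof.
move=> fl gm; apply: (@continuous2_cvg _ V V V F _ f g +%R l m _ fl gm).
exact: (@add_continuous V (l, m)).
Qed.

Lemma tvs_cvgN (V : tvsType R) (T : Type) (F : set_system T) {FF : Filter F}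
    (f : T -> V) (l : V) : f @ F --> l -> (fun t => - f t) @ F --> - l.
Proof. by move=> fl; apply: (@continuous_cvg _ V V F _ f -%R l _ fl); exact: opp_continuous. Qed.

Section rules.
Context (V : tvsType R).
Implicit Types (f g : R -> V) (l m : V).

Lemma has_deriv_unique f t l m : hausdorff_space V ->
  has_deriv f t l -> has_deriv f t m -> l = m.
Proof. by move=> hV fl fm; apply: (cvg_unique hV fl fm). Qed.

Lemma has_deriv_continuous f t l : has_deriv f t l ->
  (fun h => f (t + h)) @ 0^' --> f t.
Proof.
move=> fl; have -> : f t = 0 *: l + f t by rewrite scale0r add0r.
apply: (@eq_cvg_dnbhs0 V _ (fun h => h *: (h^-1 *: (f (t + h) - f t)) + f t)).
  by move=> h h0; rewrite scalerA divff// scale1r subrK.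
apply: tvs_cvgD; last exact: cvg_cst.
by apply: tvs_cvgZ => //; exact: cvg_dnbhs0.
Qed.

Lemma has_deriv_cst l t : has_deriv (fun=> l) t 0.
Proof.
rewrite /has_deriv; under eq_fun do rewrite subrr scaler0.
exact: cvg_cst.
Qed.

Lemma has_derivD f g t l m : has_deriv f t l -> has_deriv g t m ->
  has_deriv (fun t => f t + g t) t (l + m).
Proof.
move=> fl gm; rewrite /has_deriv.
under eq_fun do rewrite opprD addrACA scalerDr.
exact: tvs_cvgD.
Qed.

Lemma has_derivN f t l : has_deriv f t l ->
  has_deriv (fun t => - f t) t (- l).
Proof.
move=> fl; rewrite /has_deriv.
under eq_fun do rewrite -opprD scalerN.
exact: tvs_cvgN.
Qed.

Lemma has_derivB f g t l m : has_deriv f t l -> has_deriv g t m ->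
  has_deriv (fun t => f t - g t) t (l - m).
Proof. by move=> fl gm; apply: has_derivD => //; exact: has_derivN. Qed.

Lemma has_derivZ (c : R) f t l : has_deriv f t l ->
  has_deriv (fun t => c *: f t) t (c *: l).
Proof.
move=> fl; rewrite /has_deriv.
under eq_fun do rewrite -scalerBr scalerA mulrC -scalerA.
by apply: tvs_cvgZ => //; exact: cvg_cst.
Qed.

Lemma has_deriv_affine (a c : R) f t l : has_deriv f (a + c * t) l ->
  has_deriv (fun t => f (a + c * t)) t (c *: l).
Proof.
have [->|c0] := eqVneq c 0.
  rewrite scale0r => _; rewrite /has_deriv.
  by under eq_fun do rewrite !mul0r subrr scaler0; exact: cvg_cst.
move=> fl; apply: (@eq_cvg_dnbhs0 V _
    (fun h => c *: ((c * h)^-1 *: (f (a + c * t + c * h) - f (a + c * t))))).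
  move=> h h0; rewrite scalerA invfM mulrA divff// mul1r.
  by rewrite mulrDr addrA.
apply: tvs_cvgZ; first exact: cvg_cst.
exact: (cvg_comp _ _ (cvg_dnbhs0M c0) fl).
Qed.

Lemma has_deriv_linear l t : has_deriv (fun t => t *: l) t l.
Proof.
apply: eq_cvg_dnbhs0 (cvg_cst l) => h h0.
by rewrite -scalerBl addrAC subrr add0r scalerA mulVf// scale1r.
Qed.

Lemma eq_has_deriv f g t l : f =1 g -> has_deriv f t l -> has_deriv g t l.
Proof. by move=> /funext ->. Qed.

End rules.

Lemma has_deriv_comp_linear (V W : tvsType R) (L : V -> W) (f : R -> V) t l :
  (forall a x y, L (a *: x + y) = a *: L x + L y) -> continuous L ->
  has_deriv f t l -> has_deriv (fun t => L (f t)) t (L l).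
Proof.
move=> Llin Lcont fl; rewrite /has_deriv.
have L0 : L 0 = 0.
  by have := Llin (-1) 0 0; rewrite scaler0 addr0 scaleN1r addNr.
have LE (h : R) : h^-1 *: (L (f (t + h)) - L (f t)) = L (h^-1 *: (f (t + h) - f t)).
  rewrite -[h^-1 *: (f _ - _)]addr0 Llin L0 addr0; congr (_ *: _).
  by rewrite [f _ - _]addrC -[- f t]scaleN1r Llin scaleN1r addrC.
under eq_fun do rewrite LE.
by apply: (@continuous_cvg _ V W _ _ _ L _ _ fl); exact: Lcont.
Qed.

Lemma has_deriv_pair (V W : tvsType R) (f : R -> V) (g : R -> W) t l m :
  has_deriv f t l -> has_deriv g t m ->
  has_deriv (fun t => (f t, g t) : V * W) t (l, m).
Proof. by move=> fl gm; exact: cvg_pair. Qed.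

Lemma has_deriv_bilinear (V W Z : tvsType R) (B : V -> W -> Z)
    (f : R -> V) (g : R -> W) t l m :
  (forall a x x' y, B (a *: x + x') y = a *: B x y + B x' y) ->
  (forall a x y y', B x (a *: y + y') = a *: B x y + B x y') ->
  continuous (fun p : V * W => B p.1 p.2) ->
  has_deriv f t l -> has_deriv g t m ->
  has_deriv (fun t => B (f t) (g t)) t (B l (g t) + B (f t) m).
Proof.
move=> Bl Br Bcont fl gm; rewrite /has_deriv.
have Bl0 y : B 0 y = 0.
  by have := Bl (-1) 0 0 y; rewrite scaler0 addr0 scaleN1r addNr.
have Br0 x : B x 0 = 0.
  by have := Br (-1) x 0 0; rewrite scaler0 addr0 scaleN1r addNr.
have BlZ a x y : B (a *: x) y = a *: B x y by rewrite -[a *: x]addr0 Bl Bl0 addr0.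
have BrZ a x y : B x (a *: y) = a *: B x y by rewrite -[a *: y]addr0 Br Br0 addr0.
have BE (h : R) : h^-1 *: (B (f (t + h)) (g (t + h)) - B (f t) (g t)) =
    B (h^-1 *: (f (t + h) - f t)) (g (t + h)) + B (f t) (h^-1 *: (g (t + h) - g t)).
  rewrite BlZ BrZ -scalerDr; congr (_ *: _).
  have -> : B (f (t + h) - f t) (g (t + h)) =
      B (f (t + h)) (g (t + h)) - B (f t) (g (t + h)).
    by rewrite addrC -[- f t]scaleN1r Bl scaleN1r addrC.
  have -> : B (f t) (g (t + h) - g t) = B (f t) (g (t + h)) - B (f t) (g t).
    by rewrite addrC -[- g t]scaleN1r Br scaleN1r addrC.
  by rewrite subrKA.
under eq_fun do rewrite BE.
apply: tvs_cvgD.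
- apply: (@continuous2_cvg _ V W Z _ _ _ _ B _ _ _ fl (has_deriv_continuous gm)).
  exact: (Bcont (l, g t)).
- apply: (@continuous2_cvg _ V W Z _ _ (fun=> f t) _ B _ _ _ (cvg_cst _) gm).
  exact: (Bcont (f t, m)).
Qed.

Lemma has_deriv_is_derive (f : R -> R) (t l : R) :
  has_deriv (f : R -> R^o) t l -> is_derive t 1 f l.
Proof.
move=> fl; have fl' :
  (fun h : R => h^-1 *: ((f \o shift t) (h *: 1) - f t)) @ 0^' --> l.
apply: (@eq_cvg_dnbhs0 R^o _ _ _ _ fl) => h h0 /=.
  by rewrite [h *: 1]mulr1 (addrC h).
apply: DeriveDef; first by apply/cvg_ex; exists l.
exact: cvg_lim fl'.
Qed.

Lemma has_deriv0_cst (f : R -> R) : (forall t, has_deriv (f : R -> R^o) t 0) ->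
  forall s t, f s = f t.
Proof.
by move=> f0 s t; apply: is_derive_0_is_cst => u; exact: has_deriv_is_derive.
Qed.

Lemma has_deriv_rip (H : hilbertType R) (f g : R -> realify H) t (l m : H) :
  has_deriv f t l -> has_deriv g t m ->
  has_deriv (fun t => rip (f t : H) (g t : H) : R^o) t
    (rip l (g t : H) + rip (f t : H) m).
Proof.
apply: (@has_deriv_bilinear (realify H) (realify H) R^o
  (fun x y => rip (x : H) (y : H))).
- by move=> a x x' y; rewrite ripDl ripZl.
- by move=> a x y y'; rewrite ripDr ripZr.
- move=> p; apply: (@cvg_rip R H).
  exact: (@cvg_fst _ _ (nbhs p.1) (nbhs p.2) _).
  exact: (@cvg_snd _ _ (nbhs p.1) (nbhs p.2) _).
Qed.

Lemma hausdorff_realify (H : hilbertType R) : hausdorff_space (realify H).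
Proof. exact: (@norm_hausdorff _ H). Qed.

(** Pairing [f] with the fixed vector [f s - f t] leaves a real function with zero derivative, so
    this vector is orthogonal to itself. *)
Lemma has_deriv0_hilbert (H : hilbertType R) (f : R -> realify H) :
  (forall t, has_deriv f t 0) -> forall s t, f s = f t.
Proof.
move=> f0 s t; apply/eqP; rewrite -subr_eq0; apply/eqP.
apply: (@hnorm_sqr0 R H); rewrite -rip_norm ripBl subr_le0 le_eqVlt.
apply/orP; left; apply/eqP.
apply: (has_deriv0_cst (f := fun u => rip (f u : H) (f s - f t : H))) => u.
have := has_deriv_rip (f0 u) (has_deriv_cst (f s - f t) u).
by rewrite rip0l rip0r addr0.
Qed.

(** Such a [g] is [g 0 * expR (c * t)], unbounded in one direction of time unless [g 0 = 0]. Applied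
    to matrix coefficients of a unitary group, this excludes vectors orthogonal to the range of its
    generator minus [c]. *)
Lemma bounded_exponential (g : R -> R) (c M : R) : c != 0 ->
  (forall t, has_deriv (g : R -> R^o) t (c * g t)) ->
  (forall t, `|g t| <= M) -> g 0 = 0.
Proof.
move=> c0 gder gM.
have gE t : g t = g 0 * expR (c * t).
  have dg (u : R) : is_derive u 1 g (c * g u) by exact: has_deriv_is_derive.
  have d1 (u : R) : is_derive u 1 (fun u : R => g u * expR (- c * u)) 0.
    apply: is_derive_eq.
    rewrite /GRing.scale /=.
    by ring.
  have := is_derive_0_is_cst t 0 d1.
  rewrite mulr0 expR0 mulr1 => <-.
  by rewrite -mulrA -expRD mulNr addNr expR0 mulr1.
apply/eqP; rewrite -normr_le0 leNgt; apply/negP => g0.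
(* Time [n / c] gives the factor [expR n >= 1 + n] for either sign of [c]. *)
have h (n : R) : 0 <= n -> `|g 0| * n <= M.
  move=> n0; have := gM (n / c); rewrite gE [c * _]mulrC divfK// normrM.
  rewrite [`|expR _|]gtr0_norm ?expR_gt0//; apply: le_trans.
  rewrite ler_wpM2l//; have := expR_ge1Dx n; lra.
have M0 : 0 <= M := le_trans (normr_ge0 _) (gM 0).
have := h (M / `|g 0| + 1) (addr_ge0 (divr_ge0 M0 (normr_ge0 _)) ler01).
by rewrite mulrDr mulr1 mulrC divfK ?gt_eqF// gerDl leNgt g0.
Qed.

End curves.

(** * Orthogonality and density *)

Section approximation.
Context (R : realType) (H : hilbertType R).
Implicit Types (x y z w : H) (M : set H).

Definition approximable M z := forall e : R, 0 < e ->
  exists2 x, M x & hnorm (z - x) < e.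

Lemma approximable_seq M z : approximable M z ->
  exists2 u : nat -> H, (forall n, M (u n)) & u @ \oo --> z.
Proof.
move=> Mz; have /choice[u uP] (n : nat) : exists x, M x /\ hnorm (z - x) < n.+1%:R^-1.
  have n0 : 0 < n.+1%:R^-1 :> R by rewrite invr_gt0 ltr0n.
  by have [x Mx xz] := Mz _ n0; exists x.
exists u => [n|]; first by have [] := uP n.
apply/cvg_hnorm => e e0; have [k] := ltr_add_invr e0.
rewrite add0r => ke; exists k => // n /= kn.
apply: lt_trans (proj2 (uP n)) _; apply: le_lt_trans ke.
by rewrite lef_pV2 ?posrE ?ltr0n// ler_nat.
Qed.

Lemma cvg_seq_hnorm (u : nat -> H) (l : H) (e : R) : u @ \oo --> l -> 0 < e ->
  exists N, forall n, (N <= n)%N -> hnorm (l - u n) < e.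
Proof. by move=> /cvg_hnorm/[apply] -[N _ NP]; exists N. Qed.

Lemma cvg_dominated (u w : nat -> H) (l : H) (K : R) : w @ \oo --> l ->
  (forall m n, hnorm (u m - u n) <= K * hnorm (w m - w n)) ->
  exists l' : H, u @ \oo --> l'.
Proof.
move=> wl uw; apply: hilbert_complete => e e0.
have K0 : 0 < `|K| + 1 by rewrite ltr_pwDr.
have [N NP] := cvg_seq_hnorm wl (divr_gt0 e0 (mulr_gt0 (ltr0Sn R 1) K0)).
exists N => m n /NP mN /NP nN; apply: le_lt_trans (uw m n) _.
have : hnorm (w m - w n) < e / (`|K| + 1).
  apply: le_lt_trans (hnorm_dist _ l _) _; rewrite hnormBC.
  have -> : e / (`|K| + 1) = e / (2 * (`|K| + 1)) + e / (2 * (`|K| + 1)).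
    by field; rewrite gt_eqF.
  exact: ltrD.
rewrite ltr_pdivlMr// => h.
have := hnorm_ge0 (w m - w n); have := ler_norm K; nra.
Qed.

Lemma approximable_orthogonal M w : (forall z, approximable M z) ->
  (forall x, M x -> rip x w = 0) -> w = 0.
Proof.
move=> Md Mw; apply/eqP; apply: contraT => /hnorm_gt0 w0.
have [x Mx xw] := Md w _ w0.
have : hnorm w ^+ 2 <= hnorm (w - x) * hnorm w.
  rewrite -rip_norm -[leLHS]subr0 -(Mw x Mx) -ripBl.
  exact: le_trans (ler_norm _) (rip_CauchySchwarz _ _).
by nra.
Qed.

(** A sequence in [M] minimizing the distance to [z] converges in [H], even if its limit [l] leaves
    [M]; the error [z - l] is orthogonal to [M], hence zero. *)
Lemma orthogonal_approximable M : M 0 ->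
  (forall (a : R) x y, M x -> M y -> M (a%:C *: x + y)) ->
  (forall w, (forall x, M x -> rip x w = 0) -> w = 0) ->
  forall z, approximable M z.
Proof.
move=> M0 Mlin Morth z.
pose E := [set hnorm (z - x) ^+ 2 | x in M].
have E0 : has_inf E.
  split; first by exists (hnorm (z - 0) ^+ 2); exists 0.
  by exists 0 => _ [x _ <-]; exact: sqr_ge0.
pose d := inf E.
have dP x : M x -> d <= hnorm (z - x) ^+ 2.
  by move=> Mx; apply: ge_inf; [exact: E0.2|exists x].
have /choice[u uP] (n : nat) : exists x, M x /\ hnorm (z - x) ^+ 2 < d + n.+1%:R^-1.
  have n0 : 0 < n.+1%:R^-1 :> R by rewrite invr_gt0 ltr0n.
  by have [_ [x Mx <-] xd] := inf_adherent n0 E0; exists x.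
have uE (e : R) n k : k.+1%:R^-1 < e -> (k <= n)%N -> hnorm (z - u n) ^+ 2 < d + e.
  move=> ke kn; apply: lt_trans (proj2 (uP n)) _; rewrite ltrD2l.
  by apply: le_lt_trans ke; rewrite lef_pV2 ?posrE ?ltr0n// ler_nat.
have [l ul] : exists l : H, u @ \oo --> l.
  apply: hilbert_complete => e e0.
  (* Both squared distances are below [d + e ^+ 2 / 4], and the midpoint has squared distance at
     least [d], so the parallelogram identity keeps [hnorm (u m - u n) ^+ 2] below [e ^+ 2]. *)
  have [k] := ltr_add_invr (divr_gt0 (exprn_gt0 2 e0) (ltr0Sn R 3)).
  rewrite add0r => ke; exists k => m n /(uE _ _ _ ke) mk /(uE _ _ _ ke) nk.
  have umn : hnorm (u m - u n) ^+ 2 = 2 * hnorm (z - u m) ^+ 2 +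
      2 * hnorm (z - u n) ^+ 2 - 4 * hnorm (z - ((2^-1)%:C *: u m + (2^-1)%:C *: u n)) ^+ 2.
    by rewrite -!rip_norm !(ripBl, ripBr, ripDl, ripDr, ripZl, ripZr)
      (ripC (u m) z) (ripC (u n) z) (ripC (u n) (u m)); field.
  have : d <= hnorm (z - ((2^-1)%:C *: u m + (2^-1)%:C *: u n)) ^+ 2.
    apply/dP/Mlin; first by have [] := uP m.
    by rewrite -[_ *: u n]addr0; apply/Mlin => //; have [] := uP n.
  move=> ?; rewrite ltNge; apply/negP => ?.
  have : e ^+ 2 <= hnorm (u m - u n) ^+ 2 by rewrite ler_pXn2r ?nnegrE ?hnorm_ge0 ?(ltW e0).
  by lra.
have zul x : (fun n => z - u n - x) @ \oo --> z - l - x.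
  by apply: cvgB; [apply: cvgB => //; exact: cvg_cst|exact: cvg_cst].
have wd : hnorm (z - l) ^+ 2 <= d.
  apply/ler_addgt0Pr => e e0; have [k] := ltr_add_invr e0.
  rewrite add0r => ke.
  have h : (fun n => rip (z - u n - 0) (z - u n - 0)) @ \oo -->
      rip (z - l - 0) (z - l - 0) by apply: cvg_rip; exact: zul.
  rewrite -rip_norm -[z - l]subr0; apply: (cvgr_to_le h).
  by exists k => // n /= kn; rewrite subr0 rip_norm ltW// (uE _ _ _ ke).
have wx x : M x -> d <= hnorm (z - l - x) ^+ 2.
  move=> Mx; have h : (fun n => rip (z - u n - x) (z - u n - x)) @ \oo -->
      rip (z - l - x) (z - l - x) by apply: cvg_rip; exact: zul.
  rewrite -rip_norm; apply: (cvgr_to_ge h); apply: nearW => n.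
  rewrite rip_norm -addrA -opprD; apply: dP.
  by rewrite -[u n]scale1r; apply: (Mlin 1) => //; have [] := uP n.
have /subr0_eq zl : z - l = 0.
  move: wd wx {zul}; move: (z - l) => w wd wx.
  apply: Morth => x Mx; rewrite ripC.
  suff : rip w x ^+ 2 <= 0 * rip x x.
    by rewrite mul0r => h; apply/eqP; rewrite -sqrf_eq0 eq_le h sqr_ge0.
  (* Minimality of [hnorm w] leaves a quadratic polynomial in [t] without constant term. *)
  apply: discriminant_le => [|t]; first by rewrite rip_norm sqr_ge0.
  have := wx ((- t)%:C *: x); rewrite -[X in M X]addr0 => /(_ (Mlin _ _ _ Mx M0)).
  move: wd; rewrite -!rip_norm !(ripBl, ripBr, ripZl, ripZr) (ripC x w).
  by move=> ? ?; nra.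
move=> e e0; have [N NP] := cvg_seq_hnorm ul e0.
by exists (u N); [have [] := uP N|rewrite zl; exact: NP].
Qed.

End approximation.

(** * Spectrum and numerical range *)

Lemma nbhs_hnorm (R : realType) (H : hilbertType R) (x : H) (e : R) : 0 < e ->
  nbhs x [set y | hnorm (x - y) < e].
Proof. exact: (proj1 (cvg_hnorm _ id x) cvg_id). Qed.

Section closed_graph.
Context (R : realType) (H : hilbertType R) (T : operator H).
Let D := dom T.
Let Tbar := closure (graph T).

Lemma closure_graphP v w : Tbar (v, w) <-> exists u : nat -> H,
  [/\ forall n, D (u n), u @ \oo --> v & (fun n => T (u n)) @ \oo --> w].
Proof.
split=> [Tvw|[u [Du uv uw]]].
  have /choice[u uP] (n : nat) : exists x, D x /\
      (hnorm (v - x) < n.+1%:R^-1 /\ hnorm (w - T x) < n.+1%:R^-1).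
    have n0 : 0 < n.+1%:R^-1 :> R by rewrite invr_gt0 ltr0n.
    have : nbhs (v, w) [set p : H * H |
        hnorm (v - p.1) < n.+1%:R^-1 /\ hnorm (w - p.2) < n.+1%:R^-1].
      exists ([set x | hnorm (v - x) < n.+1%:R^-1],
              [set x | hnorm (w - x) < n.+1%:R^-1]) => /=; last by move=> [].
      by split; exact: nbhs_hnorm.
    by move=> /Tvw[[x y] [[/= Dx yT] [/= xv yw]]]; exists x; rewrite -yT.
  exists u; split=> [n||]; first by have [] := uP n.
    apply/cvg_hnorm => e e0; have [k] := ltr_add_invr e0.
    rewrite add0r => ke; exists k => // n /= kn.
    apply: lt_trans (proj1 (proj2 (uP n))) _; apply: le_lt_trans ke.
    by rewrite lef_pV2 ?posrE ?ltr0n// ler_nat.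
  apply/cvg_hnorm => e e0; have [k] := ltr_add_invr e0.
  rewrite add0r => ke; exists k => // n /= kn.
  apply: lt_trans (proj2 (proj2 (uP n))) _; apply: le_lt_trans ke.
  by rewrite lef_pV2 ?posrE ?ltr0n// ler_nat.
have : (fun n => (u n, T (u n))) @ \oo --> (v, w) by exact: cvg_pair.
move=> uvw B /uvw[N _ NB]; exists (u N, T (u N)); split.
  by split; [exact: Du|].
exact: (NB N (leqnn N)).
Qed.

Hypothesis Tlin : linear_operator T.

Lemma closure_graph_linear (a : R[i]) v w v' w' : Tbar (v, w) -> Tbar (v', w') ->
  Tbar (a *: v + v', a *: w + w').
Proof.
move=> /closure_graphP[u [Du uv uw]] /closure_graphP[u' [Du' uv' uw']].
apply/closure_graphP; exists (fun n => a *: u n + u' n); split.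
- by move=> n; have [] := Tlin.2 a _ _ (Du n) (Du' n).
- by apply: cvgD => //; apply: cvgZr.
- under eq_fun do rewrite (Tlin.2 a _ _ (Du _) (Du' _)).2.
  by apply: cvgD => //; apply: cvgZr.
Qed.

Hypothesis Tsym : forall x y, D x -> D y -> rip (T x) y = rip x (T y).

Lemma closure_graph_symmetric v w v' w' : Tbar (v, w) -> Tbar (v', w') ->
  rip w v' = rip v w'.
Proof.
move=> /closure_graphP[u [Du uv uw]] /closure_graphP[u' [Du' uv' uw']].
have h1 : (fun n => rip (T (u n)) (u' n)) @ \oo --> rip w v' by exact: cvg_rip.
have h2 : (fun n => rip (u n) (T (u' n))) @ \oo --> rip v w' by exact: cvg_rip.
have e : (fun n => rip (T (u n)) (u' n)) = (fun n => rip (u n) (T (u' n))).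
  by apply/funext => n; exact: Tsym.
rewrite e in h1; exact: (cvg_unique (@Rhausdorff R) h1 h2).
Qed.

Section bounded_above.
Context (m l : R).
Hypothesis ml : m < l.
Hypothesis Tle : forall x, D x -> rip (T x) x <= m * hnorm x ^+ 2.

Lemma closure_graph_le v w : Tbar (v, w) -> rip w v <= m * hnorm v ^+ 2.
Proof.
move=> /closure_graphP[u [Du uv uw]].
have h1 : (fun n => rip (T (u n)) (u n)) @ \oo --> rip w v by exact: cvg_rip.
have h2 : (fun n => m * rip (u n) (u n)) @ \oo --> m * rip v v.
  by apply: cvgMr; exact: cvg_rip.
rewrite -rip_norm -subr_ge0; apply: (cvgr_to_ge (cvgB h2 h1)).
by apply: nearW => n; rewrite /= subr_ge0 rip_norm Tle.
Qed.

(** Pairing [w - l v] with [v] gives [(l - m) |v|^2 <= |w - l v| |v|]. This one estimate yields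
    closed range, uniqueness of solutions and continuity of the resolvent. *)
Lemma resolvent_bound v w : Tbar (v, w) ->
  hnorm v <= (l - m)^-1 * hnorm (w - l%:C *: v).
Proof.
move=> Tvw; have lm : 0 < l - m by rewrite subr_gt0.
rewrite ler_pdivlMl//.
have [->|v0] := eqVneq v 0; first by rewrite hnorm0 mulr0 hnorm_ge0.
rewrite -(ler_pM2r (hnorm_gt0 v0)).
apply: le_trans (rip_CauchySchwarz (w - l%:C *: v) v).
rewrite -normrN; apply: le_trans (ler_norm _).
rewrite ripBl ripZl rip_norm; have := closure_graph_le Tvw; nra.
Qed.

Hypothesis Tdense : forall w,
  (forall x, D x -> rip (T x - l%:C *: x) w = 0) -> w = 0.

(** By [Tdense] the range of [T - l] on [D] is dense. Along right-hand sides tending to [u] the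
    solutions are Cauchy by [resolvent_bound], and the closure contains the limit. *)
Lemma resolvent_exists u : exists v, Tbar (v, u + l%:C *: v).
Proof.
have T0 : T 0 = 0.
  have [D0 /(_ (-1) _ _ D0 D0)[_]] := Tlin.
  by rewrite !scaleN1r !addNr.
have : approximable [set z | exists x, D x /\ z = T x - l%:C *: x] u.
  apply: orthogonal_approximable.
  - exists 0; split; first exact: Tlin.1.
    by rewrite T0 scaler0 subr0.
  - move=> a _ _ [x [Dx ->]] [y [Dy ->]]; exists (a%:C *: x + y).
    have [Dxy ->] := Tlin.2 a%:C _ _ Dx Dy; split=> //.
    by rewrite [in RHS]scalerDr opprD [RHS]addrACA scalerBr !scalerA (mulrC l%:C).
  - by move=> z zT; apply: Tdense => x Dx; apply: zT; exists x.
move=> /approximable_seq[w /choice[x xP] wu].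
have Dx n := (xP n).1; have Tx n : T (x n) = w n + l%:C *: x n.
  by rewrite (xP n).2 subrK.
have [v xv] : exists v : H, x @ \oo --> v.
  apply: (@cvg_dominated R H x w u (l - m)^-1 wu) => i j.
  have Tij : Tbar (-1 *: x j + x i, -1 *: T (x j) + T (x i)).
    by apply: closure_graph_linear; apply: subset_closure; split=> //; exact: Dx.
  have := resolvent_bound Tij; rewrite !scaleN1r !(addrC (- _)).
  by rewrite !Tx scalerBr opprD addrACA addrK.
exists v; apply/closure_graphP; exists x; split=> //.
under eq_fun do rewrite Tx.
by apply: cvgD => //; apply: cvgZr.
Qed.

Lemma spectrum_lt : ~ spectrum Tbar l%:C.
Proof.
suff : exists2 S : {linear H -> H}, continuous S &
                forall u v, S u = v <-> Tbar (v, u + l%:C *: v) by move=> h; apply.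
have /choice[S SP] := resolvent_exists.
(* Subtracting two points of the form [(v, u + l v)] and removing [l] times the difference of the
   [v] leaves the difference of the [u]. *)
have shift u v u' v' : -1 *: (u + l%:C *: v) + (u' + l%:C *: v') -
    l%:C *: (-1 *: v + v') = u' - u :> H.
  rewrite !scaleN1r [X in _ - X]scalerDr scalerN !opprD opprK.
  have e (p p' : H) : u' + p' + (p - p') = u' + p by rewrite addrACA subrr addr0.
  by rewrite -addrA e addrACA addNr addr0 addrC.
have Tuniq u v v' : Tbar (v, u + l%:C *: v) -> Tbar (v', u + l%:C *: v') -> v = v'.
  move=> Tv Tv'; apply/eqP; rewrite eq_sym -subr_eq0; apply/eqP/hnorm_eq0.
  apply/le_anti; rewrite hnorm_ge0 andbT.
  have := resolvent_bound (closure_graph_linear (a := -1) Tv Tv').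
  by rewrite shift subrr hnorm0 mulr0 scaleN1r addrC.
have Slin : linear S.
  move=> a u u'; apply: (Tuniq (a *: u + u')); first exact: SP.
  have := closure_graph_linear (a := a) (SP u) (SP u').
  by rewrite !scalerDr addrACA !scalerA (mulrC a).
pose S' : {linear H -> H} := HB.pack S (GRing.isLinear.Build _ _ _ _ S Slin).
exists S'; last first.
  by move=> u v; split=> [<-|Tv]; [exact: SP|exact: Tuniq (SP u) Tv].
move=> u; apply/cvg_hnorm => e e0.
have lm : 0 < l - m by rewrite subr_gt0.
apply: filterS (nbhs_hnorm u (mulr_gt0 e0 lm)) => u' /= uu'.
have := resolvent_bound (closure_graph_linear (a := -1) (SP u') (SP u)).
rewrite shift scaleN1r addrC => /le_lt_trans; apply.
by rewrite ltr_pdivrMl// mulrC.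
Qed.

End bounded_above.

End closed_graph.

(** * Numerical range bounded by the spectrum *)

Section spectrum_lower_bound.
Context (R : realType) (H : hilbertType R).

Lemma continuous_linear_bounded (S : {linear H -> H}) : continuous S ->
  exists2 K : R, 0 < K & forall u, hnorm (S u) <= K * hnorm u.
Proof.
move=> Sc; have : nbhs (0 : H) [set u | hnorm (S u) < 1].
  have h : \forall u \near (0 : H), hnorm (S 0 - S u) < 1.
    exact: (Sc 0 _ (nbhs_hnorm (S 0) ltr01)).
  apply: filterS h => u; rewrite /= linear0 sub0r.
  by rewrite Defs.hnormN.
move=> /nbhs_ballP[d /= d0 dS].
move: d0; rewrite ltcE /= => /andP[/eqP d2 d1].
exists (2 / complex.Re d); first by rewrite divr_gt0.
move=> u; have [->|u0] := eqVneq u 0; first by rewrite linear0 hnorm0 mulr0.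
have u1 := hnorm_gt0 u0; set c := complex.Re d / (2 * hnorm u).
have c0 : 0 < c by rewrite divr_gt0// mulr_gt0.
have : hnorm (S (c%:C *: u)) < 1.
  apply: dS; rewrite -ball_normE /= sub0r normrN hnormE ltcE /= d2 eqxx /=.
  rewrite hnormZ gtr0_norm// /c.
  have -> : complex.Re d / (2 * hnorm u) * hnorm u = complex.Re d / 2.
    by field; rewrite gt_eqF.
  by rewrite ltr_pdivrMr// mulr_natr mulr2n ltrDl.
rewrite linearZ /= hnormZ gtr0_norm// mulrC -ltr_pdivlMr// => /ltW/le_trans; apply.
by rewrite /c le_eqVlt; apply/orP; left; apply/eqP; field; rewrite !gt_eqF.
Qed.

Context (T : operator H).
Let D := dom T.
Let Tbar := closure (graph T).
Hypothesis Tsym : forall x y, D x -> D y -> rip (T x) y = rip x (T y).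

(* If the resolvent [S] of [T] at [l] had [M = sup <Su, u> > 0] on the unit
   sphere, Cauchy-Schwarz for the form [<(M - S)u, u>] would make [M - S] not
   bounded below, whereas it factors through the resolvent at [l + 1 / M]. *)
Lemma resolvent_le0 (a l : R) (S : {linear H -> H}) : a < l ->
  (forall r : R, a < r -> ~ spectrum Tbar r%:C) ->
  continuous S -> (forall u v, S u = v <-> Tbar (v, u + l%:C *: v)) ->
  forall u, rip (S u) u <= 0.
Proof.
move=> al Tspec Sc SP.
have [K K0 SK] := continuous_linear_bounded Sc.
have Ssym u u' : rip (S u) u' = rip u (S u').
  have := closure_graph_symmetric Tsym (proj1 (SP u _) erefl) (proj1 (SP u' _) erefl).
  by rewrite ripDl ripDr ripZl ripZr => /addIr.
pose E := [set rip (S u) u | u in [set u | hnorm u = 1]].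
move=> u0; rewrite leNgt; apply/negP => q0.
have normalize (u : H) : u != 0 -> hnorm (((hnorm u)^-1)%:C *: u) = 1.
  move=> /hnorm_gt0 u1.
  by rewrite hnormZ gtr0_norm ?invr_gt0// mulVf// gt_eqF.
have u0n0 : u0 != 0 by apply: contraTneq q0 => ->; rewrite rip0r ltxx.
have qZ (c : R) u : rip (S (c%:C *: u)) (c%:C *: u) = c ^+ 2 * rip (S u) u.
  by rewrite linearZ /= ripZl ripZr mulrA.
have Ebnd u : hnorm u = 1 -> rip (S u) u <= K.
  move=> u1; apply: le_trans (ler_norm _) _; apply: le_trans (rip_CauchySchwarz _ _) _.
  by rewrite u1 mulr1 (le_trans (SK _))// u1 mulr1.
have E0 : has_sup E.
  split; last by exists K => _ [u u1 <-]; exact: Ebnd.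
  by exists (rip (S (((hnorm u0)^-1)%:C *: u0)) (((hnorm u0)^-1)%:C *: u0));
    eexists; [exact: normalize u0n0|].
pose M := sup E.
have EM u : hnorm u = 1 -> rip (S u) u <= M.
  by move=> u1; apply: sup_upper_bound => //; exists u.
have M0 : 0 < M.
  apply: (lt_le_trans _ (EM _ (normalize _ u0n0))); rewrite qZ mulr_gt0//.
  by rewrite exprn_gt0// invr_gt0 hnorm_gt0.
have psd u : 0 <= rip (M%:C *: u - S u) u.
  rewrite ripBl ripZl rip_norm subr_ge0.
  have [->|un0] := eqVneq u 0; first by rewrite rip0r mulr_ge0 ?sqr_ge0// ltW.
  have := EM _ (normalize _ un0); rewrite qZ => h; have u1 := hnorm_gt0 un0.
  by rewrite -ler_pdivrMr ?exprn_gt0// mulrC -exprVn.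
(* [B = M - S], introduced through its equation so that rewriting does not unfold it. *)
have [B BE] : exists B : H -> H, forall u, B u = M%:C *: u - S u.
  by exists (fun u => M%:C *: u - S u).
have Bsym u u' : rip (B u) u' = rip u (B u').
  by rewrite !BE ripBl ripBr ripZl ripZr Ssym.
have Blin u (t : R) u' : B (u + t%:C *: u') = B u + t%:C *: B u'.
  rewrite !BE (_ : S (u + _) = S u + t%:C *: S u'); last by rewrite linearD linearZ.
  rewrite [in LHS]scalerDr scalerBr !scalerA (mulrC t%:C).
  by rewrite opprD addrACA.
(* Cauchy-Schwarz at [u] and [B u] bounds [|B u|^4] by [<B u, u> <B B u, B u>], and the last factor
   is at most [(M + K) |B u|^2]. *)
have BB u : hnorm (B u) ^+ 2 <= (M + K) * rip (B u) u.
  have h : (hnorm (B u) ^+ 2) ^+ 2 <= rip (B u) u * rip (B (B u)) (B u).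
    rewrite -rip_norm; apply: discriminant_le => [|t]; first by rewrite BE; exact: psd.
    have := psd (u + t%:C *: B u); rewrite -BE Blin.
    rewrite !(ripDl, ripDr, ripZl, ripZr) (Bsym (B u) u) => h; lra.
  have BBK : rip (B (B u)) (B u) <= (M + K) * hnorm (B u) ^+ 2.
    rewrite {1}BE ripBl ripZl rip_norm mulrDl lerD2l.
    rewrite -ripNl; apply: le_trans (ler_norm _) _.
    apply: le_trans (rip_CauchySchwarz _ _) _; rewrite Defs.hnormN expr2 mulrA.
    by rewrite ler_wpM2r ?hnorm_ge0.
  have [Bu0|Bun0] := eqVneq (B u) 0.
    by rewrite Bu0 rip0l mulr0 hnorm0 expr0n.
  have := hnorm_gt0 Bun0 => Bu1; have Bu2 := exprn_gt0 2 Bu1.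
  rewrite -(ler_pM2r Bu2) -expr2; apply: le_trans h _.
  rewrite [leRHS](_ : _ = rip (B u) u * ((M + K) * hnorm (B u) ^+ 2)); last by ring.
  by rewrite ler_wpM2l// BE psd.
pose l' := l + M^-1.
have /contrapT[S' S'c S'P] : ~ spectrum Tbar l'%:C.
  by apply: Tspec; rewrite (lt_le_trans al)// lerDl invr_ge0 ltW.
have [K' K'0 S'K] := continuous_linear_bounded S'c.
pose C := (1 + K' / M) / M.
have C0 : 0 < C by rewrite divr_gt0// addr_gt0// divr_gt0.
(* The closure of [T - l - 1 / M] maps [S u] to [u - S u / M = B u / M], and [u = (B u + S u) / M];
   bounding [S u] through [S'] gives the constant [C]. *)
have uB u : hnorm u <= C * hnorm (B u).
  have SB : S' ((M^-1)%:C *: B u) = S u.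
    apply/S'P; have := proj1 (SP u _) erefl; congr (Tbar (_, _)).
    rewrite BE /l' rmorphD scalerDl scalerBr scalerA -rmorphM mulVf ?gt_eqF//.
    by rewrite rmorph1 scale1r (addrC (l%:C *: _)) subrKA.
  have -> : hnorm u = M^-1 * hnorm (B u + S u).
    by rewrite BE subrK hnormZ gtr0_norm// mulrA mulVf ?mul1r// gt_eqF.
  rewrite /C mulrAC [leRHS]mulrC ler_pM2l ?invr_gt0// (le_trans (Defs.hnormD _ _))//.
  rewrite mulrDl mul1r lerD2l -SB (le_trans (S'K _))// hnormZ gtr0_norm ?invr_gt0//.
  by rewrite mulrA.
(* The two bounds keep [<B u, u> = M - <S u, u>] away from [0] on the unit sphere, against the
   choice of [M]. *)
have Eub : ubound E (M - (C ^+ 2 * (M + K))^-1).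
  move=> _ [u u1 <-]; have := BB u; have := uB u; rewrite u1 => h1 h2.
  have h3 : 1 <= C ^+ 2 * ((M + K) * rip (B u) u).
    have h4 : 1 <= C ^+ 2 * hnorm (B u) ^+ 2.
      by rewrite -exprMn exprn_ege1.
    by apply: le_trans h4 _; rewrite ler_pM2l ?exprn_gt0.
  have MK : 0 < C ^+ 2 * (M + K) by rewrite mulr_gt0 ?exprn_gt0 ?addr_gt0.
  rewrite mulrA mulrC -ler_pdivrMr// mul1r in h3.
  move: h3; rewrite BE ripBl ripZl rip_norm u1 expr1n mulr1; lra.
have := ge_sup E0.1 Eub; rewrite -/M lerBrDl gerDr leNgt invr_gt0.
by rewrite mulr_gt0 ?exprn_gt0 ?addr_gt0.
Qed.

(** At [u = (T - l) x] the resolvent returns [x], so [resolvent_le0] reads [<x, (T - l) x> <= 0];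
    then [l] decreases to [a]. *)
Lemma spectrum_ub (a : R) : (forall r : R, a < r -> ~ spectrum Tbar r%:C) ->
  forall x, D x -> rip (T x) x <= a * hnorm x ^+ 2.
Proof.
move=> Tspec x Dx.
suff h (l : R) : a < l -> rip (T x) x <= l * hnorm x ^+ 2.
  have [->|x0] := eqVneq x 0; first by rewrite hnorm0 rip0r expr0n mulr0.
  have x1 := exprn_gt0 2 (hnorm_gt0 x0); rewrite -ler_pdivrMr//.
  apply/ler_addgt0Pr => e e0; rewrite ler_pdivrMr//.
  by apply: h; rewrite ltrDl.
move=> al; have /contrapT[S Sc SP] := Tspec _ al.
have := resolvent_le0 al Tspec Sc SP (T x - l%:C *: x).
have -> : S (T x - l%:C *: x) = x.
  by apply/SP; rewrite subrK; apply: subset_closure; split.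
by rewrite ripBr ripZr rip_norm subr_le0 ripC.
Qed.

End spectrum_lower_bound.

(** * Generators of unitary one-parameter groups *)

Section skew_generator.
Context (R : realType) (H : hilbertType R).
Variables (D : set H) (X : H -> H) (U : R -> H -> H).
Hypothesis D0 : D 0.
Hypothesis Xlin : forall (a : R[i]) x y, D x -> D y ->
  D (a *: x + y) /\ X (a *: x + y) = a *: X x + X y.
Hypothesis D_dense : forall z, approximable D z.
Hypothesis UD : forall t x, D x -> D (U t x).
Hypothesis U0 : forall x, U 0 x = x.
Hypothesis U_isometry : forall t x y, rip (U t x) (U t y) = rip x y.
Hypothesis UX : forall x t, D x ->
  has_deriv (fun t => U t x : realify H) t (X (U t x)).

(** Derivative at [0] of the constant function [rip (U t x) (U t y)]. *)
Lemma skew_adjoint x y : D x -> D y -> rip (X x) y = - rip x (X y).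
Proof.
move=> Dx Dy; apply/eqP; rewrite -addr_eq0; apply/eqP.
have h := has_deriv_rip (@UX x 0 Dx) (@UX y 0 Dy).
rewrite !U0 in h; apply: (has_deriv_unique (@Rhausdorff R) h).
apply: (eq_has_deriv (f := fun=> rip x y)); first by move=> t; rewrite U_isometry.
exact: has_deriv_cst.
Qed.

(** If [w] is orthogonal to the range, [rip (U t x) w] satisfies [g' = c g], because [U t x] stays
    in [D]. Being bounded, it vanishes at [t = 0], and [D] is dense. *)
Lemma skew_range_dense (c : R) : c != 0 ->
  forall z, approximable [set X x - c%:C *: x | x in D] z.
Proof.
move=> c0; have X0 : X 0 = 0.
  by have [_] := @Xlin (-1) _ _ D0 D0; rewrite !scaleN1r !addNr.
apply: orthogonal_approximable.
- by exists 0 => //; rewrite X0 scaler0 subrr.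
- move=> a _ _ [x Dx <-] [y Dy <-]; have [Dxy Xxy] := @Xlin a%:C _ _ Dx Dy.
  exists (a%:C *: x + y) => //; rewrite Xxy [X in _ - X]scalerDr opprD addrACA.
  by rewrite scalerBr !scalerA (mulrC c%:C).
- move=> w wX; apply: (approximable_orthogonal D_dense) => x Dx.
  rewrite -[x in LHS]U0.
  apply: (@bounded_exponential _ (fun t => rip (U t x) w) c (hnorm x * hnorm w) c0).
    move=> t; have := has_deriv_rip (@UX x t Dx) (has_deriv_cst (w : realify H) t).
    rewrite rip0r addr0.
    have := wX _ (ex_intro2 _ _ (U t x) (UD t Dx) erefl).
    by rewrite ripBl ripZl => /subr0_eq ->.
  move=> t; apply: le_trans (rip_CauchySchwarz _ _) _.
  rewrite (_ : hnorm (U t x) = hnorm x)//.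
  by apply/eqP; rewrite -(@eqrXn2 _ 2)// ?hnorm_ge0// -!rip_norm U_isometry.
Qed.

Let T : operator H := Operator D (fun x => 'i%C *: X x).

Lemma skew_linear_operator : linear_operator T.
Proof.
split=> // a x y Dx Dy; have [Dxy Xxy] := @Xlin a _ _ Dx Dy; split=> //=.
by rewrite Xxy scalerDr !scalerA mulrC.
Qed.

Lemma skew_symmetric x y : D x -> D y -> rip (T x) y = rip x (T y).
Proof.
move=> Dx Dy /=; have [DJy XJy] := @Xlin 'i%C _ _ Dy D0.
have X0 : X 0 = 0.
  by have [_] := @Xlin (-1) _ _ D0 D0; rewrite !scaleN1r !addNr.
rewrite !addr0 X0 addr0 in DJy XJy.
by rewrite ripJl (skew_adjoint Dx DJy) opprK XJy.
Qed.

(* A vector [w] orthogonal to [(T - l) D] satisfies [T^* w = l w]; solving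
   [(X - 1) v = (- i l - 1) w] in the closure and using that [(X + 1) D] is
   dense gives [v = w], so [w] lies in the domain of the closure. *)
Lemma skew_range_orthogonal (m l : R) : m < l ->
  (forall x, D x -> rip (T x) x <= m * hnorm x ^+ 2) ->
  forall w, (forall x, D x -> rip (T x - l%:C *: x) w = 0) -> w = 0.
Proof.
move=> ml Tm w wT.
have X0 : X 0 = 0.
  by have [_] := @Xlin (-1) _ _ D0 D0; rewrite !scaleN1r !addNr.
(* Testing against [i x], again in [D], turns the orthogonality into the adjoint relation
   [X^* w = l i w]. *)
have wX x : D x -> rip (X x) w = l * rip x ('i%C *: w).
  move=> Dx; have [DJx XJx] := @Xlin 'i%C _ _ Dx D0.
  rewrite !addr0 X0 addr0 in DJx XJx.
  have := wT _ DJx; rewrite /= XJx scaleii ripBl ripNl ripZl ripJl; lra.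
have [y yM yl] := approximable_seq (skew_range_dense (oner_neq0 R)
  (- l%:C *: ('i%C *: w) - w)).
have /choice[v vP] n : exists x, D x /\ y n = X x - x.
  by have [x Dx <-] := yM n; exists x; rewrite rmorph1 scale1r.
have Dv n := (vP n).1; have Xv n : X (v n) = y n + v n.
  by rewrite (vP n).2 subrK.
have XB a b : D a -> D b -> D (a - b) /\ X (a - b) = X a - X b.
  by move=> Da Db; have := @Xlin (-1) _ _ Db Da; rewrite !scaleN1r ![- _ + _]addrC.
have [v' vl] : exists l : H, v @ \oo --> l.
  (* Skewness gives [|X v - v|^2 = |X v|^2 + |v|^2], so differences of [v] are dominated by those of
     [y] with constant [1]. *)
  apply: (@cvg_dominated _ _ v y _ 1 yl) => i j; rewrite mul1r.
  have [Dij Xij] := XB _ _ (Dv i) (Dv j).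
  have Xs : rip (X (v i - v j)) (v i - v j) = 0.
    by have := skew_adjoint Dij Dij; rewrite (ripC _ (X _)); lra.
  have -> : y i - y j = X (v i - v j) - (v i - v j).
    by rewrite Xij !Xv [in RHS]opprD addrACA addrK.
  rewrite -(@ler_pXn2r _ 2)// ?nnegrE ?hnorm_ge0// (hnormB_sqr (X _)) Xs.
  by have := sqr_ge0 (hnorm (X (v i - v j))); lra.
have Xvl : (fun n => X (v n)) @ \oo --> - l%:C *: ('i%C *: w) - w + v'.
  by under eq_fun do rewrite Xv; exact: cvgD.
have vw : v' - w = 0.
  apply: (approximable_orthogonal (skew_range_dense _ (c := -1))).
    by rewrite oppr_eq0 oner_neq0.
  move=> _ [x Dx <-]; rewrite rmorphN rmorph1 scaleN1r opprK.
  have h1 : (fun n => rip (X x + x) (v n)) @ \oo --> rip (X x + x) v'.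
    by apply: cvg_rip => //; exact: cvg_cst.
  have h2 : (fun n => rip x (v n - X (v n))) @ \oo -->
      rip x (v' - (- l%:C *: ('i%C *: w) - w + v')).
    by apply: cvg_rip; [exact: cvg_cst|exact: cvgB].
  have e : (fun n => rip (X x + x) (v n)) = (fun n => rip x (v n - X (v n))).
    by apply/funext => n; rewrite ripDl ripBr skew_adjoint// addrC.
  rewrite e in h1; rewrite ripBr (cvg_unique (@Rhausdorff R) h1 h2).
  rewrite ripDl wX// !(ripBr, ripDr) -rmorphN ripZr; ring.
have {vw} vw : v' = w by exact: subr0_eq.
(* In the closure [X w = - l i w], so the left-hand side is [l |w|^2]; since [m < l], this forces
   [w = 0]. *)
have h : rip ('i%C *: (- l%:C *: ('i%C *: w))) w <= m * hnorm w ^+ 2.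
  have h1 : (fun n => rip ('i%C *: X (v n)) (v n)) @ \oo -->
      rip ('i%C *: (- l%:C *: ('i%C *: w))) w.
    apply: cvg_rip; last by rewrite -vw.
    by rewrite vw subrK in Xvl; exact: cvgZr.
  have h2 : (fun n => m * rip (v n) (v n)) @ \oo --> m * rip w w.
    by apply: cvgMr; rewrite -vw; exact: cvg_rip.
  rewrite -rip_norm -subr_ge0; apply: (cvgr_to_ge (cvgB h2 h1)).
  by apply: nearW => n; rewrite /= subr_ge0 rip_norm; exact: Tm.
apply: hnorm_sqr0; move: h.
rewrite scalerA mulrC -scalerA scaleii scalerN scaleNr opprK ripZl rip_norm.
by have := sqr_ge0 (hnorm w); nra.
Qed.

Theorem spectrum_sup : (exists v : H, v != 0) ->
  ereal_sup [set l%:E | l in [set l : R | spectrum (closure (graph T)) l%:C]] =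
  ereal_sup [set (rip ('i%C *: X x) x)%:E | x in [set x | D x /\ hnorm x = 1]].
Proof.
move=> [v0 v0n0].
have normalize x : D x -> x != 0 ->
    D (((hnorm x)^-1)%:C *: x) /\ hnorm (((hnorm x)^-1)%:C *: x) = 1.
  move=> Dx x0; split.
    by have [] := @Xlin ((hnorm x)^-1)%:C _ _ Dx D0; rewrite addr0.
  by rewrite hnormZ gtr0_norm ?invr_gt0 ?hnorm_gt0// mulVf// gt_eqF// hnorm_gt0.
have qZ (m : R) : (forall x, D x -> hnorm x = 1 -> rip ('i%C *: X x) x <= m) ->
    forall x, D x -> rip (T x) x <= m * hnorm x ^+ 2.
  move=> mub x Dx; have [->|x0] := eqVneq x 0.
    by rewrite rip0r hnorm0 expr0n mulr0.
  have [Dx1 x1] := normalize _ Dx x0; have := mub _ Dx1 x1.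
  have [_] := @Xlin ((hnorm x)^-1)%:C _ _ Dx D0; rewrite addr0 => ->.
  have [_] := @Xlin (-1) _ _ D0 D0; rewrite !scaleN1r !addNr => ->.
  rewrite addr0 scalerA mulrC -scalerA ripZl ripZr mulrA -expr2 exprVn mulrC.
  by rewrite ler_pdivrMr// exprn_gt0// hnorm_gt0.
apply/eqP; rewrite eq_le; apply/andP; split.
  apply: ub_ereal_sup => _ [l lspec <-]; rewrite leNgt; apply/negP => lgt.
  have [x1 Dx1 x1n0] : exists2 x, D x & x != 0.
    have [x Dx xv] := D_dense v0 (hnorm_gt0 v0n0); exists x => //.
    by apply: contraTneq xv => ->; rewrite subr0 ltxx.
  have [Dy y1] := normalize _ Dx1 x1n0.
  set s := ereal_sup _ in lgt.
  have sub x : D x -> hnorm x = 1 -> ((rip ('i%C *: X x) x)%:E <= s)%E.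
    by move=> Dx x1'; apply: ereal_sup_ubound; exists x.
  (* The unit vector excludes [-oo], and [lgt] excludes [+oo]. *)
  have := sub _ Dy y1; move: lgt sub; case: s => [m|//|//].
  rewrite lte_fin => ml mub _; apply: (@spectrum_lt _ _ T) lspec => //.
  - exact: skew_linear_operator.
  - exact: ml.
  - by apply: qZ => x Dx x1'; rewrite -lee_fin; exact: mub.
  - apply: skew_range_orthogonal ml _ => //.
    by apply: qZ => x Dx x1'; rewrite -lee_fin; exact: mub.
apply: ub_ereal_sup => _ [x [Dx x1] <-].
set s := ereal_sup _.
have sub (a : R) : (s <= a%:E)%E -> rip ('i%C *: X x) x <= a.
  move=> sa; have := @spectrum_ub _ _ T skew_symmetric a.
  rewrite /= => /(_ _ x Dx); rewrite x1 expr1n mulr1; apply => r ar rspec.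
  have : (r%:E <= s)%E by apply: ereal_sup_ubound; exists r.
  by move=> /le_trans/(_ sa); rewrite lee_fin leNgt ar.
case: s sub => [a||] sub; first by rewrite lee_fin; exact: sub.
  by rewrite leey.
(* If the supremum of the spectrum were [-oo], every real number would bound this value, even the
   value minus [1]. *)
by have := sub (rip ('i%C *: X x) x - 1) (leNye _); rewrite lerDl oppr_ge0 ler10.
Qed.

End skew_generator.

(** * Differential calculus in the sense of Michal and Bastiani *)

Section differential_calculus.
Context (R : realType).

Definition is_linear (V W : tvsType R) (L : V -> W) :=
  forall (a : R) x y, L (a *: x + y) = a *: L x + L y.

Lemma hausdorff_prod (T U : topologicalType) :
  hausdorff_space T -> hausdorff_space U -> hausdorff_space (T * U)%type.
Proof.
move=> hT hU [x y] [x' y'] xy; congr (_, _).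
  apply: hT => A B Ax Bx'.
  have [[z w] [/= Az Bz]] := xy (fst @^-1` A) (fst @^-1` B)
    (@cvg_fst _ _ (nbhs x) (nbhs y) _ _ Ax) (@cvg_fst _ _ (nbhs x') (nbhs y') _ _ Bx').
  by exists z.
apply: hU => A B Ay By'.
have [[z w] [/= Aw Bw]] := xy (snd @^-1` A) (snd @^-1` B)
  (@cvg_snd _ _ (nbhs x) (nbhs y) _ _ Ay) (@cvg_snd _ _ (nbhs x') (nbhs y') _ _ By').
by exists w.
Qed.

Lemma diff_quotientP (E F : tvsType R) (f : E -> F) x h l :
  diff_quotient f x h @ 0^' --> l <-> has_deriv (fun t => f (x + t *: h)) 0 l.
Proof.
rewrite /has_deriv; suff -> : (fun t : R => t^-1 *: (f (x + (0 + t) *: h) -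
    f (x + 0 *: h))) = diff_quotient f x h by [].
by apply/funext => t; rewrite add0r scale0r addr0.
Qed.

Lemma dderivP (E F : tvsType R) (f : E -> F) x h : dderivable f x h ->
  has_deriv (fun t => f (x + t *: h)) 0 (dderiv f x h).
Proof.
move=> fxh; apply/diff_quotientP.
exact: (xgetPex 0 (P := [set l | diff_quotient f x h @ 0^' --> l])).
Qed.

Lemma dderivE (E F : tvsType R) (f : E -> F) x h l : hausdorff_space F ->
  has_deriv (fun t => f (x + t *: h)) 0 l -> dderiv f x h = l.
Proof.
move=> hF fl; apply: (has_deriv_unique hF _ fl); apply: dderivP.
by exists l; apply/diff_quotientP.
Qed.

(** Introduction rule with an explicit differential [df] in place of the chosen [dderiv]; the two
    agree because limits in [F] are unique. *)
Lemma CnS (n : nat) (E F : tvsType R) (f : E -> F) (df : E * E -> F) :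
  hausdorff_space F -> continuous f ->
  (forall x h, has_deriv (fun t => f (x + t *: h)) 0 (df (x, h))) ->
  Cn n df -> Cn n.+1 f.
Proof.
move=> hF fc fd dfn; split=> // [x h|]; first by exists (df (x, h)); apply/diff_quotientP.
suff -> : (fun p => dderiv f p.1 p.2) = df by [].
by apply/funext => -[x h] /=; exact: dderivE.
Qed.

Lemma CnS_inv (n : nat) (E F : tvsType R) (f : E -> F) : Cn n.+1 f ->
  [/\ continuous f,
      forall x h, has_deriv (fun t => f (x + t *: h)) 0 (dderiv f x h) &
      Cn n (fun p : E * E => dderiv f p.1 p.2)].
Proof. by move=> [fc fd dfn]; split=> // x h; exact: dderivP. Qed.

Lemma Cn_continuous n (E F : tvsType R) (f : E -> F) : Cn n f -> continuous f.
Proof. by case: n => // n []. Qed.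

Lemma Cn_le n (E F : tvsType R) (f : E -> F) : Cn n.+1 f -> Cn n f.
Proof.
elim: n E F f => [E F f [] //|n IH E F f [fc fd dfn]].
by split=> //; apply: IH.
Qed.

Lemma Cn_cst n (E F : tvsType R) (y : F) : hausdorff_space F ->
  Cn n (fun _ : E => y).
Proof.
move=> hF; elim: n E y => [E y|n IH E y]; first by move=> x; exact: cvg_cst.
apply: (@CnS _ _ _ _ (fun=> 0)) => //; first by move=> x; exact: cvg_cst.
by move=> x h; exact: has_deriv_cst.
Qed.

Lemma continuous_affine (E F : tvsType R) (c : F) (L : E -> F) :
  continuous L -> continuous (fun x => c + L x).
Proof. by move=> Lc x; apply: tvs_cvgD; [exact: cvg_cst|exact: Lc]. Qed.

(** Affine maps keep the induction closed: the differential is that of [f] after the affine map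
    sending [(x, h)] to [(c, 0) + (L x, L h)]. *)
Lemma Cn_precomp n (E E' F : tvsType R) (f : E' -> F) (c : E') (L : E -> E') :
  hausdorff_space F -> is_linear L -> continuous L ->
  Cn n f -> Cn n (fun x => f (c + L x)).
Proof.
move=> hF; elim: n E E' f c L => [|n IH] E E' f c L Llin Lc.
  by move=> fc x; apply: (@continuous_comp _ _ _ (fun x => c + L x) f);
    [exact: continuous_affine|exact: fc].
move=> fn; have [fc fd dfn] := CnS_inv fn.
apply: (@CnS _ _ _ _ (fun p => dderiv f (c + L p.1) (L p.2))) => //.
- by move=> x; apply: (@continuous_comp _ _ _ (fun x => c + L x) f);
    [exact: continuous_affine|exact: fc].
- move=> x h; apply: eq_has_deriv (fd (c + L x) (L h)) => t.
  by rewrite -addrA (addrC x) Llin (addrC (L x)).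
- have -> : (fun p => dderiv f (c + L p.1) (L p.2)) =
      (fun p => (fun q => dderiv f q.1 q.2) ((c, 0) + (L p.1, L p.2))).
    by apply/funext => p /=; rewrite add0r.
  apply: IH dfn; first by move=> a [x h] [y k] /=; rewrite !Llin.
  by move=> p; apply: cvg_pair; apply: continuous_cvg; [exact: Lc|exact: cvg_fst|
    exact: Lc|exact: cvg_snd].
Qed.

Lemma Cn_linear n (E E' F : tvsType R) (f : E' -> F) (L : E -> E') :
  hausdorff_space F -> is_linear L -> continuous L ->
  Cn n f -> Cn n (fun x => f (L x)).
Proof.
move=> hF Llin Lc fn; have := @Cn_precomp n E E' F f 0 L hF Llin Lc fn.
by under eq_fun do rewrite add0r.
Qed.

Lemma is_linear_fst (E F : tvsType R) : is_linear (fst : E * F -> E).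
Proof. by []. Qed.

Lemma is_linear_snd (E F : tvsType R) : is_linear (snd : E * F -> F).
Proof. by []. Qed.

Lemma continuous_fst (E F : topologicalType) : continuous (fst : E * F -> E).
Proof. by move=> p; exact: (@cvg_fst _ _ (nbhs p.1) (nbhs p.2) _). Qed.

Lemma continuous_snd (E F : topologicalType) : continuous (snd : E * F -> F).
Proof. by move=> p; exact: (@cvg_snd _ _ (nbhs p.1) (nbhs p.2) _). Qed.

Lemma continuous_pair (E F G : topologicalType) (f : E -> F) (g : E -> G) :
  continuous f -> continuous g -> continuous (fun x => (f x, g x)).
Proof. by move=> fc gc x; apply: cvg_pair; [exact: fc|exact: gc]. Qed.

Lemma Cn_id n (E : tvsType R) : hausdorff_space E -> Cn n (fun x : E => x).
Proof.
move=> hE; case: n => [|n]; first by move=> x; exact: cvg_id.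
apply: (@CnS _ _ _ _ snd) => //.
- by move=> x; exact: cvg_id.
- move=> x h; have := has_derivD (has_deriv_cst x 0) (@has_deriv_linear _ _ h 0).
  by rewrite add0r.
- elim: n => [|n IH]; first exact: continuous_snd.
  apply: (@CnS _ _ _ _ (fun p => p.2.2)) => //; first exact: continuous_snd.
    move=> x h; have := has_derivD (has_deriv_cst x.2 0) (@has_deriv_linear _ _ h.2 0).
    by rewrite add0r.
  by apply: (@Cn_linear _ _ _ _ (snd : E * E -> E) snd) => //; exact: continuous_snd.
Qed.

Lemma Cn_linear_comp n (E F F' : tvsType R) (f : E -> F) (L : F -> F') :
  hausdorff_space F' -> is_linear L -> continuous L ->
  Cn n f -> Cn n (fun x => L (f x)).
Proof.
move=> hF' Llin Lc; elim: n E f => [|n IH] E f fn.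
  by move=> x; apply: (@continuous_comp _ _ _ f L); [exact: fn|exact: Lc].
have [fc fd dfn] := CnS_inv fn.
apply: (@CnS _ _ _ _ (fun p => L (dderiv f p.1 p.2))) => //.
- by move=> x; apply: (@continuous_comp _ _ _ f L); [exact: fc|exact: Lc].
- by move=> x h; apply: has_deriv_comp_linear.
- exact: IH.
Qed.

Lemma CnD n (E F : tvsType R) (f g : E -> F) : hausdorff_space F ->
  Cn n f -> Cn n g -> Cn n (fun x => f x + g x).
Proof.
move=> hF; elim: n E f g => [|n IH] E f g fn gn.
  by move=> x; apply: tvs_cvgD; [exact: fn|exact: gn].
have [fc fd dfn] := CnS_inv fn; have [gc gd dgn] := CnS_inv gn.
apply: (@CnS _ _ _ _ (fun p => dderiv f p.1 p.2 + dderiv g p.1 p.2)) => //.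
- by move=> x; apply: tvs_cvgD; [exact: fc|exact: gc].
- by move=> x h; exact: has_derivD.
- exact: IH.
Qed.

Lemma Cn_pair n (E F G : tvsType R) (f : E -> F) (g : E -> G) :
  hausdorff_space F -> hausdorff_space G ->
  Cn n f -> Cn n g -> Cn n (fun x => (f x, g x)).
Proof.
move=> hF hG; elim: n E f g => [|n IH] E f g fn gn; first exact: continuous_pair.
have [fc fd dfn] := CnS_inv fn; have [gc gd dgn] := CnS_inv gn.
apply: (@CnS _ _ _ _ (fun p => (dderiv f p.1 p.2, dderiv g p.1 p.2))) => //.
- exact: hausdorff_prod.
- exact: continuous_pair.
- by move=> x h; exact: has_deriv_pair.
- exact: IH.
Qed.

Lemma Cn_bilinear n (E F G K : tvsType R) (B : F -> G -> K) (f : E -> F) (g : E -> G) :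
  hausdorff_space F -> hausdorff_space G -> hausdorff_space K ->
  (forall y, is_linear (B^~ y)) -> (forall x, is_linear (B x)) ->
  continuous (fun p : F * G => B p.1 p.2) ->
  Cn n f -> Cn n g -> Cn n (fun x => B (f x) (g x)).
Proof.
move=> hF hG hK Bl Br Bc; elim: n E f g => [|n IH] E f g fn gn.
  move=> x; apply: (@continuous_comp _ _ _ (fun x => (f x, g x)) (fun p => B p.1 p.2)).
    exact: continuous_pair.
  exact: Bc.
have [fc fd dfn] := CnS_inv fn; have [gc gd dgn] := CnS_inv gn.
apply: (@CnS _ _ _ _ (fun p => B (dderiv f p.1 p.2) (g p.1) +
    B (f p.1) (dderiv g p.1 p.2))) => //.
- move=> x; apply: (@continuous_comp _ _ _ (fun x => (f x, g x)) (fun p => B p.1 p.2)).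
    exact: continuous_pair.
  exact: Bc.
- move=> x h; have := has_deriv_bilinear (fun a x x' y => Bl y a x x')
    (fun a x y y' => Br x a y y') Bc (fd x h) (gd x h).
  by rewrite scale0r addr0.
- apply: CnD => //; apply: IH => //.
    by apply: (Cn_linear (L := fst)) => //; [exact: continuous_fst|exact: Cn_le].
  by apply: (Cn_linear (L := fst)) => //; [exact: continuous_fst|exact: Cn_le].
Qed.

(** * Mean value theorem and chain rule for Hilbert-valued maps *)

Section hilbert_valued.
Context (H : hilbertType R).

(** The point [c] depends on [w], so one direction at a time is controlled; taking for [w] the error
    to be estimated turns this into a norm bound. *)
Lemma hilbert_mean_value (f f' : R -> realify H) (w : H) :
  (forall t, has_deriv f t (f' t)) ->
  exists2 c : R, 0 < c < 1 & rip (f 1 - f 0 : H) w = rip (f' c) w.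
Proof.
move=> fd; have gd (t : R) : is_derive t 1 (fun t => rip (f t : H) w) (rip (f' t : H) w).
  apply: has_deriv_is_derive.
  have := has_deriv_rip (fd t) (has_deriv_cst (w : realify H) t).
  by rewrite rip0r addr0.
have [|c] := MVT (@ltr01 R) (fun t _ => gd t).
  apply: derivable_within_continuous => t _.
  by have [] := gd t.
rewrite in_itv /= subr0 mulr1 => c01 e; exists c => //.
by rewrite ripBl.
Qed.

Section strict.
Context (E : tvsType R) (f : E -> realify H) (df : E * E -> realify H).
Hypothesis fd : forall x h, has_deriv (fun t => f (x + t *: h)) 0 (df (x, h)).
Hypothesis df_cont : continuous df.

Lemma has_deriv_line x h t :
  has_deriv (fun t => f (x + t *: h)) t (df (x + t *: h, h)).
Proof.
have -> : df (x + t *: h, h) = 1 *: df (x + t *: h, h) by rewrite scale1r.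
have h1 := @fd (x + t *: h) h.
apply: (eq_has_deriv (f := fun u => (fun v => f (x + t *: h + v *: h)) (- t + 1 * u))).
  by move=> u /=; rewrite mul1r -addrA -scalerDl addrA subrr add0r.
apply: (@has_deriv_affine _ (realify H) (- t) 1 (fun v => f (x + t *: h + v *: h))).
by rewrite mul1r addNr.
Qed.

Lemma diff_homogeneous x (a : R) h : df (x, a *: h) = a *: df (x, h).
Proof.
apply: (has_deriv_unique (@hausdorff_realify R H) (@fd x (a *: h))).
apply: (eq_has_deriv (f := fun u => (fun v => f (x + v *: h)) (0 + a * u))).
  by move=> u /=; rewrite add0r scalerA mulrC.
apply: (@has_deriv_affine _ (realify H) 0 a (fun v => f (x + v *: h))).
by rewrite mulr0 addr0.
Qed.

(** Base point and direction both move with [s], as the chain rule and the additivity of the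
    differential require. *)
Lemma strict_differentiability (q k : R -> E) x h :
  q @ 0^' --> x -> k @ 0^' --> h ->
  (fun s => s^-1 *: (f (q s + s *: k s) - f (q s))) @ 0^' --> df (x, h).
Proof.
move=> qx kh; apply/(@cvg_hnorm R H) => e e0.
pose g (p : E * (R^o * E)) : realify H := df (p.1 + p.2.1 *: p.2.2, p.2.2).
have gc : continuous g.
  move=> p; apply: (@continuous_comp _ _ _
      (fun p : E * (R^o * E) => (p.1 + p.2.1 *: p.2.2, p.2.2)) df); last exact: df_cont.
  apply: continuous_pair.
    move=> {}p; apply: tvs_cvgD; first exact: continuous_fst.
    apply: tvs_cvgZ; apply: (@continuous_comp _ _ _ snd).
    - exact: continuous_snd.
    - exact: continuous_fst.
    - exact: continuous_snd.
    - exact: continuous_snd.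
  by move=> {}p; apply: (@continuous_comp _ _ _ snd snd); exact: continuous_snd.
have : nbhs (x, (0 : R^o, h)) [set p | hnorm (df (x, h) - g p : H) < e].
  have -> : df (x, h) = g (x, (0 : R^o, h)) by rewrite /g /= scale0r addr0.
  exact: gc _ _ (nbhs_hnorm (g (x, (0, h)) : H) e0).
move=> [[A B] [/= Ax [[C D] [/= C0 Dh] CDB]] ABg].
move: C0 => /nbhs_ballP[d /= d0 dC].
have /near0P[d1 d10 d1P] := qx _ Ax; have /near0P[d2 d20 d2P] := kh _ Dh.
apply/near0P; exists (Num.min d (Num.min d1 d2)); first by rewrite !lt_min d0 d10.
move=> s; rewrite !lt_min => /and3P[sd sd1 sd2] s0 /=.
(* Paired with the error [w], the quotient equals [df] at a point of the segment, close to [(x, h)];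
   hence [|w|^2 <= |df (x, h) - g _| |w|]. *)
set w : H := df (x, h) - _.
have [c /andP[c0 c1]] := hilbert_mean_value w
  (fun t => @has_deriv_line (q s) (s *: k s) t).
rewrite scale1r scale0r addr0 diff_homogeneous => cE.
have gs : hnorm (df (x, h) - g (q s, (c * s, k s)) : H) < e.
  apply: ABg; split=> /=; first exact: d1P.
  apply: CDB; split=> /=; last exact: d2P.
  apply: dC; rewrite /ball /= sub0r normrN normrM (le_lt_trans _ sd)//.
  by rewrite ler_piMl// ger0_norm ltW.
suff : hnorm w <= hnorm (df (x, h) - g (q s, (c * s, k s)) : H).
  by move=> /le_lt_trans; apply.
have [->|w0] := eqVneq w 0; first by rewrite hnorm0 hnorm_ge0.
rewrite -(ler_pM2r (hnorm_gt0 w0)) -expr2 -rip_norm.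
apply: le_trans (rip_CauchySchwarz _ _); apply: le_trans (ler_norm _).
rewrite {1}/w !ripBl; apply: lerB => //.
have sE (a : R) (z : realify H) : rip (a *: z : H) w = a * rip (z : H) w.
  exact: ripZl.
by rewrite sE cE sE /g /= scalerA mulrA mulVf// mul1r.
Qed.

Lemma chain_rule (c : R -> E) t h : has_deriv c t h ->
  has_deriv (fun t => f (c t)) t (df (c t, h)).
Proof.
(* The moving direction is the difference quotient of [c]. *)
move=> cd; apply: (@eq_cvg_dnbhs0 _ (realify H) _ (fun s =>
    s^-1 *: (f (c t + s *: (s^-1 *: (c (t + s) - c t))) - f (c t)))).
  by move=> s s0; rewrite scalerA divff// scale1r [c t + _]addrC subrK.
by apply: (strict_differentiability _ cd); exact: cvg_cst.
Qed.

(** The increment along [h + k] is split at [x + s h]; the second part starts from a moving base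
    point. *)
Lemma diffD x h k : df (x, h + k) = df (x, h) + df (x, k).
Proof.
apply: (has_deriv_unique (@hausdorff_realify R H) (@fd x (h + k))).
have qx : (fun s => x + s *: h) @ 0^' --> x.
  rewrite -[X in _ --> X]addr0 -(scale0r h).
  apply: tvs_cvgD; first exact: cvg_cst.
  by apply: tvs_cvgZ; [exact: cvg_dnbhs0|exact: cvg_cst].
apply: (@eq_cvg_dnbhs0 _ (realify H) _ (fun s =>
    s^-1 *: (f (x + (0 + s) *: h) - f (x + 0 *: h)) +
    s^-1 *: (f (x + s *: h + s *: k) - f (x + s *: h)))).
  move=> s s0; rewrite -scalerDr !add0r !scale0r !addr0 [in RHS]addrC subrKA.
  by rewrite [s *: (h + k)]scalerDr addrA.
apply: tvs_cvgD; first exact: fd.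
by apply: (strict_differentiability qx (k := fun=> k)); exact: cvg_cst.
Qed.

End strict.

(** The differential is again a composite, of that of [f] with the pair formed by [g] and its
    differential, so the induction ranges over all domains. *)
Lemma Cn_comp n (E F : tvsType R) (f : F -> realify H) (g : E -> F) :
  hausdorff_space F -> Cn n f -> Cn n g -> Cn n (fun x => f (g x)).
Proof.
elim: n E F f g => [|n IH] E F f g hF fn gn.
  by move=> x; apply: (@continuous_comp _ _ _ g f); [exact: gn|exact: fn].
have [fc fd dfn] := CnS_inv fn; have [gc gd dgn] := CnS_inv gn.
have hH := @hausdorff_realify R H.
apply: (@CnS _ _ _ _ (fun p => dderiv f (g p.1) (dderiv g p.1 p.2))) => //.
- by move=> x; apply: (@continuous_comp _ _ _ g f); [exact: gc|exact: fc].
- move=> x h; have := chain_rule fd (Cn_continuous dfn) (gd x h).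
  by rewrite scale0r addr0.
- apply: (IH _ _ (fun q => dderiv f q.1 q.2)
    (fun p => (g p.1, dderiv g p.1 p.2))) => //; first exact: hausdorff_prod.
  apply: Cn_pair => //.
  by apply: (Cn_linear (L := fst)) => //; [exact: continuous_fst|exact: Cn_le].
Qed.

End hilbert_valued.

End differential_calculus.

(** * One-parameter groups of an embedded oscillator group *)

Section embedded_oscillator.
Context (R : realType) (V : tvsType R) (G : oscillator V).
Context (HA : hilbertType R) (A : standard HA) (iota : {linear V -> Cinfty A}).
Hypothesis iotaP : standard_embedding G iota.
Local Notation osc V := (R^o * V * R^o)%type.
Local Notation om := (omega G).
Local Notation gam := (gamma G).
Local Notation mul := (group_mul (omega G) (gamma G)).
Local Notation gen := (generator (gamma G)).

Definition emb (x : V) : realify HA := Cinfty_incl (iota x).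

Lemma emb_linear : is_linear emb.
Proof. by move=> a x y; rewrite /emb linearP. Qed.

Lemma emb0 : emb 0 = 0.
Proof. by have := emb_linear (-1) 0 0; rewrite scaler0 addr0 scaleN1r addNr. Qed.

Lemma embZ a x : emb (a *: x) = a *: emb x.
Proof. by have := emb_linear a x 0; rewrite emb0 !addr0. Qed.

Lemma embD x y : emb (x + y) = emb x + emb y.
Proof. by have := emb_linear 1 x y; rewrite !scale1r. Qed.

Lemma embB x y : emb (x - y) = emb x - emb y.
Proof. by rewrite embD -scaleN1r embZ scaleN1r. Qed.

Lemma emb_inj x y : emb x = emb y -> x = y.
Proof. by move=> e; apply: (iota_injective iotaP); apply: val_inj. Qed.

Lemma emb_continuous : continuous emb.
Proof.
move=> x; have h := @iota_continuous _ _ _ _ _ _ iotaP x.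
exact: (proj1 (cvg_Cinfty _ iota (iota x)) h 0%N).
Qed.

Lemma std_exp_rip t (x y : HA) : rip (std_exp A t x) (std_exp A t y) = rip x y.
Proof.
have [/(_ t)[_ _ Uip] _ _ _] := std_expP A.
by rewrite /rip Uip.
Qed.

Lemma std_exp0 (x : HA) : std_exp A 0 x = x.
Proof.
have [/(_ 0)[_ Ubij _] UD _ _] := std_expP A.
by apply: (bij_inj Ubij); rewrite -UD addr0.
Qed.

Lemma std_gamma0 (x : Cinfty A) : std_gamma 0 x = x.
Proof. by apply: val_inj; exact: std_exp0. Qed.

Lemma iota_gamma t x : iota (gam t x) = std_gamma t (iota x).
Proof.
have := osc_map_mul iotaP (0, 0, t) (0, x, 0).
by rewrite /osc_map /= linear0 => -[_ +]; rewrite !add0r.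
Qed.

Lemma emb_gamma t x : emb (gam t x) = std_exp A t (emb x).
Proof. by rewrite /emb iota_gamma. Qed.

Lemma rip_gamma t x y : rip (emb (gam t x) : HA) (emb (gam t y) : HA) =
  rip (emb x : HA) (emb y : HA).
Proof. by rewrite !emb_gamma std_exp_rip. Qed.

Lemma omega_iota x y : om x y = @std_omega _ _ A (iota x) (iota y).
Proof.
have := osc_map_mul iotaP (0, x, 0) (0, y, 0).
rewrite /osc_map /= => -[+ _]; rewrite std_gamma0 gamma0 !add0r.
by move=> /(mulfI _); apply; rewrite invr_neq0.
Qed.

Lemma gammaL t : is_linear (gam t).
Proof. by move=> a x y; exact: gamma_linear. Qed.

Lemma gamma_zero t : gam t 0 = 0.
Proof. by have := gammaL t (-1) 0 0; rewrite scaler0 addr0 scaleN1r addNr. Qed.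

Lemma gammaZ t a x : gam t (a *: x) = a *: gam t x.
Proof. by have := gammaL t a x 0; rewrite gamma_zero !addr0. Qed.

Lemma omega_linear_r x : is_linear (om x : V -> R^o).
Proof.
move=> a y y'; rewrite [LHS]omega_skew omega_linear opprD -mulrN.
by rewrite -!(omega_skew G x).
Qed.

Lemma omegaxx x : om x x = 0.
Proof. by have := omega_skew G x x => ?; lra. Qed.

Lemma gamma_time_smooth x : smooth ((fun t => gam t x) : R^o -> V).
Proof.
move=> n; have := @Cn_precomp R n R^o (R^o * V)%type V (fun p => gam p.1 p.2) (0, x)
  (fun t => (t, 0)) (osc_hausdorff G).
rewrite /= => h; have {}h := h _ _ (gamma_smooth G n).
have -> : (fun t : R^o => gam t x) = (fun t : R^o => gam (0 + t) (x + 0)).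
  by apply/funext => t; rewrite add0r addr0.
apply: h.
  move=> a s t; rewrite [RHS](_ : _ = (a *: s + t, a *: 0 + 0))//.
  by rewrite scaler0 addr0.
by apply: continuous_pair; [move=> t; exact: cvg_id|move=> t; exact: cvg_cst].
Qed.

Lemma gamma_continuous t : continuous (gam t).
Proof.
move=> x; apply: (@continuous_comp _ _ _ (fun x => ((t : R^o), x)) (fun p => gam p.1 p.2)).
  have cc : continuous (fun x : V => (t : R^o, x)).
    by apply: continuous_pair => y; [exact: cvg_cst|exact: cvg_id].
  exact: cc.
exact: (gamma_smooth G 0 (t, x)).
Qed.

Lemma has_deriv_smooth (W : tvsType R) (c : R^o -> W) t : smooth c ->
  has_deriv c t (dderiv c t 1).
Proof.
move=> /(_ 1%N)/CnS_inv[_ /(_ t 1) h _].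
apply: (@eq_cvg_dnbhs0 _ W _ _ _ _ h) => u u0.
rewrite add0r scale0r addr0; congr (_ *: (c (_ + _) - _)).
by rewrite /GRing.scale /= mulr1.
Qed.

Lemma gamma_deriv0 x : has_deriv (fun t => gam t x) 0 (gen x).
Proof. exact: (has_deriv_smooth (gamma_time_smooth x)). Qed.

Lemma gen_unique x l : has_deriv (fun t => gam t x) 0 l -> gen x = l.
Proof. exact: (has_deriv_unique (osc_hausdorff G) (@gamma_deriv0 x)). Qed.

Lemma emb_gen x : dom A (emb x) /\ (emb (gen x) : HA) = 'i%C *: A (emb x).
Proof.
have [_ _ _ Ugen] := std_expP A.
suff /Ugen[Ax Ax'] : (fun t : R => (t^-1)%:C *: (std_exp A t (emb x) - (emb x : HA))) @ 0^'
    --> (emb (gen x) : HA) by [].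
have h := has_deriv_comp_linear emb_linear emb_continuous (@gamma_deriv0 x).
apply: (@eq_cvg_dnbhs0 R HA _ _ _ _ h) => t t0.
by rewrite add0r gamma0 emb_gamma.
Qed.

(** From [omega_A (x, y) = Im <A x, y>] and [D = i A] on [V]. Through this identity the norm of [HA]
    enters the adjoint action. *)
Lemma omega_gen x y : om x y = - rip (emb (gen x) : HA) (emb y).
Proof.
rewrite omega_iota /std_omega Im_ip (emb_gen x).2.
by rewrite ripJl opprK.
Qed.

Lemma hausdorff_osc : hausdorff_space (osc V).
Proof.
apply: hausdorff_prod; last exact: Rhausdorff.
by apply: hausdorff_prod; [exact: Rhausdorff|exact: osc_hausdorff].
Qed.

Section primitive.
Variables (x : V) (p : R -> V).
Hypothesis p0 : p 0 = 0.
Hypothesis pd : forall t, has_deriv p t (gam t x).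

(** As functions of [u] both sides have derivative [gam (t + u) x] and agree at [u = 0]; equality is
    read off in [HA]. *)
Lemma primitive_cocycle t u : p (t + u) = p t + gam t (p u).
Proof.
apply: emb_inj; apply/eqP; rewrite -subr_eq0 -embB; apply/eqP.
pose f v := emb (p (t + v) - (p t + gam t (p v))).
have : f u = f 0.
  apply: has_deriv0_hilbert => v.
  rewrite -emb0; apply: (has_deriv_comp_linear emb_linear emb_continuous).
  rewrite [X in has_deriv _ _ X](_ : _ = gam (t + v) x - (0 + gam t (gam v x))); last first.
    by rewrite add0r -gammaD subrr.
  apply: has_derivB.
    have := @has_deriv_affine R V t 1 p v (gam (t + v) x).
    rewrite mul1r scale1r => h; apply: eq_has_deriv (h (@pd _)) => w.
    by rewrite mul1r.
  apply: has_derivD; first exact: has_deriv_cst.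
  exact: (has_deriv_comp_linear (@gammaL t) (@gamma_continuous t)).
by rewrite /f addr0 p0 gamma_zero addr0 subrr emb0.
Qed.

(** The cocycle identity gives [gam h (p t) = p (t + h) - p h], to be differentiated at [h = 0]. *)
Lemma gen_primitive t : gen (p t) = gam t x - x.
Proof.
apply: gen_unique.
have e h : gam h (p t) = p (t + h) - p h.
  by rewrite [t + h]addrC primitive_cocycle addrAC subrr add0r.
apply: (eq_has_deriv (f := fun h => p (t + 1 * h) - p h)).
  by move=> h; rewrite e mul1r.
apply: has_derivB.
  have := @has_deriv_affine R V t 1 p 0 (gam t x).
  by rewrite scale1r mulr0 addr0; apply.
by have := @pd 0; rewrite gamma0.
Qed.

End primitive.

Lemma primitive_exists x : exists p : R -> V,
  [/\ p 0 = 0, smooth (p : R^o -> V) & forall t, has_deriv p t (gam t x)].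
Proof.
have [b bs bd] := gamma_antiderivative G x.
exists (fun t => b t - b 0); split; first by rewrite subrr.
  move=> n; apply: CnD => //; first exact: osc_hausdorff.
  by apply: Cn_cst; exact: osc_hausdorff.
move=> t; rewrite -[gam t x]subr0; apply: has_derivB; last exact: has_deriv_cst.
by rewrite -bd; exact: has_deriv_smooth.
Qed.

Lemma smooth_scale_time (W : tvsType R) (f : R^o -> W) (s : R) :
  hausdorff_space W -> smooth f -> smooth ((fun t => f (s * t)) : R^o -> W).
Proof.
move=> hW fs n; apply: (@Cn_linear R n R^o R^o W f (fun t => s * t)) => //.
- by move=> a t u; rewrite /GRing.scale /=; ring.
- exact: mulrl_continuous.
Qed.

Lemma smooth_linear (W W' : tvsType R) (L : W -> W') (f : R^o -> W) :
  hausdorff_space W' -> is_linear L -> continuous L -> smooth f ->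
  smooth (fun t => L (f t)).
Proof. by move=> hW' Ll Lc fs n; exact: Cn_linear_comp. Qed.

Lemma smooth_pair (W W' : tvsType R) (f : R^o -> W) (g : R^o -> W') :
  hausdorff_space W -> hausdorff_space W' -> smooth f -> smooth g ->
  smooth (fun t => (f t, g t)).
Proof. by move=> hW hW' fs gs n; exact: Cn_pair. Qed.

Lemma eq_smooth (W W' : tvsType R) (f g : W -> W') : f =1 g -> smooth f -> smooth g.
Proof. by move=> /funext ->. Qed.

Lemma smoothD (W : tvsType R) (f g : R^o -> W) : hausdorff_space W ->
  smooth f -> smooth g -> smooth (fun t => f t + g t).
Proof. by move=> hW fs gs n; exact: CnD. Qed.

Lemma smoothZ (W : tvsType R) (s : R) (f : R^o -> W) : hausdorff_space W ->
  smooth f -> smooth (fun t => s *: f t).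
Proof.
move=> hW; apply: smooth_linear => //.
  by move=> a x y; rewrite scalerDr !scalerA mulrC.
by move=> x; apply: tvs_cvgZ; [exact: cvg_cst|exact: cvg_id].
Qed.

Lemma smoothN (W : tvsType R) (f : R^o -> W) : hausdorff_space W ->
  smooth f -> smooth (fun t => - f t).
Proof.
move=> hW fs; apply: (eq_smooth (f := fun t => -1 *: f t)); last exact: smoothZ.
by move=> t; rewrite scaleN1r.
Qed.

Lemma smooth_scale_vec (W : tvsType R) (x : W) : hausdorff_space W ->
  smooth ((fun t => t *: x) : R^o -> W).
Proof.
move=> hW; apply: (@smooth_linear R^o W (fun t : R^o => t *: x) id) => //.
- by move=> a s t; rewrite scalerDl -scalerA.
- by move=> t; apply: tvs_cvgZ; [exact: cvg_id|exact: cvg_cst].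
- by move=> n; exact: Cn_id.
Qed.

Lemma omegaZl a x y : om (a *: x) y = a * om x y.
Proof.
have o0 : om 0 y = 0.
  by have := omega_linear G y (-1) 0 0; rewrite scaler0 addr0 mulN1r addNr.
by have := omega_linear G y a x 0; rewrite o0 !addr0.
Qed.

Lemma omegaZr a x y : om x (a *: y) = a * om x y.
Proof. by rewrite omega_skew omegaZl [in RHS]omega_skew mulrN. Qed.

Lemma emb_rip_linear x : is_linear ((fun y => rip (emb x : HA) (emb y : HA)) : V -> R^o).
Proof. by move=> a y y'; rewrite emb_linear ripDr ripZr. Qed.

Lemma emb_rip_continuous x :
  continuous ((fun y => rip (emb x : HA) (emb y : HA)) : V -> R^o).
Proof. by move=> y; apply: cvg_rip; [exact: cvg_cst|exact: emb_continuous]. Qed.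

Lemma one_parameter_groupP (xi : osc V) (c : R^o -> osc V) :
  smooth c -> (forall s t, c (s + t) = mul (c s) (c t)) ->
  has_deriv c 0 xi -> one_parameter_group om gam xi c.
Proof.
move=> cs cm cd; split=> //.
exact: (has_deriv_unique hausdorff_osc (@has_deriv_smooth _ c 0 cs) cd).
Qed.

(* The central coordinate of [exp (t xi)] integrates [omega y y' / 2], where
   [y] is the vector coordinate; [D (y t) = (gamma (s t) x - x) / s] together
   with [omega u v = - <D u, v>] makes this integral explicit. *)
Lemma one_parameter_group_exists (xi : osc V) :
  exists c, one_parameter_group om gam xi c.
Proof.
case: xi => [[tau x] s].
have hV := osc_hausdorff G; have hR := @Rhausdorff R.
have hRV : hausdorff_space (R^o * V)%type by exact: hausdorff_prod.
have [s0|s0] := eqVneq s 0.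
  exists (fun t => (t *: (tau : R^o), t *: x, t *: (s : R^o))); apply: one_parameter_groupP.
  - apply: smooth_pair => //; last exact: smooth_scale_vec.
    by apply: smooth_pair => //; exact: smooth_scale_vec.
  - move=> t u /=; rewrite s0 !scaler0 gamma0 !scalerDl omegaZl omegaZr omegaxx.
    by rewrite !mulr0 !addr0.
  - by do 2?apply: has_deriv_pair; exact: has_deriv_linear.
have [p [p0 ps pd]] := primitive_exists x.
pose y t := s^-1 *: p (s * t).
pose rx z : R^o := rip (emb x : HA) (emb z : HA).
(* Here [y] has derivative [gam (s t) x], and as [gam] preserves [rip], [omega (y t) (gam (s t) x) =
   - (|x|^2 - <x, gam (s t) x>) / s]. Half of this, integrated from [0], is the second term. *)
pose a t : R^o := t *: (tau : R^o) - (2 * s)^-1 *: (t *: (rx x : R^o) - rx (y t)).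
have ys : smooth (y : R^o -> V).
  by apply: smoothZ => //; exact: smooth_scale_time.
have yd : has_deriv y 0 x.
  have := @has_deriv_affine R V 0 s p 0 (gam 0 x).
  rewrite mulr0 addr0 => /(_ (@pd 0)); rewrite gamma0 => h.
  rewrite -[x](scalerK s0); apply: has_derivZ.
  by apply: eq_has_deriv h => t; rewrite add0r.
have yD t u : y (t + u) = y t + gam (s * t) (y u).
  by rewrite /y mulrDr (primitive_cocycle p0 pd) scalerDr gammaZ.
have genyE t : gen (y t) = s^-1 *: (gam (s * t) x - x).
  apply: gen_unique.
  have h := @gamma_deriv0 (p (s * t)).
  rewrite (gen_primitive p0 pd) in h.
  apply: (eq_has_deriv (f := fun u => s^-1 *: gam u (p (s * t)))).
    by move=> u; rewrite gammaZ.
  exact: has_derivZ.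
exists (fun t => (a t, y t, s * t)); apply: one_parameter_groupP.
- apply: smooth_pair => //; last first.
    apply: (eq_smooth (f := fun t : R^o => t *: (s : R^o))); last exact: smooth_scale_vec.
    by move=> t; rewrite /GRing.scale /= mulrC.
  apply: smooth_pair => //.
  apply: smoothD => //; first exact: smooth_scale_vec.
  apply: smoothN => //; apply: smoothZ => //.
  apply: smoothD => //; first exact: smooth_scale_vec.
  apply: smoothN => //.
  apply: (smooth_linear (L := rx)) => //; first exact: emb_rip_linear.
  exact: emb_rip_continuous.
- move=> t u /=; rewrite -yD -mulrDr; congr (_, _, _).
  rewrite omega_gen genyE embZ embB ripZl ripBl rip_gamma.
  rewrite /a yD /rx embD ripDr /GRing.scale /=.
  by field.
- apply: has_deriv_pair; last first.
    apply: (eq_has_deriv (f := fun t => t *: (s : R^o))); last exact: has_deriv_linear.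
    by move=> t; rewrite /GRing.scale /= mulrC.
  apply: has_deriv_pair => //.
  have -> : tau = (tau : R^o) - (2 * s)^-1 *: ((rx x : R^o) - rx x).
    by rewrite subrr scaler0 subr0.
  apply: has_derivB; first exact: has_deriv_linear.
  apply: has_derivZ; apply: has_derivB; first exact: has_deriv_linear.
  apply: (has_deriv_comp_linear (L := rx)) => //.
    exact: emb_rip_linear.
  exact: emb_rip_continuous.
Qed.

End embedded_oscillator.

(** * Exponential map and conjugation by vectors *)

Section exponential.
Context (R : realType) (V : tvsType R) (G : oscillator V).
Context (HA : hilbertType R) (A : standard HA) (iota : {linear V -> Cinfty A}).
Hypothesis iotaP : standard_embedding G iota.
Local Notation osc V := (R^o * V * R^o)%type.
Local Notation om := (omega G).
Local Notation gam := (gamma G).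
Local Notation mul := (group_mul (omega G) (gamma G)).
Local Notation gen := (generator (gamma G)).
Local Notation emb := (emb iota).

Lemma group_mulE g h : mul g h =
  (g.1.1 + h.1.1 + 2^-1 * om g.1.2 (gam g.2 h.1.2), g.1.2 + gam g.2 h.1.2, g.2 + h.2).
Proof. by case: g => [[? ?] ?]; case: h => [[? ?] ?]. Qed.

Lemma has_deriv_shift (W : tvsType R) (f : R -> W) t l :
  has_deriv (fun h => f (t + h)) 0 l -> has_deriv f t l.
Proof. by rewrite /has_deriv; under eq_fun do rewrite add0r addr0. Qed.

Lemma omega_continuous_r x : continuous (om x : V -> R^o).
Proof.
move=> y; apply: (@continuous_comp _ _ _ (fun y => (x, y)) (fun p => om p.1 p.2 : R^o)).
  have cc : continuous (fun y : V => (x, y)).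
    by apply: continuous_pair => z; [exact: cvg_cst|exact: cvg_id].
  exact: cc.
exact: omega_continuous.
Qed.

Section one_parameter_group.
Variables (xi : osc V) (c : R^o -> osc V).
Hypothesis cP : one_parameter_group om gam xi c.

Lemma one_parameter_group_deriv0 : has_deriv c 0 xi.
Proof. by have [cs _ <-] := cP; exact: has_deriv_smooth. Qed.

Lemma one_parameter_group0 : c 0 = 0.
Proof.
have [_ cm _] := cP; have := cm 0 0; rewrite addr0 group_mulE.
case: (c 0) => [[a y] r] /= [ae ye re].
have r0 : r = 0 by apply: (@addrI _ r); rewrite -re addr0.
rewrite r0 gamma0 in ye ae.
have y0 : y = 0 by apply: (@addrI _ y); rewrite -ye addr0.
rewrite y0 omegaxx mulr0 addr0 in ae.
have a0 : a = 0 by apply: (@addrI _ a); rewrite -ae addr0.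
by rewrite a0 y0 r0.
Qed.

Let a t : R^o := (c t).1.1.
Let y t : V := (c t).1.2.
Let r t : R^o := (c t).2.

Let r_deriv0 : has_deriv r 0 xi.2.
Proof.
exact: (has_deriv_comp_linear (@is_linear_snd _ _ _) (@continuous_snd _ _)
  one_parameter_group_deriv0).
Qed.

Let y_deriv0 : has_deriv y 0 xi.1.2.
Proof.
apply: (has_deriv_comp_linear (@is_linear_snd _ _ _) (@continuous_snd _ _)).
exact: (has_deriv_comp_linear (@is_linear_fst _ _ _) (@continuous_fst _ _)
  one_parameter_group_deriv0).
Qed.

Let a_deriv0 : has_deriv a 0 xi.1.1.
Proof.
apply: (has_deriv_comp_linear (@is_linear_fst _ _ _) (@continuous_fst _ _)).
exact: (has_deriv_comp_linear (@is_linear_fst _ _ _) (@continuous_fst _ _)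
  one_parameter_group_deriv0).
Qed.

Lemma one_parameter_group_time t : (c t).2 = t * xi.2.
Proof.
have rd u : has_deriv r u xi.2.
  apply: has_deriv_shift; rewrite -[X in has_deriv _ _ X]add0r.
  apply: (eq_has_deriv (f := fun h => r u + r h)).
    by have [_ cm _] := cP; move=> h; rewrite /r cm group_mulE.
  by apply: has_derivD => //; exact: has_deriv_cst.
have : r t - t * xi.2 = r 0 - 0 * xi.2.
  apply: (has_deriv0_cst (f := fun t => r t - t * xi.2)) => u.
  rewrite -(subrr (xi.2 : R^o)); apply: has_derivB => //.
  exact: (@has_deriv_linear _ R^o xi.2).
rewrite mul0r subr0 {2}/r one_parameter_group0 => /eqP; rewrite subr_eq0.
by move=> /eqP.
Qed.

Lemma one_parameter_group_vector t :
  has_deriv (fun t => (c t).1.2) t (gam (t * xi.2) xi.1.2).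
Proof.
apply: has_deriv_shift; rewrite -[X in has_deriv _ _ X]add0r.
apply: (eq_has_deriv (f := fun h => y t + gam (t * xi.2) (y h))).
  have [_ cm _] := cP; move=> h.
  by rewrite cm group_mulE /= one_parameter_group_time.
apply: has_derivD; first exact: has_deriv_cst.
exact: (has_deriv_comp_linear (@gammaL _ _ G _) (@gamma_continuous _ _ G _) y_deriv0).
Qed.

Lemma one_parameter_group_scalar t : has_deriv (fun t => (c t).1.1) t
  (xi.1.1 + 2^-1 * om (c t).1.2 (gam (t * xi.2) xi.1.2)).
Proof.
apply: has_deriv_shift; rewrite -[X in has_deriv _ _ X]add0r addrA.
apply: (eq_has_deriv (f := fun h => a t + a h +
    2^-1 *: (om (y t) (gam (t * xi.2) (y h)) : R^o))).
  have [_ cm _] := cP; move=> h.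
  by rewrite cm group_mulE /= one_parameter_group_time.
apply: has_derivD; first by apply: has_derivD => //; exact: has_deriv_cst.
apply: has_derivZ.
apply: (has_deriv_comp_linear (@omega_linear_r _ _ G _) (@omega_continuous_r _)).
exact: (has_deriv_comp_linear (@gammaL _ _ G _) (@gamma_continuous _ _ G _) y_deriv0).
Qed.

End one_parameter_group.

(** The coordinates are determined in turn: time is linear, the derivative of the vector depends on
    time alone, and that of the central coordinate on time and vector. *)
Lemma one_parameter_group_unique xi c d : one_parameter_group om gam xi c ->
  one_parameter_group om gam xi d -> c = d.
Proof.
move=> cP dP.
have ye t : (c t).1.2 = (d t).1.2.
  apply: (emb_inj iotaP); apply/eqP; rewrite -subr_eq0 -embB; apply/eqP.
  have : emb ((c t).1.2 - (d t).1.2) = emb ((c 0).1.2 - (d 0).1.2).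
    apply: (has_deriv0_hilbert (f := fun t => emb ((c t).1.2 - (d t).1.2))) => u.
    rewrite -(emb0 iota).
    apply: (has_deriv_comp_linear (emb_linear iota) (emb_continuous iotaP)).
    rewrite -(subrr (gam (u * xi.2) xi.1.2)).
    by apply: has_derivB; exact: one_parameter_group_vector.
  by rewrite (one_parameter_group0 cP) (one_parameter_group0 dP) subrr emb0.
apply/funext => t; have re := one_parameter_group_time cP t.
rewrite -(one_parameter_group_time dP) in re.
have ae : (c t).1.1 = (d t).1.1.
  apply/eqP; rewrite -subr_eq0; apply/eqP.
  have : (c t).1.1 - (d t).1.1 = (c 0).1.1 - (d 0).1.1.
    apply: (has_deriv0_cst (f := fun t => (c t).1.1 - (d t).1.1)) => u.
    have h1 := @one_parameter_group_scalar _ _ cP u.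
    have h2 := @one_parameter_group_scalar _ _ dP u.
    rewrite ye in h1; have := has_derivB h1 h2; rewrite subrr; exact.
  by rewrite (one_parameter_group0 cP) (one_parameter_group0 dP) subrr.
by move: (ye t) re ae; case: (c t) (d t) => [[? ?] ?] [[? ?] ?] /= -> -> ->.
Qed.

(** [group_exp] chooses a curve anew for each argument and evaluates it at time [1]; uniqueness
    identifies the choice for [t *: xi] with the rescaled curve [c (t * u)]. *)
Lemma group_exp_one_parameter xi : exists2 c, one_parameter_group om gam xi c &
  forall t, group_exp om gam (t *: xi) = c t.
Proof.
have [c cP] := one_parameter_group_exists iotaP xi; exists c => // t.
have [cs cm _] := cP.
have ctP : one_parameter_group om gam (t *: xi) (fun u => c (t * u)).
  apply: one_parameter_groupP.
  - by apply: smooth_scale_time => //; exact: (hausdorff_osc G).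
  - by move=> u v; rewrite mulrDr cm.
  - have := @has_deriv_affine _ _ 0 t c 0 xi.
    rewrite mulr0 addr0 => /(_ (one_parameter_group_deriv0 cP)) h.
    by apply: eq_has_deriv h => u; rewrite add0r.
have dP := xgetPex (fun=> 0) (ex_intro _ _ ctP).
by rewrite /group_exp (one_parameter_group_unique dP ctP) mulr1.
Qed.

(** The orbit map of [pi g v] is that of [v] after this right translation, whence the invariance of
    the smooth vectors. *)
Lemma mul_right_smooth g : smooth (fun h => mul h g).
Proof.
have hV := osc_hausdorff G; have hR := @Rhausdorff R.
have hRV : hausdorff_space (R^o * V)%type by exact: hausdorff_prod.
have hO := hausdorff_osc G.
move=> n; under eq_fun do rewrite group_mulE.
have idO : Cn n (fun h : osc V => h) by exact: Cn_id.
have h1 : Cn n (fun h : osc V => h.1).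
  exact: (Cn_linear_comp hRV (@is_linear_fst _ _ _) (@continuous_fst _ _) idO).
have h2 : Cn n (fun h : osc V => h.2).
  exact: (Cn_linear_comp hR (@is_linear_snd _ _ _) (@continuous_snd _ _) idO).
have h11 : Cn n (fun h : osc V => h.1.1).
  exact: (Cn_linear_comp hR (@is_linear_fst _ _ _) (@continuous_fst _ _) h1).
have h12 : Cn n (fun h : osc V => h.1.2).
  exact: (Cn_linear_comp hV (@is_linear_snd _ _ _) (@continuous_snd _ _) h1).
have hg : Cn n (fun h : osc V => gam h.2 g.1.2).
  exact: (Cn_linear hV (@is_linear_snd _ _ _) (@continuous_snd _ _)
    (gamma_time_smooth G g.1.2 n)).
apply: Cn_pair => //; last by apply: CnD => //; exact: Cn_cst.
apply: Cn_pair => //; last exact: CnD.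
apply: CnD => //; first by apply: CnD => //; exact: Cn_cst.
apply: (Cn_linear_comp (L := fun z : R^o => 2^-1 *: z)) => //.
- by move=> u z z'; rewrite scalerDr !scalerA mulrC.
- by move=> z; apply: tvs_cvgZ; [exact: cvg_cst|exact: cvg_id].
- apply: (Cn_bilinear (B := fun x y => om x y : R^o)) => //.
  + by move=> y u x x'; exact: omega_linear.
  + exact: omega_linear_r.
  + exact: omega_continuous.
Qed.

(* [Ad(y^-1) xi] for [y] in [V] with [D y = d] *)
Definition shear (d : V) (xi : osc V) : osc V :=
  (xi.1.1 + rip (emb d : HA) (emb xi.1.2) + xi.2 / 2 * hnorm (emb d : HA) ^+ 2,
   xi.1.2 + xi.2 *: d, xi.2).

(** With [d = gen y], the terms [- omega y x / 2] and [omega x y / 2] add up to [<d, x>], and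
    [- s omega y d / 2] is [s |d|^2 / 2], by [omega_gen]. *)
Lemma conjugation_deriv y xi :
  has_deriv (fun t => mul (mul (0, - y, 0) (t *: xi)) (0, y, 0)) 0
    (shear (gen y) xi).
Proof.
case: xi => [[tau x] s].
apply: (eq_has_deriv (f := fun t => (t *: (tau : R^o) + 2^-1 *: (- t *: (om y x : R^o)) +
  2^-1 *: (om (t *: x - y) (gam (0 + s * t) y) : R^o),
  t *: x - y + gam (0 + s * t) y, t *: (s : R^o)))).
  move=> t; rewrite !group_mulE /= gamma0 !add0r addr0 mulrC; congr (_, _, _).
  - rewrite [- y + _]addrC; congr (_ + _ * _ + _).
    by rewrite -[- y]scaleN1r omegaZl omegaZr /GRing.scale /=; ring.
  - by rewrite (addrC (- y)).
  - by rewrite addr0.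
have gd : has_deriv (fun t => gam (0 + s * t) y) 0 (s *: gen y).
  apply: (@has_deriv_affine _ V 0 s (fun t => gam t y)).
  by rewrite mulr0 addr0; exact: gamma_deriv0.
have xd : has_deriv (fun t => t *: x - y) 0 x.
  rewrite -[X in has_deriv _ _ X]subr0.
  by apply: has_derivB; [exact: has_deriv_linear|exact: has_deriv_cst].
rewrite /shear /=; apply: has_deriv_pair; last exact: has_deriv_linear.
apply: has_deriv_pair; last exact: has_derivD.
have h := has_deriv_bilinear (B := fun x y => om x y : R^o)
  (fun u z z' w => omega_linear G w u z z')
  (fun u z w w' => @omega_linear_r _ _ G z u w w') (@omega_continuous _ _ G) xd gd.
have -> : tau + rip (emb (gen y) : HA) (emb x) + s / 2 * hnorm (emb (gen y) : HA) ^+ 2 =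
  (tau : R^o) + 2^-1 *: (-1 *: (om y x : R^o)) +
  2^-1 *: (om x (gam (0 + s * 0) y) + om (0 *: x - y) (s *: gen y) : R^o).
  rewrite mulr0 addr0 gamma0 scale0r sub0r (omega_skew G x y) -[- y]scaleN1r omegaZl omegaZr.
  by rewrite !(omega_gen iotaP) rip_norm /GRing.scale /=; field.
apply: (@has_derivD _ R^o); last by apply: (@has_derivZ _ R^o).
apply: (@has_derivD _ R^o); first exact: has_deriv_linear.
apply: has_derivZ.
apply: (eq_has_deriv (f := fun t => -1 *: (t *: (om y x : R^o)))).
  by move=> t; rewrite scaleN1r scaleNr.
by apply: has_derivZ; exact: has_deriv_linear.
Qed.

End exponential.

(** * Smooth representations and their support function *)

Section representation.
Context (R : realType) (V : tvsType R) (G : oscillator V).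
Context (HA : hilbertType R) (A : standard HA) (iota : {linear V -> Cinfty A}).
Hypothesis iotaP : standard_embedding G iota.
Context (H : hilbertType R) (pi : unitary_rep G H).
Hypothesis pi_smooth : smooth_rep pi.
Hypothesis H_nontrivial : exists v : H, v != 0.
Local Notation osc V := (R^o * V * R^o)%type.
Local Notation om := (omega G).
Local Notation gam := (gamma G).
Local Notation mul := (group_mul (omega G) (gamma G)).
Local Notation gen := (generator (gamma G)).
Local Notation emb := (emb iota).
Local Notation D := (smooth_vectors pi).

Lemma rep_linear g (a : R[i]) v w : pi g (a *: v + w) = a *: pi g v + pi g w.
Proof. by have [+ _ _] := rep_unitary pi g; apply. Qed.

Lemma rep_rip g v w : rip (pi g v) (pi g w) = rip v w.
Proof. by have [_ _ e] := rep_unitary pi g; rewrite /rip e. Qed.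

Lemma rep_hnorm g v : hnorm (pi g v) = hnorm v.
Proof. by apply/eqP; rewrite -(@eqrXn2 _ 2)// ?hnorm_ge0// -!rip_norm rep_rip. Qed.

Lemma repB g v w : pi g (v - w) = pi g v - pi g w.
Proof. by have := rep_linear g (-1) w v; rewrite !scaleN1r ![- _ + _]addrC. Qed.

Lemma rep0 g : pi g 0 = 0.
Proof. by have := repB g 0 0; rewrite !subrr. Qed.

Lemma rep_unit v : pi 0 v = v.
Proof.
have [_ /bij_inj inj _] := rep_unitary pi 0; apply: inj.
rewrite -rep_mul; congr (pi _ v).
by rewrite group_mulE /= gamma0 omegaxx mulr0 !addr0.
Qed.

Lemma rep_continuous g : continuous (pi g : realify H -> realify H).
Proof.
move=> v; apply/(@cvg_hnorm R H) => e e0.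
apply: filterS (nbhs_hnorm (v : H) e0) => w /=.
by rewrite -repB rep_hnorm.
Qed.

Lemma smooth_vectors0 : D 0.
Proof.
move=> n; under eq_fun do rewrite rep0.
by apply: Cn_cst; exact: hausdorff_realify.
Qed.

Lemma smooth_vectors_linear (a : R[i]) v w : D v -> D w -> D (a *: v + w).
Proof.
move=> Dv Dw n; under eq_fun do rewrite rep_linear.
have hH := @hausdorff_realify R H.
apply: (@CnD R n _ (realify H) (fun g => (a *: pi g v : H) : realify H)) => //.
apply: (@Cn_linear_comp R n _ _ _ _ (fun z : realify H => (a *: (z : H) : H) : realify H)) => //.
- move=> r x y; rewrite [LHS]scalerDr; congr (_ + _).
  by rewrite [LHS]scalerA mulrC -scalerA.
- by move=> x; apply: (@cvgZr R[i] H); exact: cvg_id.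
Qed.

Lemma smooth_vectors_rep g v : D v -> D (pi g v).
Proof.
move=> Dv n; under eq_fun do rewrite -rep_mul.
apply: (Cn_comp (hausdorff_osc G) (Dv n)).
exact: mul_right_smooth.
Qed.

Lemma smooth_vectors_dense z : approximable D z.
Proof.
move=> e e0; pose O : set H := [set x | hnorm (z - x) < e]°.
have O0 : O !=set0 by exists z; exact: nbhs_hnorm.
have [x [Ox Dx]] := pi_smooth O0 (@open_interior _ _).
by exists x => //; exact: nbhs_singleton Ox.
Qed.

Local Notation orbit v := ((fun g => pi g v) : osc V -> realify H).
Local Notation dorbit v :=
  ((fun p => dderiv (orbit v) p.1 p.2) : osc V * osc V -> realify H).

Lemma orbit_deriv v : D v ->
  (forall xi eta, has_deriv (fun t => orbit v (xi + t *: eta)) 0 (dorbit v (xi, eta))) /\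
  continuous (dorbit v).
Proof. by move=> Dv; have [_ fd dfc] := CnS_inv (Dv 1%N). Qed.

(** Differential of the orbit map at the identity. In contrast to the derivative along [group_exp],
    its linearity and continuity in [xi] come from the calculus. *)
Definition tangent v (xi : osc V) : realify H :=
  dderiv ((fun g => pi g v) : osc V -> realify H) 0 xi.

(** Only the velocity of a curve through the identity matters, so straight lines and conjugated
    curves may replace the exponential. *)
Lemma tangent_curve v (c : R -> osc V) xi : D v -> c 0 = 0 -> has_deriv c 0 xi ->
  has_deriv (fun t => pi (c t) v : realify H) 0 (tangent v xi).
Proof.
move=> Dv c0 cd; have [fd dfc] := orbit_deriv Dv.
have := @chain_rule R H _ (orbit v) (dorbit v) fd dfc c 0 xi cd.
by rewrite c0.
Qed.

Lemma tangent_additive v xi eta : D v -> tangent v (xi + eta) = tangent v xi + tangent v eta.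
Proof.
move=> Dv; have [fd dfc] := orbit_deriv Dv.
exact: (@diffD R H _ (orbit v) (dorbit v) fd dfc).
Qed.

Lemma tangentZ v (a : R) xi : D v -> tangent v (a *: xi) = a *: tangent v xi.
Proof.
move=> Dv; have [fd _] := orbit_deriv Dv.
exact: (@diff_homogeneous R H _ (orbit v) (dorbit v) fd).
Qed.

Lemma tangent_continuous v : D v -> continuous (tangent v).
Proof.
move=> Dv xi; have [_ dfc] := orbit_deriv Dv.
apply: (@continuous_comp _ _ _ (fun xi : osc V => (0 : osc V, xi)) (dorbit v)).
  have cc : continuous (fun xi : osc V => (0 : osc V, xi)).
    by apply: continuous_pair => z; [exact: cvg_cst|exact: cvg_id].
  exact: cc.
exact: dfc.
Qed.

Lemma tangent_linear (a : R[i]) v w xi : D v -> D w ->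
  tangent (a *: v + w) xi = (a *: (tangent v xi : H) : H) + tangent w xi.
Proof.
move=> Dv Dw; have ld := @has_deriv_linear R _ xi 0.
have l0 : (0 : R) *: xi = 0 by rewrite scale0r.
have h1 := tangent_curve (smooth_vectors_linear a Dv Dw) l0 ld.
apply: (has_deriv_unique (@hausdorff_realify R H) h1).
apply: (eq_has_deriv (f := fun t => ((a *: pi (t *: xi) v : H) : realify H) + pi (t *: xi) w)).
  by move=> t; rewrite rep_linear.
apply: has_derivD; last exact: tangent_curve.
apply: (has_deriv_comp_linear (L := fun z : realify H => (a *: (z : H) : H) : realify H)).
- move=> r x y; rewrite [LHS]scalerDr; congr (_ + _).
  by rewrite [LHS]scalerA mulrC -scalerA.
- by move=> x; apply: (@cvgZr R[i] H); exact: cvg_id.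
- exact: tangent_curve.
Qed.

Lemma derived_repE xi v : D v -> derived_rep pi xi v = tangent v xi.
Proof.
move=> Dv; have [c cP cE] := group_exp_one_parameter iotaP xi.
apply: (dderivE (E := R^o) (F := realify H)); first exact: hausdorff_realify.
apply: (eq_has_deriv (f := fun t => pi (c t) v : realify H)).
  by move=> t; rewrite -cE add0r; congr (pi (group_exp _ _ (_ *: _)) _);
    rewrite /GRing.scale /= mulr1.
apply: tangent_curve => //; first exact: one_parameter_group0 cP.
exact: (one_parameter_group_deriv0 cP).
Qed.

Definition expectation v xi : R := rip ('i%C *: (tangent v xi : H)) v.

Lemma expectationD v xi eta : D v ->
  expectation v (xi + eta) = expectation v xi + expectation v eta.
Proof. by move=> Dv; rewrite /expectation tangent_additive// scalerDr ripDl. Qed.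

Lemma expectationZ v (a : R) xi : D v ->
  expectation v (a *: xi) = a * expectation v xi.
Proof.
move=> Dv; rewrite /expectation tangentZ//.
rewrite [X in rip (_ *: X)](_ : _ = a%:C *: (tangent v xi : H))//.
by rewrite scalerA mulrC -scalerA ripZl.
Qed.

Lemma expectation_continuous v : D v -> continuous (expectation v : osc V -> R^o).
Proof.
move=> Dv xi; apply: cvg_rip; last exact: cvg_cst.
by apply: (@cvgZr R[i] H); exact: (@tangent_continuous v Dv xi).
Qed.

Lemma support_functionE xi : support_function pi xi =
  ereal_sup [set (expectation v xi)%:E | v in [set v | D v /\ hnorm v = 1]].
Proof.
have [c cP cE] := group_exp_one_parameter iotaP xi.
have [_ cm _] := cP; have c0 := one_parameter_group0 cP.
transitivity (ereal_sup [set (rip ('i%C *: derived_rep pi xi v) v)%:E |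
    v in [set v | D v /\ hnorm v = 1]]); last first.
  congr ereal_sup; apply: eq_imagel => v [Dv _].
  by rewrite derived_repE.
apply: (@spectrum_sup R H D (derived_rep pi xi) (fun t => pi (c t))).
- exact: smooth_vectors0.
- move=> a v w Dv Dw; split; first exact: smooth_vectors_linear.
  by rewrite !derived_repE ?tangent_linear//; exact: smooth_vectors_linear.
- exact: smooth_vectors_dense.
- by move=> t v; exact: smooth_vectors_rep.
- by move=> v; rewrite c0 rep_unit.
- by move=> t v w; exact: rep_rip.
- move=> v t Dv; rewrite derived_repE; last exact: smooth_vectors_rep.
  apply: has_deriv_shift.
  apply: (eq_has_deriv (f := fun h => pi (c h) (pi (c t) v) : realify H)).
    by move=> h; rewrite -rep_mul -cm addrC.
  apply: tangent_curve => //; first exact: smooth_vectors_rep.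
  exact: (one_parameter_group_deriv0 cP).
- exact: H_nontrivial.
Qed.

(** With [g = (0, y, 0)], [pi (t xi) pi g v = pi g pi (g^-1 (t xi) g) v]; the conjugated line has
    velocity [shear iota (gen y) xi], and unitarity removes the outer [pi g]. *)
Lemma expectation_conj y v xi : D v ->
  expectation (pi (0, y, 0) v) xi = expectation v (shear iota (gen y) xi).
Proof.
move=> Dv; set g := (0, y, 0).
have gg : mul g (0, - y, 0) = 0.
  by rewrite group_mulE /= gamma0 subrr -scaleN1r omegaZr omegaxx !mulr0 !addr0.
rewrite /expectation.
suff -> : (tangent (pi g v) xi : H) = pi g (tangent v (shear iota (gen y) xi)).
  rewrite -[RHS](rep_rip g).
  by have := rep_linear g 'i%C (tangent v (shear iota (gen y) xi)) 0; rewrite rep0 !addr0 => ->.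
have h1 := tangent_curve (smooth_vectors_rep g Dv) (scale0r xi) (@has_deriv_linear R _ xi 0).
apply: (has_deriv_unique (@hausdorff_realify R H) h1).
apply: (eq_has_deriv (f := fun t =>
    pi g (pi (mul (mul (0, - y, 0) (t *: xi)) g) v) : realify H)).
  by move=> t; rewrite !rep_mul -(rep_mul pi g) gg rep_unit.
apply: (has_deriv_comp_linear (V := realify H) (W := realify H) (L := pi g)).
- by move=> a x x'; exact: rep_linear.
- exact: rep_continuous.
- apply: tangent_curve => //; last exact: conjugation_deriv.
  have o0 : om (- y) 0 = 0 by have := omegaZr G 0 (- y) 0; rewrite scale0r mul0r.
  have oy : om (- y) y = 0 by rewrite -scaleN1r omegaZl omegaxx mulr0.
  rewrite scale0r (_ : (0 : osc V) = (0, 0, 0))// !group_mulE /= !gamma0.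
  by rewrite !addr0 gamma0 o0 oy !mulr0 !addr0 addNr.
Qed.

Lemma shear_continuous xi : continuous ((fun d => shear iota d xi) : V -> osc V).
Proof.
have c1 : continuous ((fun d => xi.1.1 + rip (emb d : HA) (emb xi.1.2) +
    xi.2 / 2 * hnorm (emb d : HA) ^+ 2) : V -> R^o).
  move=> d; apply: (@tvs_cvgD _ R^o); last first.
    apply: (@tvs_cvgZ _ R^o); first exact: cvg_cst.
    under eq_fun do rewrite -rip_norm.
    by rewrite -rip_norm; apply: cvg_rip; exact: (emb_continuous iotaP).
  apply: (@tvs_cvgD _ R^o); first exact: cvg_cst.
  by apply: cvg_rip; [exact: (emb_continuous iotaP)|exact: cvg_cst].
have c2 : continuous ((fun d => xi.1.2 + xi.2 *: d) : V -> V).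
  move=> d; apply: tvs_cvgD; first exact: cvg_cst.
  by apply: tvs_cvgZ; [exact: cvg_cst|exact: cvg_id].
apply: (@continuous_pair V (R^o * V)%type R^o); last by move=> d; exact: cvg_cst.
exact: (@continuous_pair V R^o V).
Qed.

Hypothesis D_dense : dense (range gen).

Lemma support_function_shear d xi :
  (support_function pi (shear iota d xi) <= support_function pi xi)%E.
Proof.
rewrite !support_functionE; apply: ub_ereal_sup => _ [v [Dv v1] <-].
rewrite leNgt; apply/negP => h.
pose f d' : R^o := expectation v (shear iota d' xi).
have fc : continuous f.
  move=> d'; apply: (@continuous_comp _ _ _ (fun d => shear iota d xi) (expectation v : _ -> R^o)).
    exact: shear_continuous.
  exact: expectation_continuous.
set s := ereal_sup _ in h.
have sP y : ((f (gen y))%:E <= s)%E.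
  rewrite /f -expectation_conj//; apply: ereal_sup_ubound.
  exists (pi (0, y, 0) v) => //; split; first exact: smooth_vectors_rep.
  by rewrite rep_hnorm.
case: s h sP => [s| |] h sP //; last by have := sP 0.
have O0 : f @^-1` [set r | s < r] !=set0 by exists d.
(* Exceeding [s] is an open condition on the shear vector; if it held at [d], it would hold at some
   [gen y], where the expectation is that of the unit vector [pi (0, y, 0) v]. *)
have Oo : open (f @^-1` [set r | s < r]).
  by apply: open_comp; [by move=> ? _; exact: fc|exact: open_gt].
have [z [fs [y _ e]]] := D_dense O0 Oo.
by move: fs (sP y); rewrite -e /= lee_fin leNgt => ->.
Qed.

Lemma support_function_center t x s : s != 0 -> support_function pi (t, x, s) =
  support_function pi (t - hnorm (emb x : HA) ^+ 2 / (2 * s), 0, s).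
Proof.
move=> s0; set t' := t - _.
have e1 : shear iota (s^-1 *: x) (t', 0, s) = (t, x, s).
  rewrite /shear /= emb0 rip0r embZ hnormZ addr0 exprMn real_normK ?num_real//.
  rewrite scalerA mulfV// scale1r add0r.
  by congr (_, _, _); rewrite /t'; field.
(* The linear term contributes [- |x|^2 / s] and the quadratic one [|x|^2 / (2 s)]. *)
have e2 : shear iota (- s^-1 *: x) (t, x, s) = (t', 0, s).
  rewrite /shear /= embZ hnormZ [rip _ _]ripZl rip_norm exprMn real_normK ?num_real//.
  rewrite scalerA mulrN mulfV// scaleN1r subrr.
  by congr (_, _, _); rewrite /t'; field.
apply/eqP; rewrite eq_le; apply/andP; split.
  by rewrite -e1; exact: support_function_shear.
by rewrite -e2; exact: support_function_shear.
Qed.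

End representation.

(** * Sublinear functions and continuity in the norm *)

Section sublinear.
Context (R : realType) (E : lmodType R) (S : E -> \bar R).

(** Stated through real upper bounds, so that no sum of opposite infinities and no product of [0]
    with [+oo] occurs. *)
Definition sublinear := [/\
  forall x y (a b : R), (S x <= a%:E)%E -> (S y <= b%:E)%E -> (S (x + y) <= (a + b)%:E)%E,
  forall x (c a : R), 0 <= c -> (S x <= a%:E)%E -> (S (c *: x) <= (c * a)%:E)%E &
  forall x, (S x != -oo)%E].

Hypothesis S_sublinear : sublinear.
Let SD := let: And3 h _ _ := S_sublinear in h.
Let SZ := let: And3 _ h _ := S_sublinear in h.
Let SN := let: And3 _ _ h := S_sublinear in h.

Lemma sublinear_fin x : (S x < +oo)%E -> exists r : R, S x = r%:E.
Proof. by move=> xy; have := SN x; case: (S x) xy => // r _ _; exists r. Qed.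

Lemma sublinear_finP x : (S x < +oo)%E <-> exists a : R, (S x <= a%:E)%E.
Proof.
split=> [/sublinear_fin[r ->]|[a]]; first by exists r.
by move=> /le_lt_trans; apply; rewrite ltry.
Qed.

Lemma sublinear_finD x y : (S x < +oo)%E -> (S y < +oo)%E -> (S (x + y) < +oo)%E.
Proof.
move=> /sublinear_finP[a xa] /sublinear_finP[b yb].
by apply/sublinear_finP; exists (a + b); exact: SD.
Qed.

Lemma sublinear_finZ x (c : R) : 0 <= c -> (S x < +oo)%E -> (S (c *: x) < +oo)%E.
Proof.
move=> c0 /sublinear_finP[a xa].
by apply/sublinear_finP; exists (c * a); exact: SZ.
Qed.

Lemma sublinear_segment x u (d M a : R) : 0 < d -> `|a| <= d ->
  (S (x + d *: u) <= M%:E)%E -> (S (x - d *: u) <= M%:E)%E ->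
  (S (x + a *: u) <= M%:E)%E.
Proof.
move=> d0; rewrite ler_norml => /andP[ad1 ad2] h1 h2.
(* [c1] and [c2] are the barycentric coordinates of [a] with respect to [d] and [- d]. *)
have [c1 c10 e1] : exists2 c, 0 <= c & c = (d + a) / (2 * d).
  by exists ((d + a) / (2 * d)) => //; rewrite divr_ge0; lra.
have [c2 c20 e2] : exists2 c, 0 <= c & c = (d - a) / (2 * d).
  by exists ((d - a) / (2 * d)) => //; rewrite divr_ge0; lra.
have c12 : c1 + c2 = 1 by rewrite e1 e2; field; rewrite gt_eqF.
have cd : c1 * d - c2 * d = a by rewrite e1 e2; field; rewrite gt_eqF.
have := SD (SZ c10 h1) (SZ c20 h2); rewrite !scalerDr !scalerN !scalerA addrACA.
by rewrite -scalerDl -scalerBl -mulrDl c12 cd scale1r mul1r.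
Qed.

(** Convexity bounds [S] on a box by its values at the four corners; contracting towards [x] and
    reflecting through [x] make the estimate two-sided. *)
Lemma sublinear_continuous x u w (d : R) : 0 < d ->
  (forall a e, `|a| <= d -> `|e| <= d -> (S (x + a *: u + e *: w) < +oo)%E) ->
  forall eps : R, 0 < eps -> exists2 r : R, 0 < r &
  forall a e, `|a| <= r -> `|e| <= r ->
    exists2 s : R, S (x + a *: u + e *: w) = s%:E & `|fine (S x) - s| < eps.
Proof.
move=> d0 Sfin eps eps0.
have dd : `|d| <= d by rewrite gtr0_norm.
have dN : `|- d| <= d by rewrite normrN gtr0_norm.
have dz : `|0 : R| <= d by rewrite normr0 ltW.
have [m1 e1] := sublinear_fin (Sfin d d dd dd).
have [m2 e2] := sublinear_fin (Sfin d (- d) dd dN).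
have [m3 e3] := sublinear_fin (Sfin (- d) d dN dd).
have [m4 e4] := sublinear_fin (Sfin (- d) (- d) dN dN).
have [s0 es0] : exists r : R, S x = r%:E.
  by have := sublinear_fin (Sfin 0 0 dz dz); rewrite !scale0r !addr0.
pose M := Num.max s0 (Num.max (Num.max m1 m2) (Num.max m3 m4)).
have Mub (a e : R) : `|a| <= d -> `|e| <= d -> (S (x + a *: u + e *: w) <= M%:E)%E.
  move=> ad ed; rewrite addrAC; apply: (sublinear_segment d0 ad).
    rewrite addrAC; apply: (sublinear_segment d0 ed).
      by rewrite e1 lee_fin !le_max lexx !orbT.
    by rewrite -scaleNr e2 lee_fin !le_max lexx !orbT.
  rewrite addrAC -scaleNr; apply: (sublinear_segment d0 ed).
    by rewrite e3 lee_fin !le_max lexx !orbT.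
  by rewrite -scaleNr e4 lee_fin !le_max lexx !orbT.
have sM : s0 <= M by rewrite le_max lexx.
have K0 : 0 < M - s0 + 1 by lra.
(* The [1] keeps the denominator positive when [M = s0]. *)
pose th := Num.min 1 (eps / (M - s0 + 1) / 2).
have th0 : 0 < th by rewrite lt_min ltr01 !divr_gt0.
have th1 : th <= 1 by rewrite ge_min lexx.
have thK : th * (M - s0 + 1) < eps.
  have : th <= eps / (M - s0 + 1) / 2 by rewrite ge_min lexx orbT.
  rewrite -(ler_pM2r K0) => /le_lt_trans; apply.
  have -> : eps / (M - s0 + 1) / 2 * (M - s0 + 1) = eps / 2.
    by field; rewrite gt_eqF.
  by lra.
exists (th * d); first by rewrite mulr_gt0.
move=> a e ad ed.
have scale (b : R) : `|b| <= th * d -> `|b / th| <= d.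
  by move=> bd; rewrite normrM normfV (gtr0_norm th0) ler_pdivrMr// mulrC.
have scaleN (b : R) : `|b| <= th * d -> `|- (b / th)| <= d.
  by move=> /scale; rewrite normrN.
have bd (b : R) : `|b| <= th * d -> `|b| <= d.
  by move=> /le_trans; apply; rewrite ler_piMl// ltW.
have [s es] := sublinear_fin (Sfin a e (bd _ ad) (bd _ ed)); exists s => //.
have xs0 : (S x <= s0%:E)%E by rewrite es0.
have xs : (S (x + a *: u + e *: w) <= s%:E)%E by rewrite es.
have thn : th != 0 by rewrite gt_eqF.
(* The point lies between [x] and the point whose offsets are divided by [th]. *)
have up : s <= (1 - th) * s0 + th * M.
  have th1' : 0 <= 1 - th by lra.
  have := SD (SZ th1' xs0) (SZ (ltW th0) (Mub _ _ (scale _ ad) (scale _ ed))).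
  rewrite !scalerDr !scalerA !(mulrC th (_ / th)) !divfK// !addrA -scalerDl subrK scale1r.
  by rewrite es lee_fin.
(* Conversely [x] lies between the point and the one with offsets [- (a / th)] and [- (e / th)]. *)
have lo : (1 + th) * s0 <= s + th * M.
  have := SD xs (SZ (ltW th0) (Mub _ _ (scaleN _ ad) (scaleN _ ed))).
  have -> : x + a *: u + e *: w + th *: (x + - (a / th) *: u + - (e / th) *: w) =
      (1 + th) *: x.
    rewrite !scalerDr !scalerA !mulrN !(mulrC th (_ / th)) !divfK// !scaleNr.
    by rewrite addrACA subrr addr0 addrACA subrr addr0 scalerDl scale1r.
  have th1' : 0 < 1 + th by lra.
  move=> /(SZ (ltW (etrans (invr_gt0 _) th1'))).
  rewrite scalerA mulVf ?gt_eqF// scale1r es0 lee_fin.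
  by rewrite -(ler_pM2l th1') mulrA mulfV ?gt_eqF// mul1r.
rewrite es0 /= ltr_norml; clear -thK up lo th0.
by apply/andP; split; lra.
Qed.

End sublinear.

(** * Sublinearity of the support function *)

Section norm_continuity.
Context (R : realType) (V : tvsType R) (G : oscillator V).
Context (HA : hilbertType R) (A : standard HA) (iota : {linear V -> Cinfty A}).
Hypothesis iotaP : standard_embedding G iota.
Context (H : hilbertType R) (pi : unitary_rep G H).
Hypothesis pi_smooth : smooth_rep pi.
Hypothesis H_nontrivial : exists v : H, v != 0.
Hypothesis D_dense : dense (range (generator (gamma G))).
Local Notation osc V := (R^o * V * R^o)%type.
Local Notation emb := (emb iota).
Local Notation S := (support_function pi).
Local Notation B := (support_domain pi).
Local Notation D := (smooth_vectors pi).

Lemma unit_smooth_vector : exists2 v, D v & hnorm v = 1.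
Proof.
have [v0 v0n0] := H_nontrivial.
have [v Dv vv0] := smooth_vectors_dense pi_smooth v0 (hnorm_gt0 v0n0).
have vn0 : v != 0 by apply: contraTneq vv0 => ->; rewrite subr0 ltxx.
exists (((hnorm v)^-1)%:C *: v).
  rewrite -[_ *: v]addr0; apply: smooth_vectors_linear => //.
  exact: smooth_vectors0.
by rewrite hnormZ gtr0_norm ?invr_gt0 ?hnorm_gt0// mulVf// gt_eqF// hnorm_gt0.
Qed.

Lemma support_function_leP xi (a : R) : (S xi <= a%:E)%E <->
  forall v, D v -> hnorm v = 1 -> expectation pi v xi <= a.
Proof.
rewrite (support_functionE iotaP pi_smooth H_nontrivial); split=> [h v Dv v1|h].
  rewrite -lee_fin; apply: le_trans h.
  by apply: ereal_sup_ubound; exists v.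
by apply: ub_ereal_sup => _ [v [Dv v1] <-]; rewrite lee_fin; exact: h.
Qed.

Lemma support_function_sublinear : sublinear S.
Proof.
split.
- move=> xi eta a b /support_function_leP h1 /support_function_leP h2.
  apply/support_function_leP => v Dv v1.
  by rewrite expectationD//; apply: lerD; [exact: h1|exact: h2].
- move=> xi c a c0 /support_function_leP h; apply/support_function_leP => v Dv v1.
  by rewrite expectationZ//; apply: ler_wpM2l => //; exact: h.
- move=> xi; have [v Dv v1] := unit_smooth_vector; apply/eqP => e.
  have /support_function_leP/(_ v Dv v1) : (S xi <= (expectation pi v xi - 1)%:E)%E.
    by rewrite e leNye.
  by rewrite lerDl oppr_ge0 ler10.
Qed.

End norm_continuity.

(** Interior points for the original topology are exploited only through such boxes, on which
    convexity takes over. *)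
Lemma nbhs_box (R : realType) (W : tvsType R) (x u y w : W) (Q : set W) : nbhs x Q ->
  exists2 d : R, 0 < d & forall a b e : R, `|a| <= d -> `|b| <= d -> `|e| <= d ->
    Q (x + a *: u + b *: y + e *: w).
Proof.
pose f (p : R^o * R^o * R^o) : W := x + p.1.1 *: u + p.1.2 *: y + p.2 *: w.
have fc : f @ (0, 0, 0) --> x.
  have e : x + (0 : R) *: u + (0 : R) *: y + (0 : R) *: w = x.
    by rewrite !scale0r !addr0.
  rewrite -[X in _ --> X]e.
  have c1 : (fun p : R^o * R^o * R^o => p.1) @ (0, 0, 0) --> ((0 : R^o), (0 : R^o)).
    exact: (@continuous_fst _ _ (((0 : R^o), (0 : R^o)), (0 : R^o))).
  apply: tvs_cvgD.
    apply: tvs_cvgD.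
      apply: tvs_cvgD; first exact: cvg_cst.
      apply: tvs_cvgZ; last exact: cvg_cst.
      by apply: (cvg_comp _ _ c1); exact: (@continuous_fst R^o R^o ((0 : R^o), (0 : R^o))).
    apply: tvs_cvgZ; last exact: cvg_cst.
    by apply: (cvg_comp _ _ c1); exact: (@continuous_snd R^o R^o ((0 : R^o), (0 : R^o))).
  apply: tvs_cvgZ; last exact: cvg_cst.
  exact: (@continuous_snd _ _ (((0 : R^o), (0 : R^o)), (0 : R^o))).
move=> /fc/nbhs_ballP[d /= d0 dQ]; exists (d / 2); first by rewrite divr_gt0.
have half (r : R) : `|r| <= d / 2 -> ball (0 : R^o) d r.
  move=> rd; rewrite /ball /= sub0r normrN; lra.
move=> a b e ad bd ed; apply: (dQ (a, b, e)).
by split; [split|]; exact: half.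
Qed.

(** * Norm continuity from sublinearity and the formula *)

Section norm_continuity.
Context (R : realType) (V : tvsType R) (HA : hilbertType R) (A : standard HA).
Context (iota : {linear V -> Cinfty A}).
Local Notation osc V := (R^o * V * R^o)%type.
Local Notation emb := (emb iota).
Local Notation sqn x := (hnorm (emb x : HA) ^+ 2).
Hypothesis iota_injective : injective iota.
Hypothesis V_nontrivial : exists x : V, x != 0.

Variable S : osc V -> \bar R.
Hypothesis Ssub : sublinear S.
Hypothesis Scenter : forall (t : R) (x : V) (s : R), s != 0 ->
  S (t, x, s) = S (t - sqn x / (2 * s), 0, s).
Local Notation B := [set xi | (S xi < +oo)%E].

Lemma norm_nbhs_chart xi (Q : set (R^o * HA * R^o)) :
  nbhs (norm_chart iota xi) Q -> norm_nbhs iota xi (norm_chart iota @^-1` Q).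
Proof. exact: (@initial_continuous _ _ (norm_chart iota) xi). Qed.

Lemma norm_nbhs_filter xi : Filter (norm_nbhs iota xi).
Proof. exact: (@nbhs_filter (initial_topology (norm_chart iota))). Qed.

(* On a neighborhood of a point with [s <> 0], moving the vector part back to
   [x0] only shifts the central coordinate, by a norm-continuous amount. *)
Lemma sublinear_cvg_regular xi : xi.2 != 0 -> B° xi ->
  S @ within B° (norm_nbhs iota xi) --> S xi.
Proof.
case: xi => [[t0 x0] s0] /= s0n Bxi.
have [d d0 dB] := nbhs_box ((1, 0, 0) : osc V) (0 : osc V) ((0, 0, 1) : osc V) Bxi.
have Sfin (a e : R) : `|a| <= d -> `|e| <= d ->
    (S ((t0, x0, s0) + a *: ((1, 0, 0) : osc V) + e *: ((0, 0, 1) : osc V))%R < +oo)%E.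
  move=> ad ed; have := dB a 0 e ad _ ed; rewrite scale0r addr0; apply.
  by rewrite normr0 ltW.
have [r0 Sxi] : exists r : R, S (t0, x0, s0) = r%:E.
  apply: (sublinear_fin Ssub); exact: nbhs_singleton Bxi.
rewrite Sxi => P rP; have /nbhs_ballP[eps /= eps0 epsP] : nbhs r0 (fun r => P r%:E).
  exact/nbhs_EFin.
have [rho rho0 rhoP] := sublinear_continuous Ssub d0 Sfin eps0.
(* Solves [psi - |x0|^2 / (2 s) = t - |x|^2 / (2 s)], so that [S (t, x, s) = S (psi, x0, s)]. It
   lives on the ambient product with [HA], where its continuity is that of the norm. *)
pose psi (z : R^o * HA * R^o) : R :=
  z.1.1 - (rip z.1.2 z.1.2 - sqn x0) * (2 * z.2)^-1.
have c1 : (fun z : R^o * HA * R^o => z.1) @ norm_chart iota (t0, x0, s0) -->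
    ((t0 : R^o), (emb x0 : HA)).
  exact: (@continuous_fst _ _ (norm_chart iota (t0, x0, s0))).
have c11 : (fun z : R^o * HA * R^o => z.1.1 : R) @ norm_chart iota (t0, x0, s0) --> t0.
  by apply: (cvg_comp _ _ c1); exact: (@continuous_fst R^o HA (t0, (emb x0 : HA))).
have c12 : (fun z : R^o * HA * R^o => z.1.2) @ norm_chart iota (t0, x0, s0) --> (emb x0 : HA).
  by apply: (cvg_comp _ _ c1); exact: (@continuous_snd R^o HA (t0, (emb x0 : HA))).
have c2 : (fun z : R^o * HA * R^o => z.2 : R) @ norm_chart iota (t0, x0, s0) --> s0.
  exact: (@continuous_snd _ _ (norm_chart iota (t0, x0, s0))).
have psic : psi @ norm_chart iota (t0, x0, s0) --> t0.
  rewrite -[X in _ --> X]subr0 -[X in _ - X](mul0r (2 * s0)^-1).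
  apply: cvgB => //; apply: cvgM; last first.
    apply: cvgV; first by rewrite mulf_neq0.
    by apply: cvgM => //; exact: cvg_cst.
  by rewrite -(subrr (sqn x0)); apply: cvgB; [rewrite -rip_norm; exact: cvg_rip|exact: cvg_cst].
have near_psi : \forall z \near norm_chart iota (t0, x0, s0), `|t0 - psi z| < rho.
  exact: (@cvgr_dist_lt R R^o _ _ _ psi t0 psic).
have near_s : \forall z \near norm_chart iota (t0, x0, s0), `|s0 - z.2| < rho.
  exact: (@cvgr_dist_lt R R^o _ _ _ (fun z => z.2) s0 c2).
(* Keeps [s] away from [0], so that the formula applies. *)
have near_s0 : \forall z \near norm_chart iota (t0, x0, s0), `|s0 - z.2| < `|s0|.
  by apply: (@cvgr_dist_lt R R^o _ _ _ (fun z => z.2) s0 c2); rewrite normr_gt0.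
have near3 : \forall z \near norm_chart iota (t0, x0, s0),
    [/\ `|t0 - psi z| < rho, `|s0 - z.2| < rho & `|s0 - z.2| < `|s0|].
  by apply: filterS3 near_psi near_s near_s0.
apply: (@filterS _ _ (norm_nbhs_filter _) _ _ _ (norm_nbhs_chart near3)).
move=> [[t x] s] [/= h1 h2 h3] _.
have sn : s != 0 by apply: contraTneq h3 => ->; rewrite subr0 ltxx.
pose t' := psi (norm_chart iota (t, x, s)).
have St : S (t, x, s) = S (t', x0, s).
  rewrite (@Scenter t x s sn) (@Scenter t' x0 s sn).
  by rewrite /t' /psi /= rip_norm; congr (S (_, _, _)); field.
rewrite distrC in h1; rewrite distrC in h2.
have [r Sr rr0] := rhoP (t' - t0) (s - s0) (ltW h1) (ltW h2).
have e : (t0, x0, s0) + (t' - t0) *: ((1, 0, 0) : osc V) + (s - s0) *: ((0, 0, 1) : osc V) =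
    (t', x0, s).
  rewrite [LHS](_ : _ = (t0 + (t' - t0) * 1 + (s - s0) * 0,
    x0 + (t' - t0) *: (0 : V) + (s - s0) *: (0 : V), s0 + (t' - t0) * 0 + (s - s0) * 1))//.
  by rewrite !scaler0 !addr0; congr (_, _, _); ring.
rewrite e -St in Sr; rewrite /= Sr; apply: epsP.
by rewrite Sxi in rr0.
Qed.


Let BD := sublinear_finD Ssub.
Let BZ := sublinear_finZ Ssub.

Let emb_gt0 y : y != 0 -> 0 < sqn y.
Proof.
move=> y0; apply/exprn_gt0/hnorm_gt0; apply: contra_neq y0 => e.
by apply: iota_injective; apply: val_inj; rewrite linear0.
Qed.

Let sqnD (x y : V) (b : R) :
  sqn (x + b *: y) = sqn x + 2 * b * rip (emb x : HA) (emb y) + b ^+ 2 * sqn y.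
Proof.
have h (p q : HA) : hnorm (p + b%:C *: q) ^+ 2 =
    hnorm p ^+ 2 + 2 * b * rip p q + b ^+ 2 * hnorm q ^+ 2.
  by rewrite -!rip_norm !(ripDl, ripDr, ripZl, ripZr) (ripC q); ring.
by rewrite embD embZ; exact: h.
Qed.

(* Near [(t0, x0, 0)] the value at [(t0, x, e)] is that at the point
   [(t0 - |x|^2 / 2 e, 0, e)] of the plane; combining the points for [e] and
   [- e] and two vectors of different norm reaches both central directions. *)
Lemma finite_everywhere t0 x0 : B° (t0, x0, 0) -> forall eta, (S eta < +oo)%E.
Proof.
move=> Bxi; have [y y0] := V_nontrivial; have N0 := emb_gt0 y0.
have [d d0 dB] := nbhs_box ((0, 0, 0) : osc V) ((0, y, 0) : osc V) ((0, 0, 1) : osc V) Bxi.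
have inB (b e : R) : `|b| <= d -> `|e| <= d -> (S (t0, x0 + b *: y, e)%R < +oo)%E.
  move=> bd ed; have := dB 0 b e _ bd ed; rewrite normr0 ltW// => /(_ isT).
  rewrite [X in B X](_ : _ = (t0 + 0 * 0 + b * 0 + e * 0,
    x0 + (0 : R) *: (0 : V) + b *: y + e *: (0 : V), 0 + 0 * 0 + b * 0 + e * 1))//.
  by rewrite !scaler0 !mulr0 !addr0 mulr1 add0r.
pose c b := sqn (x0 + b *: y) / 2.
(* Scaling by [e] removes the denominator; the heights [e ^+ 2] and [- e ^+ 2] will cancel in
   [central]. *)
have plus (b e : R) : `|b| <= d -> 0 < e -> e <= d -> (S (t0 * e - c b, 0, e ^+ 2)%R < +oo)%E.
  move=> bd e0 ed; have := inB b e bd; rewrite gtr0_norm// => /(_ ed).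
  rewrite Scenter ?gt_eqF// => /(BZ (ltW e0)).
  rewrite [X in S X](_ : _ = (e * (t0 - sqn (x0 + b *: y) / (2 * e)), e *: (0 : V), e * e))//.
  rewrite scaler0; congr (S (_, _, _) < _)%E.
  by rewrite /c; field; rewrite gt_eqF.
have minus (b e : R) : `|b| <= d -> 0 < e -> e <= d -> (S (t0 * e + c b, 0, - e ^+ 2)%R < +oo)%E.
  move=> bd e0 ed; have := inB b (- e) bd; rewrite normrN gtr0_norm// => /(_ ed).
  rewrite Scenter ?oppr_eq0 ?gt_eqF// => /(BZ (ltW e0)).
  rewrite [X in S X](_ : _ = (e * (t0 - sqn (x0 + b *: y) / (2 * - e)), e *: (0 : V), e * - e))//.
  rewrite scaler0; congr (S (_, _, _) < _)%E; last by rewrite mulrN expr2.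
  by rewrite /c; field; rewrite gt_eqF.
have central (b2 b3 e : R) : `|b2| <= d -> `|b3| <= d -> 0 < e -> e <= d ->
    (S (2 * t0 * e + (c b3 - c b2), 0, 0)%R < +oo)%E.
  move=> bd b'd e0 ed; have := BD (plus b2 e bd e0 ed) (minus b3 e b'd e0 ed).
  rewrite [X in S X](_ : _ = (t0 * e - c b2 + (t0 * e + c b3), 0 + 0 : V, e ^+ 2 + - e ^+ 2))//.
  by rewrite addr0 subrr; congr (S (_, _, _) < _)%E; ring.
(* The sign of [<x0, y>] decides which of [d] and [- d] increases the norm. *)
have [b1 b1d cb1] : exists2 b1, `|b1| <= d & c 0 < c b1.
  have [r0|r0] := leP 0 (rip (emb x0 : HA) (emb y)).
    exists d; rewrite ?gtr0_norm// /c !sqnD ltr_pM2r ?invr_gt0//.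
    have := mulr_gt0 (exprn_gt0 2 d0) N0; have := mulr_ge0 (ltW d0) r0; lra.
  exists (- d); rewrite ?normrN ?gtr0_norm// /c !sqnD ltr_pM2r ?invr_gt0// sqrrN.
  have := mulr_gt0 (exprn_gt0 2 d0) N0; have := nmulr_rlt0 d r0; rewrite d0 => /idP; lra.
have dz : `|0 : R| <= d by rewrite normr0 ltW.
pose g := c b1 - c 0; have g0 : 0 < g by rewrite subr_gt0.
have t1 : 0 < `|t0| + 1 by rewrite ltr_pwDr.
(* Small enough for [2 t0 e - g < 0 < 2 t0 e + g], so exchanging the two vectors in [central]
   reaches both signs. *)
pose e := Num.min d (g / (4 * (`|t0| + 1))).
have e0 : 0 < e by rewrite lt_min d0 divr_gt0// mulr_gt0.
have ed : e <= d by rewrite ge_min lexx.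
have te : `|2 * t0 * e| < g.
  have : e <= g / (4 * (`|t0| + 1)) by rewrite ge_min lexx orbT.
  rewrite ler_pdivlMr ?mulr_gt0// => h.
  rewrite !normrM (gtr0_norm e0) (ger0_norm (ler0n _ _)).
  by have := mulr_ge0 (normr_ge0 t0) (ltW e0); nra.
move: te; rewrite ltr_norml => /andP[te1 te2].
have B1 : (S (1, 0, 0)%R < +oo)%E.
  have up : 0 < 2 * t0 * e + g by lra.
  have iup : 0 <= (2 * t0 * e + g)^-1 by rewrite invr_ge0 ltW.
  have := BZ iup (central 0 b1 e dz b1d e0 ed).
  rewrite [X in S X](_ : _ = ((2 * t0 * e + g)^-1 * (2 * t0 * e + g),
    (2 * t0 * e + g)^-1 *: (0 : V), (2 * t0 * e + g)^-1 * 0))//.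
  by rewrite scaler0 mulr0 mulVf// gt_eqF.
have BN1 : (S (- 1, 0, 0)%R < +oo)%E.
  have up : 0 < g - 2 * t0 * e by lra.
  have iup : 0 <= (g - 2 * t0 * e)^-1 by rewrite invr_ge0 ltW.
  have := BZ iup (central b1 0 e b1d dz e0 ed).
  rewrite [X in S X](_ : _ = ((g - 2 * t0 * e)^-1 * (2 * t0 * e + (c 0 - c b1)),
    (g - 2 * t0 * e)^-1 *: (0 : V), (g - 2 * t0 * e)^-1 * 0))//.
  rewrite scaler0 mulr0 (_ : 2 * t0 * e + (c 0 - c b1) = - (g - 2 * t0 * e)).
    by rewrite mulrN mulVf// gt_eqF.
  by rewrite /g; ring.
have Bt (t : R) : (S (t, 0, 0)%R < +oo)%E.
  have [t0'|t0'] := leP 0 t.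
    have := BZ t0' B1.
    rewrite [X in S X](_ : _ = (t * 1, t *: (0 : V), t * 0))//.
    by rewrite scaler0 mulr0 mulr1.
  have Nt : 0 <= - t by lra.
  have := BZ Nt BN1.
  rewrite [X in S X](_ : _ = (- t * - 1, - t *: (0 : V), - t * 0))//.
  by rewrite scaler0 mulr0 mulrN mulr1 opprK.
have ei0 : 0 <= (e ^+ 2)^-1 by rewrite invr_ge0 sqr_ge0.
have en : e ^+ 2 != 0 by rewrite sqrf_eq0 gt_eqF.
have Bp : (S (0, 0, 1)%R < +oo)%E.
  have := BZ ei0 (BD (plus 0 e dz e0 ed) (Bt (c 0 - t0 * e))).
  rewrite [X in S X](_ : _ = ((e ^+ 2)^-1 * (t0 * e - c 0 + (c 0 - t0 * e)),
    (e ^+ 2)^-1 *: (0 + 0 : V), (e ^+ 2)^-1 * (e ^+ 2 + 0)))//.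
  by rewrite !addr0 scaler0 mulVf// subrKA subrr mulr0.
have Bm : (S (0, 0, - 1)%R < +oo)%E.
  have := BZ ei0 (BD (minus 0 e dz e0 ed) (Bt (- (t0 * e + c 0)))).
  rewrite [X in S X](_ : _ = ((e ^+ 2)^-1 * (t0 * e + c 0 - (t0 * e + c 0)),
    (e ^+ 2)^-1 *: (0 + 0 : V), (e ^+ 2)^-1 * (- e ^+ 2 + 0)))//.
  by rewrite !addr0 scaler0 mulrN mulVf// subrr mulr0.
have Bs (s : R) : (S (0, 0, s)%R < +oo)%E.
  have [s0'|s0'] := leP 0 s.
    have := BZ s0' Bp.
    rewrite [X in S X](_ : _ = (s * 0, s *: (0 : V), s * 1))//.
    by rewrite scaler0 mulr0 mulr1.
  have Ns : 0 <= - s by lra.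
  have := BZ Ns Bm.
  rewrite [X in S X](_ : _ = (- s * 0, - s *: (0 : V), - s * - 1))//.
  by rewrite scaler0 mulr0 mulrN mulr1 opprK.
have Breg (t : R) x (s : R) : s != 0 -> (S (t, x, s) < +oo)%E.
  move=> s0; rewrite Scenter//; have := BD (Bt (t - sqn x / (2 * s))) (Bs s).
  rewrite [X in S X](_ : _ = (t - sqn x / (2 * s) + 0, 0 + 0 : V, 0 + s))//.
  by rewrite !addr0 add0r.
move=> [[t x] s]; have [->|s0] := eqVneq s 0; last exact: Breg.
have := BD (Breg t x 1 (oner_neq0 _)) Bm.
rewrite [X in S X](_ : _ = (t + 0, x + 0, 1 - 1))//.
by rewrite !addr0 subrr.
Qed.


(* [S (0, y, s) = S (- |y|^2 / 2 s, 0, s)] stays bounded above as [s -> 0],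
   which forbids a positive value in either central direction. *)
Lemma central_le0 (sg : R) : sg ^+ 2 = 1 -> (forall eta, (S eta < +oo)%E) ->
  (S (sg, 0, 0)%R <= 0%:E)%E.
Proof.
move=> sg2 Sfin; have [y y0] := V_nontrivial; have N0 := emb_gt0 y0.
have Sy (s : R) : s != 0 -> S (0, y, s)%R = S (0 - sqn y / (2 * s), 0, s)%R.
  exact: Scenter.
move: (sqn y) N0 Sy => N N0 Sy.
have [z Sz] := sublinear_fin Ssub (Sfin (sg, 0, 0)%R).
have [r Sr] := sublinear_fin Ssub (Sfin (0, y, 0)%R).
have [f1 Sf1] := sublinear_fin Ssub (Sfin (0, 0, sg)%R).
have [f2 Sf2] := sublinear_fin Ssub (Sfin (0, 0, - sg)%R).
have [SD SZ _] := Ssub.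
have le (xi : osc V) (a : R) : S xi = a%:E -> (S xi <= a%:E)%E by move=> ->.
(* At [(0, y, - s sg)] the formula gives the central value [sg N / (2 s)], since [sg ^+ 2 = 1].
   Adding [(0, 0, s sg)] brings the height back to [0], and scaling by [2 s / N] leaves
   [(sg, 0, 0)]. *)
have zle (s : R) : 0 < s -> z <= 2 * s / N * (r + s * f2 + s * f1).
  move=> s0; have sgn0 : sg != 0 by rewrite -sqrf_eq0 sg2 oner_neq0.
  have h1 := SD _ _ _ _ (le _ _ Sr) (SZ _ _ _ (ltW s0) (le _ _ Sf2)).
  rewrite [X in S X](_ : _ = (0 + s * 0, y + s *: (0 : V), 0 + s * - sg)) in h1; last by [].
  rewrite scaler0 mulr0 !addr0 add0r Sy in h1; last first.
    by rewrite mulf_eq0 oppr_eq0 (negPf sgn0) gt_eqF.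
  have h2 := SD _ _ _ _ h1 (SZ _ _ _ (ltW s0) (le _ _ Sf1)).
  have c0 : 0 <= 2 * s / N by apply/ltW; rewrite divr_gt0 ?mulr_gt0.
  have := SZ _ _ _ c0 h2.
  rewrite [X in S X](_ : _ = (2 * s / N * (0 - N / (2 * (s * - sg)) + s * 0),
    (2 * s / N) *: (0 + s *: (0 : V)), 2 * s / N * (s * - sg + s * sg))); last by [].
  rewrite scaler0 addr0 scaler0 mulr0 addr0 mulrN addNr mulr0.
  have -> : 2 * s / N * (0 - N / (2 * - (s * sg))) = sg.
    rewrite -[RHS](mulfK sgn0) -expr2 sg2.
    by field; rewrite sgn0 !gt_eqF.
  by rewrite Sz lee_fin.
rewrite Sz lee_fin leNgt; apply/negP => z0.
pose q := `|r| + `|f1| + `|f2| + 1.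
have q0 : 0 < q by rewrite ltr_pwDr// !addr_ge0.
(* For [s <= 1] the bracket in [zle] is at most [q]; the other bound makes the right-hand side at
   most [z / 2]. *)
pose s := Num.min 1 (z * N / (4 * q)).
have s0 : 0 < s by rewrite lt_min ltr01 divr_gt0 ?mulr_gt0.
have s1 : s <= 1 by rewrite ge_min lexx.
have sz : s <= z * N / (4 * q) by rewrite ge_min lexx orbT.
have rq : r + s * f2 + s * f1 <= q.
  have b (f : R) : s * f <= `|f|.
    apply: le_trans (ler_norm _) _; rewrite normrM (gtr0_norm s0).
    by rewrite ler_piMl.
  by rewrite /q; have := ler_norm r; have := b f1; have := b f2; lra.
have c0 : 0 < 2 * s / N by rewrite divr_gt0 ?mulr_gt0.
have := le_trans (zle s s0) (ler_wpM2l (ltW c0) rq).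
rewrite mulrAC ler_pdivlMr//; rewrite ler_pdivlMr ?mulr_gt0// in sz.
by have := mulr_gt0 z0 N0; lra.
Qed.

(** For [s != 0] the formula moves the point into the plane, where the central part contributes at
    most [0] and [(0, 0, s)] at most [K |s|]. Height [0] is the sum of heights [d] and [- d] with
    [d] arbitrarily small. *)
Lemma growth_bound : (forall eta, (S eta < +oo)%E) ->
  exists2 K : R, 0 <= K & forall xi, (S xi <= (K * `|xi.2|)%:E)%E.
Proof.
move=> Sfin; have [SD SZ _] := Ssub.
have [f1 Sf1] := sublinear_fin Ssub (Sfin (0, 0, 1)%R).
have [f2 Sf2] := sublinear_fin Ssub (Sfin (0, 0, - 1)%R).
pose K := `|f1| + `|f2|.
have K0 : 0 <= K by rewrite addr_ge0.
have f1K : (S (0, 0, 1)%R <= K%:E)%E.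
  by rewrite Sf1 lee_fin; apply: le_trans (ler_norm _) _; rewrite lerDl.
have f2K : (S (0, 0, - 1)%R <= K%:E)%E.
  by rewrite Sf2 lee_fin; apply: le_trans (ler_norm _) _; rewrite lerDr.
have Ss (s : R) : (S (0, 0, s)%R <= (K * `|s|)%:E)%E.
  have [s0|s0] := leP 0 s.
    have := SZ _ _ _ s0 f1K.
    rewrite [X in S X](_ : _ = (s * 0, s *: (0 : V), s * 1)); last by [].
    by rewrite scaler0 mulr0 mulr1 mulrC ger0_norm.
  have Ns : 0 <= - s by lra.
  have := SZ _ _ _ Ns f2K.
  rewrite [X in S X](_ : _ = (- s * 0, - s *: (0 : V), - s * - 1)); last by [].
  by rewrite scaler0 mulr0 mulrN mulr1 opprK mulrC ltr0_norm.
have St (t : R) : (S (t, 0, 0)%R <= 0%:E)%E.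
  have [t0|t0] := leP 0 t.
    have := SZ _ _ _ t0 (central_le0 (expr1n _ _) Sfin).
    rewrite [X in S X](_ : _ = (t * 1, t *: (0 : V), t * 0)); last by [].
    by rewrite scaler0 !mulr0 mulr1.
  have Nt : 0 <= - t by lra.
  have s1 : (-1 : R) ^+ 2 = 1 by rewrite sqrrN expr1n.
  have := SZ _ _ _ Nt (central_le0 s1 Sfin).
  rewrite [X in S X](_ : _ = (- t * - 1, - t *: (0 : V), - t * 0)); last by [].
  by rewrite scaler0 !mulr0 mulrN mulr1 opprK.
have Sreg (t : R) x (s : R) : s != 0 -> (S (t, x, s) <= (K * `|s|)%:E)%E.
  move=> s0; rewrite Scenter//.
  have := SD _ _ _ _ (St (t - sqn x / (2 * s))) (Ss s).
  rewrite [X in S X](_ : _ = (t - sqn x / (2 * s) + 0, 0 + 0 : V, 0 + s)); last by [].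
  by rewrite !addr0 !add0r.
exists K => // -[[t x] s] /=; have [->|s0] := eqVneq s 0; last exact: Sreg.
have [r Sr] := sublinear_fin Ssub (Sfin (t, x, 0)%R).
rewrite Sr normr0 mulr0 lee_fin; apply/ler_addgt0Pr => e e0; rewrite add0r.
have K1 : 0 < 2 * (K + 1) by rewrite mulr_gt0// ltr_pwDr.
(* The two pieces cost [2 K d], which is at most [e]. *)
pose d := e / (2 * (K + 1)); have d0 : 0 < d by rewrite divr_gt0.
have := SD _ _ _ _ (Sreg t x d (lt0r_neq0 d0)) (Ss (- d)).
rewrite [X in S X](_ : _ = (t + 0, x + 0, d - d)); last by [].
rewrite !addr0 subrr Sr lee_fin normrN gtr0_norm// => /le_trans; apply.
have : d * (2 * (K + 1)) = e by rewrite divfK// gt_eqF.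
by nra.
Qed.

(** Since [0 <= S 0 <= S xi + S (- xi)], [growth_bound] at [xi] and [- xi] gives
    [|S xi| <= K |xi.2|]; so [S] vanishes at height [0], with a modulus of continuity there that
    involves the height alone. *)
Lemma sublinear_cvg_singular xi : xi.2 = 0 -> B° xi ->
  S @ within B° (norm_nbhs iota xi) --> S xi.
Proof.
case: xi => [[t0 x0] s0] /= -> /finite_everywhere Sfin.
have [K K0 SK] := growth_bound Sfin; have [SD _ _] := Ssub.
have SKN xi : exists2 r : R, S xi = r%:E & `|r| <= K * `|xi.2|.
  have [r Sr] := sublinear_fin Ssub (Sfin xi); exists r => //.
  have [z Sz] := sublinear_fin Ssub (Sfin 0).
  have := SK xi; rewrite Sr lee_fin => h1.
  have z0 : 0 <= z.
    have := SD 0 0 z z; rewrite addr0 Sz !lee_fin => /(_ (lexx _) (lexx _)); lra.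
  have := SD xi (- xi) r (K * `|xi.2|); rewrite Sr lee_fin => /(_ (lexx _)).
  rewrite -normrN => /(_ (SK (- xi))); rewrite subrr Sz lee_fin normrN => h2.
  by rewrite ler_norml h1 andbT; lra.
have [r0 Sxi r00] := SKN (t0, x0, 0).
rewrite Sxi => P rP; have /nbhs_ballP[eps /= eps0 epsP] : nbhs r0 (fun r => P r%:E).
  exact/nbhs_EFin.
have {r00} r00 : r0 = 0.
  by move: r00; rewrite /= normr0 mulr0 normr_le0 => /eqP.
have K1 : 0 < K + 1 by rewrite ltr_pwDr.
have c2 : (fun z : R^o * HA * R^o => z.2 : R) @ norm_chart iota (t0, x0, 0) --> 0.
  exact: (@continuous_snd _ _ (norm_chart iota (t0, x0, 0))).
have near_s : \forall z \near norm_chart iota (t0, x0, 0), `|0 - z.2| < eps / (K + 1).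
  by apply: (@cvgr_dist_lt R R^o _ _ _ (fun z => z.2) 0 c2); rewrite divr_gt0.
apply: (@filterS _ _ (norm_nbhs_filter _) _ _ _ (norm_nbhs_chart near_s)).
move=> xi /= h _; have [r Sr rK] := SKN xi; rewrite Sr; apply: epsP.
rewrite /ball /= r00 sub0r normrN; apply: le_lt_trans rK _.
move: h; rewrite sub0r normrN ltr_pdivlMr// => /(le_lt_trans _); apply.
by rewrite mulrC ler_wpM2l// lerDl.
Qed.

End norm_continuity.

Local Close Scope complex_scope.

Theorem proposition2p17 (R : realType)
    (V : tvsType R) (G : oscillator V)
    (HA : hilbertType R) (A : standard HA)
    (iota : {linear V -> Cinfty A}) (iotaP : standard_embedding G iota)
    (D_dense : dense (range (generator (gamma G))))
    (H : hilbertType R) (H_nontrivial : exists v : H, v != 0)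
    (pi : unitary_rep G H) (pi_smooth : smooth_rep pi) :
  (forall (t : R) (x : V) (s : R), s != 0 ->
     support_function pi (t, x, s) =
     support_function pi
       (t - hnorm (Cinfty_incl (iota x)) ^+ 2 / (2 * s), 0, s)) /\
  (forall xi : R^o * V * R^o, (support_domain pi)° xi ->
     support_function pi @ within (support_domain pi)° (norm_nbhs iota xi)
     --> support_function pi xi).
Proof.
have center := support_function_center iotaP pi_smooth H_nontrivial D_dense.
have Ssub := support_function_sublinear iotaP pi_smooth H_nontrivial.
split; first exact: center.
move=> xi Bxi; have [s0|s0] := eqVneq xi.2 0.
  exact: (sublinear_cvg_singular (iota_injective iotaP) (osc_nontrivial G)
    Ssub center s0 Bxi).
exact: (sublinear_cvg_regular Ssub center s0 Bxi).
Qed.
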